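(* Let $\lambda>0$, $\beta>0$, $\epsilon>0$ and a positive integer $\gamma$ be fixed with $0<\epsilon<\gamma^2\beta/4$. For each $r>0$ let $(Y^r,X^r)$ be the continuous-time Markov chain described in the context, with arrival rate $\lambda r$, and let $(\bar Y^r,\bar X^r)=r^{-1}(Y^r, X^r-\lambda r/\beta)$. Suppose the initial states are deterministic and $(\bar Y^r(0),\bar X^r(0))\to (y(0),x(0))$ as $r\to\infty$, for some fixed $(y(0),x(0))\in\mathbb{R}^2$ with $x(0)\ge -\lambda/\beta$. Then these processes can be constructed on a common probability space such that the following holds: there exists a unique locally Lipschitz trajectory $(y,x)=((y(t),x(t)),\,t\ge 0)$ such that, with probability $1$, $$(\bar Y^r,\bar X^r)\to (y,x)\quad\text{uniformly on compact subsets of }[0,\infty)\text{ as } r\to\infty,$$ where $x(t)\ge -\lambda/\beta$ for all $t\ge 0$, and at every regular point $t\ge 0$ (all $t\ge0$ except a set of zero Lebesgue measure are regular) the following holds: if $x(t)>-\lambda/\beta$ then $$y'(t)=\beta x(t),\qquad x'(t)=-\gamma\beta x(t)-\epsilon y(t),$$ and if $x(t)=-\lambda/\beta$ then $$y'(t)=-\lambda,\qquad x'(t)=[\gamma\lambda-\epsilon y(t)]\vee 0 .$$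
   Context: Model: For scaling parameter $r>0$, the process $(Y^r(t),X^r(t))$, $t\ge0$, is a continuous-time Markov chain on $\mathbb{Z}\times\mathbb{Z}_+$ ($Y^r$ = agent queue minus customer queue, $X^r$ = number of pending invited agents) whose transitions from state $(Y,X)$ are: (i) at rate $\lambda r$ (customer arrival): $Y\mapsto Y-1$, $X\mapsto X+\gamma$; (ii) at rate $\beta X$ (invitation acceptance): $Y\mapsto Y+1$, $X\mapsto X-(\gamma\wedge X)$; (iii) at rate $\epsilon|Y|$: if $X\ge1$, $X\mapsto X-\mathrm{sgn}(Y)$ ($Y$ unchanged); if $X=0$, $X\mapsto X+1$ when $Y<0$ and no change when $Y\ge0$. Here $\mathrm{sgn}(z)=1,0,-1$ for $z>0$, $z=0$, $z<0$. Notation: $a\vee b=\max\{a,b\}$, $a\wedge b=\min\{a,b\}$. A point $t$ is called regular (for the pair of functions $y,x$) if for every nonempty subset of $\{y,x\}$ the derivatives of the pointwise maximum and of the pointwise minimum over that subset exist at $t$ (both one-sided derivatives exist and are equal). *)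

(* Defs.v *)
From HB Require Import structures.
From mathcomp Require Import all_boot all_order all_algebra.
From mathcomp Require Import all_classical all_reals all_analysis.
Set Implicit Arguments. Unset Strict Implicit. Unset Printing Implicit Defensive.
Import Order.TTheory GRing.Theory Num.Theory.
Import numFieldNormedType.Exports.
Local Open Scope classical_set_scope.
Local Open Scope ring_scope.

Definition state := (int * nat)%type.

Section Model.
Variable R : realType.
Variables (lam beta eps : R) (gam : nat).

(** target of a customer arrival, rate lam * r *)
Definition tgt1 (z : state) : state := (z.1 - 1, (z.2 + gam)%N).
(** target of an invitation acceptance, rate beta * X *)
Definition tgt2 (z : state) : state := (z.1 + 1, (z.2 - minn gam z.2)%N).
Definition tgt3 (z : state) : state :=
  let: (Y, X) := z in
  if (0 < X)%N then
    (if 0 < Y then (Y, X.-1) else if Y < 0 then (Y, X.+1) else (Y, X))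
  else (if Y < 0 then (Y, 1%N) else (Y, X)).

(** transition rate from z to z' (self-loops, i.e. "no change", discarded) *)
Definition rate (r : R) (z z' : state) : R :=
  lam * r * (z' == tgt1 z)%:R
  + beta * (z.2)%:R * (z' == tgt2 z)%:R
  + eps * `|(z.1)%:~R : R| * ((z' == tgt3 z) && (z' != z))%:R.

Definition qtot (r : R) (z : state) : R :=
  lam * r + beta * (z.2)%:R + eps * `|(z.1)%:~R : R| * (tgt3 z != z)%:R.

Definition loc_lipschitz (f : R -> R) : Prop :=
  forall Tm : R, exists L : R, forall s u : R,
    0 <= s <= Tm -> 0 <= u <= Tm -> `|f s - f u| <= L * `|s - u|.

Definition regular_pt (y x : R -> R) (t : R) : Prop :=
  derivable y t 1 /\ derivable x t 1 /\
  derivable (fun s => Num.max (y s) (x s)) t 1 /\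
  derivable (fun s => Num.min (y s) (x s)) t 1.

Definition fluid_solution (y0 x0 : R) (y x : R -> R) : Prop :=
  y 0 = y0 /\ x 0 = x0 /\ loc_lipschitz y /\ loc_lipschitz x /\
  (forall t, 0 <= t -> - (lam / beta) <= x t) /\
  (forall t, 0 < t -> regular_pt y x t ->
     (- (lam / beta) < x t ->
        derive1 y t = beta * x t /\ derive1 x t = - (gam%:R * beta * x t) - eps * y t) /\
     (x t = - (lam / beta) ->
        derive1 y t = - lam /\ derive1 x t = Num.max (gam%:R * lam - eps * y t) 0)).
End Model.

Section Chain.
Variables (R : realType) (d : measure_display) (T : measurableType d).
Variable (P : probability T R).

(** (Z, S) is the jump chain / holding times of a CTMC with rates q, total
    rates qt, started at z0: Z n = state after n-th jump, S n = holding time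
    in Z n.  The law is specified via the joint distribution of
    (Z 0, .., Z n, S 0, .., S (n-1)). *)
Definition ctmc_jump_data (q : state -> state -> R) (qt : state -> R) (z0 : state)
    (Z : nat -> T -> state) (S : nat -> T -> R) : Prop :=
  (forall n z, measurable [set w | Z n w = z]) /\
  (forall n, measurable_fun setT (S n)) /\
  (forall (n : nat) (zs : nat -> state) (s : nat -> R), (forall k, 0 <= s k) ->
     P [set w | (forall k, (k <= n)%N -> Z k w = zs k) /\
                (forall k, (k < n)%N -> s k < S k w)]
     = ((zs 0%N == z0)%:R *
        \prod_(k < n) (expR (- (qt (zs k) * s k)) * (q (zs k) (zs k.+1) / qt (zs k))))%:E).

Definition jump_time (S : nat -> T -> R) (n : nat) (w : T) : R := \sum_(k < n) S k w.

Definition path_of (Z : nat -> T -> state) (S : nat -> T -> R) (V : T -> R -> state) : Prop :=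
  {ae P, forall w, forall (n : nat) (t : R),
     jump_time S n w <= t < jump_time S n.+1 w -> V w t = Z n w}.
End Chain.

(* Main.v *)
Require Import Defs.
From HB Require Import structures.
From mathcomp Require Import all_boot all_order all_algebra.
From mathcomp Require Import all_classical all_reals all_analysis measurable_realfun.
From mathcomp Require Import ring lra zify.
Set Implicit Arguments. Unset Strict Implicit. Unset Printing Implicit Defensive.
Import Order.TTheory GRing.Theory Num.Theory.
Import numFieldNormedType.Exports.
Local Open Scope classical_set_scope.
Local Open Scope ring_scope.

(** The chain is coupled over all scales at once in such a way that convergence in probability is
    enough.  On the space of fair coin tosses each chain is built from its jump chain and its
    exponential holding times.  For [Y], [X] and the number of jumps, the sums of the increments
    minus the compensators form martingales, and a one-line induction along the Markov property
    bounds the probability that they leave [[-a, a]] within [N] jumps by [C N / a^2].  With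
    [r = s^4], [a = s^3] and [N] of order [s^5] this probability is [O(1/s)].  The seed of the
    [r]-th chain is then redrawn, by rejection, so that its law is unchanged while the chain is
    good as soon as a common uniform variable is below the probability of the good event;
    almost surely all chains of large scale are good.

    On the good event the path follows, up to a vanishing error, a piecewise linear curve whose
    slope is the fluid drift plus a nonnegative push that acts only near the boundary.  Two such
    approximate solutions stay close: the push terms contribute nothing positive to the squared
    distance, and Gronwall's inequality applies.  Hence the good paths form a Cauchy sequence,
    their limit is a fluid solution, and it is the only one; uniqueness for Lipschitz solutions
    rests on their almost everywhere differentiability, obtained from the Radon-Nikodym and
    Lebesgue differentiation theorems. *)


(** * Lipschitz functions of one variable *)

(** The scale [r] runs over the uncountable set of positive reals, so null sets attached to single
    scales cannot be collected, and a Borel-Cantelli argument along a sequence would not suffice.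
    This is why a chain has to be good surely, not just almost surely, once the common uniform
    variable is small enough: a single null event then serves all scales. Only the law of each chain
    is prescribed, which leaves the joint law free for this purpose.

    The transition rates grow linearly with the state, so no bound on the compensators is available
    at the outset. The maximal inequality is therefore run along the number of jumps, because the
    increments are bounded by [gam%:R + 1] whatever the rates. The count of jumps, itself
    compensated, converts [N] jumps back into elapsed time once an energy estimate has bounded the
    path up to its [N]-th jump.

    Existence of the fluid trajectory needs no compactness argument: good paths are selected
    deterministically along the integer scales, and the estimate behind uniqueness also controls
    their differences. *)

Section one_lipschitz.
Context {R : realType}.
Variable h : R -> R.
Hypothesis h_lip : forall s t, `|h s - h t| <= `|s - t|.
Local Notation mu := (@lebesgue_measure R).

(* [F] and [G] are nondecreasing with [F + G = id], so their Stieltjes measures add up to the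
   Lebesgue measure and are absolutely continuous with respect to it. *)
Let F (t : R) : R := (t + h t) / 2.
Let G (t : R) : R := (t - h t) / 2.

Let lip_cvg (k : R -> R) : (forall s t, `|k s - k t| <= `|s - t|) -> continuous k.
Proof.
move=> kl x; apply/cvgrPdist_lt => e e0; near=> t.
apply: (le_lt_trans (kl _ _)); near: t.
by move: e e0; apply/cvgrPdist_lt; exact: cvg_id.
Unshelve. all: by end_near. Qed.

Let h_bnd s t : s <= t -> (h t - h s <= t - s) && (s - t <= h t - h s).
Proof.
move=> st; have := h_lip t s; rewrite (ger0_norm (x := t - s)) ?subr_ge0//.
rewrite ler_norml; lra.
Qed.

Let F_nd : {homo F : x y / x <= y}.
Proof. by move=> s t st; have := h_bnd st; rewrite /F; lra. Qed.
Let G_nd : {homo G : x y / x <= y}.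
Proof. by move=> s t st; have := h_bnd st; rewrite /G; lra. Qed.

Let F_rc : right_continuous F.
Proof.
apply: right_continuousW; apply: lip_cvg => s t.
wlog st : s t / s <= t.
  by move=> H; have [/H//|/ltW/H] := leP s t; rewrite distrC [X in _ <= X]distrC.
have := h_bnd st; have := F_nd st => f1 f2.
by rewrite distrC (distrC s) !ger0_norm ?subr_ge0//; rewrite /F; lra.
Qed.
Let G_rc : right_continuous G.
Proof.
apply: right_continuousW; apply: lip_cvg => s t.
wlog st : s t / s <= t.
  by move=> H; have [/H//|/ltW/H] := leP s t; rewrite distrC [X in _ <= X]distrC.
have := h_bnd st; have := G_nd st => f1 f2.
by rewrite distrC (distrC s) !ger0_norm ?subr_ge0//; rewrite /G; lra.
Qed.

HB.instance Definition _ := isCumulative.Build R _ R F F_nd F_rc.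
HB.instance Definition _ := isCumulative.Build R _ R G G_nd G_rc.

Let muF := lebesgue_stieltjes_measure F.
Let muG := lebesgue_stieltjes_measure G.

Let muF_itv a b : a <= b -> muF `]a, b]%classic = (F b - F a)%:E.
Proof.
move=> ab; rewrite /muF /lebesgue_stieltjes_measure/= /measure_extension.
rewrite measurable_mu_extE/= ?wlength_itv_bnd//; exact: is_ocitv.
Qed.
Let muG_itv a b : a <= b -> muG `]a, b]%classic = (G b - G a)%:E.
Proof.
move=> ab; rewrite /muG /lebesgue_stieltjes_measure/= /measure_extension.
rewrite measurable_mu_extE/= ?wlength_itv_bnd//; exact: is_ocitv.
Qed.

Let muFG A : measurable A -> mu A = (muF A + muG A)%E.
Proof.
move=> mA; rewrite -measure_addE.
apply: (@lebesgue_measure_unique R (measure_add muF muG)) => //.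
move=> X /ocitvP[->|[[a b]/= ab ->]]; first by rewrite !measure0.
apply: (eq_trans _ (esym (measure_addE muF muG _))).
apply: (eq_trans _ (esym (congr2 adde (muF_itv (ltW ab)) (muG_itv (ltW ab))))).
rewrite lebesgue_measure_itv/= lte_fin ab; congr (_%:E).
rewrite /F /G. lra.
Qed.

(** Since [h = 2 F - id], the Radon-Nikodym density [g] of the Stieltjes measure of [F] yields the
    derivative [2 g - 1] of [h] wherever the fundamental theorem of calculus applies to [g]. *)
Lemma one_lipschitz_density (a b : R) : a < b -> exists g : R -> R,
  [/\ forall x, 0 <= g x, measurable_fun [set: R] g,
      forall t, a <= t <= b -> (F t - F a)%:E = (\int[mu]_(x in `]a, t]) (g x)%:E)%E &
      {ae mu, forall x, a < x < b -> derivable h x 1 /\ derive1 h x = 2 * g x - 1}].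
Proof.
move=> ab.
have mab : measurable (`]a, b]%classic : set (measurableTypeR R)) by exact: measurable_itv.
(* The restriction to []a, b]] makes the Stieltjes measure finite, as the Radon-Nikodym theorem
   requires here. *)
have fin : (muF `]a, b]%classic < +oo)%E by rewrite muF_itv ?ltW// ltry.
pose nu := mfrestr mab fin.
have dom : nu `<< mu.
  apply/null_content_dominatesP => A mA muA0.
  have : (muF A + muG A = 0)%E by rewrite -muFG.
  move/eqP; rewrite padde_eq0// => /andP[/eqP muFA _].
  apply/eqP; rewrite eq_le measure_ge0 andbT -muFA.
  by rewrite /nu /mfrestr /mrestr/= le_measure ?inE//; exact: measurableI.
have [g0 [g00 g0fin g0int nuE]] := @radon_nikodym_sigma_finite _ _ _ mu nu dom.
pose g := fine \o g0.
have gE : EFin \o g = g0 by apply/funext => x; rewrite /g/= fineK.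
have FE t : a <= t <= b -> (F t - F a)%:E = (\int[mu]_(x in `]a, t]) (g x)%:E)%E.
  move=> /andP[at_ tb]; rewrite -muF_itv//.
  transitivity (nu `]a, t]%classic).
    rewrite /nu /mfrestr /mrestr/= setIidl//.
    by move=> x/=; rewrite !in_itv/= => /andP[-> /le_trans->].
  apply: (etrans (nuE _ _)); first exact: measurable_itv.
  by apply: eq_integral => x _; rewrite -[in LHS]gE.
have gint : mu.-integrable setT (EFin \o g) by rewrite gE.
exists g; split => //; first by move=> x; rewrite /g/= fine_ge0.
  by apply/measurable_EFinP; exact: measurable_int gint.
have gloc : locally_integrable setT g.
  by apply: open_integrable_locally => //; exact: openT.
have gint' y : mu.-integrable `]a, y] (EFin \o g).
  by apply: (integrableS _ _ _ gint) => //; exact: measurable_itv.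
have := @FTC1 R g (BRight a) gint' gloc.
apply: filterS; first exact: (ae_filter_ringOfSetsType mu).
move=> x Hx /andP[ax xb].
have /Hx[dF F'] : (BRight a < BRight x)%O by rewrite bnd_simp.
set K := (fun y => _) in dF F'.
have near_eq : \forall y \near x, h y = 2 * (K y + F a) - y.
  near=> y.
  have ay : a <= y <= b.
    apply/andP; split; apply/ltW; near: y; [exact: lt_nbhsr|exact: lt_nbhsl].
  have := FE _ ay; rewrite /K /Rintegral => <- /=; rewrite /F; lra.
have dK : is_derive x 1 K (g x) by rewrite -F' derive1E; exact: DeriveDef.
have dh : is_derive x 1 (fun y => 2 * (K y + F a) - y) (2 * g x - 1).
  have -> : 2 * g x - 1 = 2 *: (g x + 0) - 1 by rewrite addr0.
  exact: is_deriveB.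
have near_eq' : \forall y \near x, 2 * (K y + F a) - y = h y.
  by apply: filterS near_eq => y ->.
split; first by apply: near_eq_derivable near_eq' _; exact: ex_derive.
by rewrite derive1E -(near_eq_derive _ near_eq'); exact: derive_val.
Unshelve. all: by end_near. Qed.

End one_lipschitz.

Definition lip_on {R : realType} (a b L : R) (f : R -> R) : Prop :=
  forall s t, a <= s <= b -> a <= t <= b -> `|f s - f t| <= L * `|s - t|.

(** * Almost everywhere calculus for functions Lipschitz on an interval *)

Section lipschitz_on.
Context {R : realType}.
Local Notation mu := (@lebesgue_measure R).

(** Projection onto [[a, b]]: composing with it extends a function Lipschitz on the interval to the
    whole line, with the same constant. *)
Let clamp (a b t : R) := Num.min (Num.max t a) b.

Let clamp_in (a b t : R) : a <= b -> a <= clamp a b t <= b.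
Proof.
move=> ab; rewrite /clamp /Num.min /Num.max.
by case: (ltP t a) => ?; case: ltP => ?; lra.
Qed.

Let clamp_id (a b t : R) : a <= t <= b -> clamp a b t = t.
Proof.
move=> /andP[at_ tb]; rewrite /clamp /Num.min /Num.max.
by case: (ltP t a) => ?; case: ltP => ?; lra.
Qed.

Let clamp_lip (a b s t : R) : a <= b -> `|clamp a b s - clamp a b t| <= `|s - t|.
Proof.
move=> ab; wlog st : s t / s <= t.
  by move=> H; have [/H//|/ltW/H] := leP s t; rewrite distrC [X in _ <= X]distrC.
rewrite distrC (distrC s) (ger0_norm (x := t - s)) ?subr_ge0//.
rewrite ler_norml /clamp /Num.min /Num.max.
by case: (ltP t a) => ?; case: ltP => ?; case: (ltP s a) => ?; case: ltP => ?; lra.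
Qed.

(** After division by [M] the extended function is 1-Lipschitz. The constant [M] is kept apart from
    [L], which may fail to be positive, and can be enlarged to suit the bound to be proved. *)
Lemma lip_on_density (a b L M : R) (f : R -> R) : a < b -> lip_on a b L f ->
  L <= M -> 0 < M -> exists g : R -> R,
  [/\ forall x, 0 <= g x, measurable_fun [set: R] g,
      ((b - a + (f b - f a) / M) / 2)%:E = (\int[mu]_(x in `]a, b[) (g x)%:E)%E &
      {ae mu, forall x, a < x < b -> derivable f x 1 /\ derive1 f x = M * (2 * g x - 1)}].
Proof.
move=> ab fL LM M0.
pose h t := f (clamp a b t) / M.
have h_lip s t : `|h s - h t| <= `|s - t|.
  rewrite /h -mulrBl normrM [X in _ * X]gtr0_norm ?invr_gt0//.
  rewrite ler_pdivrMr//.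
  apply: (le_trans (fL _ _ (clamp_in s (ltW ab)) (clamp_in t (ltW ab)))).
  apply: (@le_trans _ _ (M * `|clamp a b s - clamp a b t|)).
    by rewrite ler_wpM2r.
  by rewrite [leRHS]mulrC ler_wpM2l ?clamp_lip// ltW.
have [g [g0 gint gE gae]] := one_lipschitz_density h_lip ab.
exists g; split => //.
  rewrite integral_itv_bndo_bndc; last first.
    by apply/measurable_EFinP; exact: measurable_funTS.
  rewrite -gE ?lexx ?ltW// /h !clamp_id ?lexx ?ltW//; congr (_%:E).
  rewrite mulrBl; lra.
move: gae; apply: filterS; first exact: (ae_filter_ringOfSetsType mu).
move=> x Hx /[dup] axb /andP[ax xb]; have [dh h'] := Hx axb.
have near_eq : \forall y \near x, M *: h y = f y.
  near=> y.
  rewrite /h clamp_id; first by rewrite /GRing.scale/=; field; rewrite gt_eqF.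
  apply/andP; split; apply/ltW; near: y; [exact: lt_nbhsr|exact: lt_nbhsl].
have dMh : is_derive x 1 (fun y => M *: h y) (M *: (2 * g x - 1)).
  by rewrite -h' derive1E; apply: is_deriveZ; exact: DeriveDef.
split; first by apply: near_eq_derivable near_eq _; exact: ex_derive.
by rewrite derive1E -(near_eq_derive _ near_eq); exact: derive_val.
Unshelve. all: by end_near. Qed.

Lemma lip_on_ae_derivable (a b L : R) (f : R -> R) : lip_on a b L f ->
  {ae mu, forall x, a < x < b -> derivable f x 1}.
Proof.
move=> fL; have [ba|ab] := leP b a.
  by apply: aeW => x /andP[ax xb]; have := lt_trans ax xb; rewrite ltNge ba.
have LM : L <= `|L| + 1 by rewrite (le_trans (ler_norm L))// lerDl.
have [g [_ _ _]] := lip_on_density ab fL LM (ltr_wpDl (normr_ge0 L) ltr01).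
apply: filterS; first exact: (ae_filter_ringOfSetsType mu).
by move=> x Hx /Hx[].
Qed.

(** A Lipschitz function is the integral of its derivative, so a bound valid almost everywhere
    suffices. Derivability is a premise inside that bound, which spares the callers from
    establishing it. *)
Lemma lip_on_ae_le (a b L c : R) (f : R -> R) : a <= b -> lip_on a b L f ->
  {ae mu, forall x, a < x < b -> derivable f x 1 -> derive1 f x <= c} ->
  f b - f a <= c * (b - a).
Proof.
rewrite le_eqVlt => /orP[/eqP -> _ _|ab fL fae]; first by rewrite !subrr mulr0.
pose M : R := `|L| + `|c| + 1.
have M0 : 0 < M by rewrite /M ltr_wpDl// addr_ge0.
have LM : L <= M.
  by rewrite (le_trans (ler_norm L))// /M -addrA lerDl addr_ge0.
have cM : - M <= c.
  have := ler_norm (- c); rewrite normrN => ?; have := normr_ge0 L; rewrite /M; lra.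
have [g [g0 gint gE gae]] := lip_on_density ab fL LM M0.
(* [k] solves [M * (2 * k - 1) = c]. The choice of [M] above [|c|] makes [k] nonnegative, so that
   integrals of nonnegative functions can be compared. *)
pose k := (c / M + 1) / 2.
have k0 : 0 <= k.
  rewrite /k divr_ge0// -lerBlDr sub0r ler_pdivlMr//; lra.
have gk : {ae mu, forall x, `]a, b[%classic x -> ((g x)%:E <= k%:E)%E}.
  move: fae gae; apply: filterS2; first exact: (ae_filter_ringOfSetsType mu).
  move=> x H1 H2; rewrite /= in_itv/= => axb.
  have [dx ex] := H2 axb; have := H1 axb dx; rewrite ex => H.
  rewrite lee_fin /k ler_pdivlMr// -lerBlDr ler_pdivlMr//; lra.
have : (((b - a + (f b - f a) / M) / 2)%:E <= (k * (b - a))%:E)%E.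
  rewrite gE; apply: (@le_trans _ _ (\int[mu]_(x in `]a, b[) k%:E)%E).
    apply: ae_ge0_le_integral => //.
    - by move=> x _; rewrite lee_fin.
    - by apply/measurable_EFinP; exact: measurable_funTS.
  by rewrite integral_cst//= lebesgue_measure_itv/= lte_fin ab.
rewrite lee_fin /k => H.
have H' : (f b - f a) / M <= c / M * (b - a) by lra.
by rewrite mulrAC ler_pM2r ?invr_gt0// in H'.
Qed.

Lemma lip_on_bounded (a b L : R) (f : R -> R) : a <= b -> lip_on a b L f ->
  exists2 B, 0 <= B & forall t, a <= t <= b -> `|f t| <= B.
Proof.
move=> ab fL; exists (`|f a| + `|L| * (b - a)).
  by rewrite addr_ge0// mulr_ge0// subr_ge0.
move=> t /[dup] tab /andP[at_ tb].
have -> : f t = f a + (f t - f a) by ring.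
rewrite (le_trans (ler_normD _ _))// lerD2l.
rewrite (le_trans (fL t a tab _)) ?lexx// (@le_trans _ _ (`|L| * `|t - a|))//.
  by rewrite ler_wpM2r// ler_norm.
by rewrite ler_wpM2l// ger0_norm ?subr_ge0// lerB.
Qed.

Lemma lip_onM (a b L M : R) (f g : R -> R) : a <= b ->
  lip_on a b L f -> lip_on a b M g -> exists K, lip_on a b K (fun t => f t * g t).
Proof.
move=> ab fL gM.
have [A A0 fA] := lip_on_bounded ab fL; have [B B0 gB] := lip_on_bounded ab gM.
exists (`|L| * B + A * `|M|) => s t sab tab.
have -> : f s * g s - f t * g t = (f s - f t) * g s + f t * (g s - g t) by ring.
rewrite (le_trans (ler_normD _ _))// [leRHS]mulrDl !normrM lerD//.
  rewrite mulrAC ler_pM// ?gB//.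
  by rewrite (le_trans (fL _ _ sab tab))// ler_wpM2r// ler_norm.
rewrite -mulrA ler_pM// ?fA//.
by rewrite (le_trans (gM _ _ sab tab))// ler_wpM2r// ler_norm.
Qed.

Lemma lip_onD (a b L M : R) (f g : R -> R) :
  lip_on a b L f -> lip_on a b M g -> lip_on a b (L + M) (fun t => f t + g t).
Proof.
move=> fL gM s t sab tab.
have -> : f s + g s - (f t + g t) = (f s - f t) + (g s - g t) by ring.
by rewrite (le_trans (ler_normD _ _))// [leRHS]mulrDl lerD ?fL ?gM.
Qed.

Lemma lip_on_expR (b C : R) : 0 <= C ->
  lip_on 0 b C (fun t => expR (- (C * t))).
Proof.
move=> C0 s t; wlog st : s t / s <= t.
  move=> H sab tab; have [/H|/ltW/H] := leP s t; first exact.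
  by move=> /(_ tab sab); rewrite distrC (distrC t s).
move=> /andP[s0 _] /andP[t0 _].
have e1 : expR (- (C * t)) <= expR (- (C * s)) by rewrite ler_expR lerN2 ler_wpM2l.
rewrite ger0_norm ?subr_ge0// distrC ger0_norm ?subr_ge0//.
have -> : - (C * t) = - (C * s) + - (C * (t - s)) by ring.
rewrite expRD.
have e2 := expR_ge1Dx (- (C * (t - s))).
have e3 : expR (- (C * s)) <= 1 by rewrite -expR0 ler_expR oppr_le0 mulr_ge0.
have e4 := expR_ge0 (- (C * s)).
have e5 : 0 <= C * (t - s) by rewrite mulr_ge0// subr_ge0.
set E := expR (- (C * s)) in e3 e4 *; set X := expR (- (C * (t - s))) in e2 *.
have : E * (1 - X) <= 1 * (C * (t - s)).
  apply: (@le_trans _ _ (E * (C * (t - s)))); first by rewrite ler_wpM2l//; lra.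
  by rewrite ler_wpM2r.
lra.
Qed.

(** The function [expR (- (C * t)) * D t] has derivative at most [expR (- (C * t)) * K], hence at
    most [K], and [lip_on_ae_le] applies to it. *)
Lemma gronwall_ae (b L C K : R) (D : R -> R) : 0 <= C -> 0 <= K -> 0 <= b ->
  lip_on 0 b L D ->
  {ae mu, forall x, 0 < x < b -> derivable D x 1 -> derive1 D x <= C * D x + K} ->
  D b <= (D 0 + K * b) * expR (C * b).
Proof.
move=> C0 K0 b0 DL Dae.
pose g t := expR (- (C * t)) * D t.
have [M gM] : exists M, lip_on 0 b M g by apply: lip_onM b0 _ DL; exact: lip_on_expR.
have gae : {ae mu, forall x, 0 < x < b -> derivable g x 1 -> derive1 g x <= K}.
  move: (lip_on_ae_derivable DL) Dae.
  apply: filterS2; first exact: (ae_filter_ringOfSetsType mu).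
  move=> x H1 H2 xb _; have dx := H1 xb; have := H2 xb dx.
  have dD : is_derive x 1 D (derive1 D x) by rewrite derive1E; exact: DeriveDef.
  have dE : is_derive x 1 (fun t => expR (- (C * t))) (- C * expR (- (C * x))).
    have dl : is_derive x 1 (fun t : R => - (C * t)) (- C).
      by have := is_deriveN (is_deriveZ C (is_derive_id x 1)); rewrite /GRing.scale/= mulr1.
    have := @is_derive1_comp _ expR (fun t : R => - (C * t)) x _ _
      (is_derive_expR (- (C * x))) dl.
    by rewrite mulrC.
  have dg : is_derive x 1 g (expR (- (C * x)) * derive1 D x + D x * (- C * expR (- (C * x)))).
    exact: is_deriveM.
  rewrite [derive1 g x]derive1E (@derive_val _ _ _ _ _ _ _ dg) => H.
  have e0 := expR_ge0 (- (C * x)).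
  have e1 : expR (- (C * x)) <= 1.
    by rewrite -expR0 ler_expR oppr_le0 mulr_ge0//; case/andP: xb => /ltW.
  set E := expR _ in e0 e1 *.
  have : E * (derive1 D x - C * D x) <= E * K by rewrite ler_wpM2l//; lra.
  have : E * K <= 1 * K by rewrite ler_wpM2r.
  lra.
have := lip_on_ae_le b0 gM gae; rewrite subr0 /g mulr0 oppr0 expR0 mul1r => H.
have {}H : expR (- (C * b)) * D b <= D 0 + K * b by lra.
by rewrite expRN mulrC ler_pdivrMr ?expR_gt0 in H.
Qed.

End lipschitz_on.

(** * Independent coin tosses *)

Definition cyl (n : nat) (c : nat -> bool) : set (nat -> bool) :=
  [set w | forall i, (i < n)%N -> w i = c i].

(** Two cylinders are nested or disjoint, so adding the empty set makes them closed under
    intersection, as uniqueness of measures requires. *)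
Definition cyls : set (set (nat -> bool)) :=
  [set A | A = set0 \/ exists n c, A = cyl n c].

Definition coins := g_sigma_algebraType cyls.
HB.instance Definition _ := Measurable.on coins.

Lemma cyls_setI : setI_closed cyls.
Proof.
move=> A B [->|[n [c ->]]] [->|[m [c' ->]]];
  rewrite ?set0I ?setI0; try by left.
wlog nm : n m c c' / (n <= m)%N.
  move=> H; have [/H|/ltnW/H] := leqP n m; first exact.
  by rewrite setIC; exact.
have [e|ne] := pselect (cyl n c c').
  right; exists m, c'; apply/seteqP; split => [w [_ //]|w w'].
  by split=> // i ni; rewrite w' ?e//; exact: leq_trans nm.
left; rewrite -subset0 => w [w1 w2]; apply: ne => i ni.
by rewrite -w1// w2//; exact: leq_trans nm.
Qed.

Lemma measurable_cyl n c : measurable (cyl n c : set coins).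
Proof. by apply: sub_sigma_algebra; right; exists n, c. Qed.

Lemma measurable_coin n b : measurable ([set w | w n = b] : set coins).
Proof.
pose c (s : seq bool) i := if i == n then b else nth false s i.
have -> : [set w | w n = b] = \bigcup_(s in [set: seq bool]) (cyl n.+1 (c s)).
  apply/seteqP; split=> [w /= wn|w [s _ /(_ n (leqnn _))]]; last first.
    by rewrite /c eqxx.
  exists (mkseq w n.+1) => // i ni; rewrite /c; case: eqP => [->//|_].
  by rewrite nth_mkseq.
by apply: countable_bigcupT_measurable => [|s]; [exact: countableP|exact: measurable_cyl].
Qed.

Lemma measurable_fun_coins d (T : measurableType d) (f : T -> coins) :
  (forall n, measurable [set t | f t n]) -> measurable_fun setT f.
Proof.
move=> mf; apply: (@measurability _ _ _ _ setT f cyls) => //.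
move=> _ [_ [->|[n [c ->]]] <-]; first by rewrite preimage_set0 setI0; exact: measurable0.
rewrite setTI.
have -> : f @^-1` cyl n c = \bigcap_(i in `I_n) [set t | f t i = c i].
  by apply/seteqP; split=> t /= h i; exact: h.
apply: bigcap_measurableType => // i _.
case: (c i); first exact: mf.
have -> : [set t | f t i = false] = ~` [set t | f t i].
  by apply/seteqP; split=> t /=; [move=> ->|move/negP/negbTE].
by apply: measurableC; exact: mf.
Qed.

Definition coin_shift (w : coins) : coins := fun n => w n.+1.
(** Each of the two halves is again a sequence of fair coins and can be split further, so one seed
    supplies all the randomness of a chain. *)
Definition evens (w : coins) : coins := fun n => w n.*2.
Definition odds (w : coins) : coins := fun n => w n.*2.+1.

Lemma measurable_coin_shift : measurable_fun setT coin_shift.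
Proof. by apply: measurable_fun_coins => n; exact: measurable_coin. Qed.
Lemma measurable_evens : measurable_fun setT evens.
Proof. by apply: measurable_fun_coins => n; exact: measurable_coin. Qed.
Lemma measurable_odds : measurable_fun setT odds.
Proof. by apply: measurable_fun_coins => n; exact: measurable_coin. Qed.

Lemma measurable_coin_shiftl A : measurable A -> measurable (coin_shift @^-1` A).
Proof. by move=> mA; rewrite -[X in measurable X]setTI; exact: measurable_coin_shift. Qed.
Lemma measurable_evensl A : measurable A -> measurable (evens @^-1` A).
Proof. by move=> mA; rewrite -[X in measurable X]setTI; exact: measurable_evens. Qed.
Lemma measurable_oddsl A : measurable A -> measurable (odds @^-1` A).
Proof. by move=> mA; rewrite -[X in measurable X]setTI; exact: measurable_odds. Qed.

(** * Binary digits of a real number *)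

Section digits.
Context {R : realType}.
Local Notation mu := (@lebesgue_measure R).

(** The doubling map of the unit interval; its itinerary through the two halves is the binary
    expansion. *)
Definition doubling (x : R) : R := if x < 2^-1 then 2 * x else 2 * x - 1.
Definition digits (x : R) : coins := fun n => 2^-1 <= iter n doubling x.

Lemma digitsS x n : digits x n.+1 = digits (doubling x) n.
Proof. by rewrite /digits iterSr. Qed.

Lemma measurable_doubling : measurable_fun setT doubling.
Proof.
apply: measurable_fun_if => //; first exact: measurable_fun_ltr.
by apply: measurable_funB.
Qed.

Lemma measurable_digits : measurable_fun setT digits.
Proof.
apply: measurable_fun_coins => n.
have mi : measurable_fun setT (iter n doubling).
  elim: n => [|n IH]; first exact: measurable_id.
  exact: measurableT_comp measurable_doubling IH.
rewrite -[X in measurable X]setTI.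
have : measurable_fun setT (fun x => 2^-1 <= iter n doubling x) by exact: measurable_fun_ler.
move=> /(_ measurableT [set true] I).
by congr (measurable (_ `&` _)).
Qed.

Fixpoint dyadic (n : nat) (c : nat -> bool) : R :=
  if n is n'.+1 then ((c 0%N)%:R + dyadic n' (fun i => c i.+1)) / 2 else 0.

Lemma dyadic_ge0 n c : 0 <= dyadic n c.
Proof. by elim: n c => //= n IH c; rewrite divr_ge0// addr_ge0. Qed.

Lemma dyadic_le n c : dyadic n c + 2 ^- n <= 1.
Proof.
elim: n c => [|n IH] c /=; first by rewrite add0r expr0 invr1.
have := IH (fun i => c i.+1).
rewrite exprS invfM.
by case: (c 0%N) => /=; lra.
Qed.

Lemma digits_cyl n c x : 0 <= x < 1 ->
  cyl n c (digits x) <-> dyadic n c <= x < dyadic n c + 2 ^- n.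
Proof.
elim: n c x => [|n IH] c x x01 /=; first by rewrite add0r expr0 invr1; split.
have d0 := dyadic_ge0 n (fun i => c i.+1).
have d1 := dyadic_le n (fun i => c i.+1).
have Tx : 0 <= doubling x < 1.
  by rewrite /doubling; case: ltP => ?; move: x01; lra.
have -> : cyl n.+1 c (digits x) <->
    (2^-1 <= x) = c 0%N /\ cyl n (fun i => c i.+1) (digits (doubling x)).
  split=> [h|[h0 h]].
    split; first exact: (h 0%N).
    by move=> i ni; rewrite -digitsS; exact: h.
  by move=> [|i] ni; [exact: h0|rewrite digitsS; exact: h].
rewrite IH//.
have -> : 2 ^- n.+1 = 2 ^- n / 2 :> R.
  by rewrite exprS invfM mulrC.
set q := 2 ^- n in d1 *; set e := dyadic _ _ in d0 d1 *.
rewrite /doubling; case: (c 0%N) => /=; case: ltP => h.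
- split=> [[]//|]; lra.
- split=> [[_]|]; first lra.
  by move=> ?; split => //; lra.
- split=> [[_]|]; first lra.
  by move=> ?; split => //; lra.
- split=> [[]//|]; lra.
Qed.

End digits.

(** * The fair coin measure and the independence of its halves *)

Section coin_probability.
Context {R : realType}.
Local Notation mu := (@lebesgue_measure R).

Definition unif01 := mrestr mu (measurable_itv `[0%R, 1%R[).
HB.instance Definition _ := Measure.on unif01.

Lemma unif01E A : unif01 A = mu (A `&` `[0, 1[%classic).
Proof. by []. Qed.

Let unif01T : unif01 setT = 1%E.
Proof. by rewrite unif01E setTI lebesgue_measure_itv/= lte_fin ltr01 oppr0 adde0. Qed.
HB.instance Definition _ := Measure_isProbability.Build _ _ _ unif01 unif01T.

Let mdigits : measurable_fun [set: measurableTypeR R] (@digits R : _ -> coins).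
Proof. exact: measurable_digits. Qed.

HB.instance Definition _ := isMeasurableFun.Build _ _ (measurableTypeR R) coins
  (@digits R : measurableTypeR R -> coins) mdigits.

(** The law of the binary digits of a uniform point, in place of an infinite product of two-point
    measures. *)
Definition coinP : probability coins R :=
  distribution unif01 ((@digits R : measurableTypeR R -> coins) : {mfun _ >-> _}).

Lemma coinP_cyl n c : coinP (cyl n c) = (2 ^- n)%:E.
Proof.
rewrite /coinP /= /distribution /pushforward unif01E.
have -> : digits @^-1` cyl n c `&` `[0, 1[ =
    `[dyadic n c, dyadic n c + 2 ^- n[%classic :> set R.
  have d0 := @dyadic_ge0 R n c; have d1 := @dyadic_le R n c.
  apply/seteqP; split=> x /=; rewrite !in_itv/=.
    by move=> [h x01]; exact/digits_cyl.
  move=> h; have x01 : 0 <= x < 1 by move: h; lra.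
  by split => //; exact/digits_cyl.
rewrite lebesgue_measure_itv/= lte_fin ltrDl invr_gt0 exprn_gt0//.
by rewrite -EFinD; congr (_%:E); ring.
Qed.

Lemma coins_measure_unique (m1 m2 : {measure set coins -> \bar R}) :
  (forall n c, m1 (cyl n c) = m2 (cyl n c)) -> (m1 setT < +oo)%E ->
  forall A, measurable A -> m1 A = m2 A.
Proof.
move=> mE m1fin A mA.
have cyl0 : cyl 0 (fun=> true) = setT by apply/seteqP; split.
apply: (@measure_unique _ R coins cyls (fun=> setT) erefl) => //.
- exact: cyls_setI.
- by move=> _; right; exists 0%N, (fun=> true).
- by rewrite bigcup_const//; exact/set0P.
- by move=> _ [->|[n [c ->]]]; rewrite ?measure0.
Qed.

Definition consb (b : bool) (c : nat -> bool) : nat -> bool :=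
  fun i => if i is i'.+1 then c i' else b.

(** Both sides are finite measures in [A], so agreement on cylinders is enough. The factor [k] will
    be [1/2] for the shift and the probability of one of the two events for independence. *)
Lemma coinP_preimage_unique (f : coins -> coins) (D A : set coins) (k : R) :
  measurable_fun setT f -> measurable D -> 0 <= k ->
  (forall n c, coinP (D `&` f @^-1` cyl n c) = (k%:E * coinP (cyl n c))%E) ->
  measurable A -> coinP (D `&` f @^-1` A) = (k%:E * coinP A)%E.
Proof.
move=> mf mD k0 fE mA; pose h := NngNum k0.
have := @coins_measure_unique (pushforward (mrestr coinP mD) f) (mscale h coinP).
rewrite /pushforward /mrestr /mscale/= setIC; apply => //.
  by move=> n c; rewrite /pushforward /mrestr /mscale/= setIC; exact: fE.
by rewrite /pushforward /mrestr preimage_setT setTI (le_lt_trans (probability_le1 _ _)) ?ltry.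
Qed.

Lemma coinP_shift b A : measurable A ->
  coinP ([set w | w 0%N = b] `&` coin_shift @^-1` A) = (2^-1%:E * coinP A)%E.
Proof.
apply: coinP_preimage_unique; rewrite ?invr_ge0//.
- exact: measurable_coin_shift.
- exact: measurable_coin.
move=> n c.
have -> : [set w | w 0%N = b] `&` coin_shift @^-1` cyl n c = cyl n.+1 (consb b c).
  apply/seteqP; split=> [w [/= w0 ws] [|i] ni //=|w h'].
    exact: ws.
  by split; [exact: (h' 0%N)|move=> i ni; exact: (h' i.+1)].
by rewrite !coinP_cyl exprS invfM EFinM.
Qed.

Lemma coinP_shiftT A : measurable A -> coinP (coin_shift @^-1` A) = coinP A.
Proof.
move=> mA.
have -> : coin_shift @^-1` A = ([set w | w 0%N = true] `&` coin_shift @^-1` A) `|`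
                          ([set w | w 0%N = false] `&` coin_shift @^-1` A).
  apply/seteqP; split=> [w wA|w [][]//].
  by case: (boolP (w 0%N)) => h; [left|right; split => //; exact/negbTE].
set X := (X in X `|` _); set Y := (Y in _ `|` Y).
transitivity (coinP X + coinP Y)%E.
  apply: measureU.
  - by apply: measurableI; [exact: measurable_coin|exact: measurable_coin_shiftl].
  - by apply: measurableI; [exact: measurable_coin|exact: measurable_coin_shiftl].
  - by rewrite -subset0 => w [[/= h _] [/= h' _]]; rewrite h in h'.
rewrite /X /Y !coinP_shift// -ge0_muleDl ?lee_fin//.
by rewrite -EFinD (_ : 2^-1 + 2^-1 = 1 :> R) ?mul1e//; lra.
Qed.

Lemma coinP_split_cyl n c m c' :
  coinP (evens @^-1` cyl n c `&` odds @^-1` cyl m c') = (2 ^- (n + m))%:E.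
Proof.
(* Reading one coin exchanges the two subsequences: the odd one is the even one of the shifted
   sequence. The measure counts every constrained coin twice, plus one when the even subsequence
   carries no constraint, because the exchange must then make progress without using up a
   constraint. *)
have [k] := ubnP ((n + m).*2 + (n == 0)%N)%N.
elim: k n c m c' => // k IH [|n] c m c' hk.
  have -> : evens @^-1` cyl 0 c `&` odds @^-1` cyl m c' =
     coin_shift @^-1` (evens @^-1` cyl m c' `&` odds @^-1` cyl 0 c).
    by apply/seteqP; split=> w [h1 h2]; split => //.
  have mS : measurable (evens @^-1` cyl m c' `&` odds @^-1` cyl 0 c).
    apply: measurableI; [apply: measurable_evensl|apply: measurable_oddsl];
      exact: measurable_cyl.
  rewrite coinP_shiftT//.
  case: m c' hk mS => [|m] c' hk mS.
    rewrite (_ : _ `&` _ = setT) ?probability_setT ?expr0 ?invr1//.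
    by apply/seteqP; split.
  rewrite IH ?addn0 ?add0n//; move: hk; rewrite add0n !eqxx/=; lia.
have -> : evens @^-1` cyl n.+1 c `&` odds @^-1` cyl m c' =
   [set w | w 0%N = c 0%N] `&`
   coin_shift @^-1` (evens @^-1` cyl m c' `&` odds @^-1` cyl n (fun i => c i.+1)).
  apply/seteqP; split=> [w [h1 h2]|w [/= h0 [h1 h2]]].
    split; first exact: (h1 0%N).
    by split=> // i ni; exact: (h1 i.+1).
  by split=> //; case=> [|i] ni //; exact: h2.
rewrite coinP_shift; last first.
  apply: measurableI; [apply: measurable_evensl|apply: measurable_oddsl];
    exact: measurable_cyl.
rewrite IH; last by move: hk; case: (m == 0%N) => /=; lia.
by rewrite -EFinM addSn exprS invfM addnC.
Qed.

(** The cylinder case is extended one factor at a time: to arbitrary [A] with [B] a cylinder, then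
    to arbitrary [B]. *)
Lemma coinP_split A B : measurable A -> measurable B ->
  coinP (evens @^-1` A `&` odds @^-1` B) = (coinP A * coinP B)%E.
Proof.
move=> mA mB.
have pk (D : set coins) : measurable D -> coinP D = (fine (coinP D))%:E.
  by move=> mD; rewrite fineK// fin_num_measure.
have step n c : coinP (evens @^-1` A `&` odds @^-1` cyl n c) =
    (coinP A * coinP (cyl n c))%E.
  rewrite setIC muleC (pk (cyl n c)); last exact: measurable_cyl.
  apply: coinP_preimage_unique; rewrite ?fine_ge0//.
  - exact: measurable_evens.
  - by apply: measurable_oddsl; exact: measurable_cyl.
  move=> k c'; rewrite setIC coinP_split_cyl !coinP_cyl/= -EFinM.
  by rewrite exprD invfM mulrC.
rewrite (pk A)//; apply: coinP_preimage_unique; rewrite ?fine_ge0//.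
- exact: measurable_odds.
- exact: measurable_evensl.
by move=> n c; rewrite step -pk.
Qed.

(** The number with binary digits [w]. It can equal 1, at the constant sequence [true]; that null
    value is behind the exceptional event of the theorem. *)
Definition coinU (w : coins) : R := sup (range (fun n => dyadic n w)).

Lemma dyadic_nd (w : coins) : nondecreasing_seq (fun n => dyadic n w : R).
Proof.
apply/nondecreasing_seqP => n; elim: n w => [|n IH] w /=.
  by rewrite addr0 divr_ge0.
by rewrite ler_pM2r ?invr_gt0// lerD2l; exact: IH.
Qed.

Lemma dyadic_le1 n c : dyadic n c <= 1 :> R.
Proof. by apply: le_trans (dyadic_le n c); rewrite lerDl invr_ge0 exprn_ge0. Qed.

Lemma dyadic_has_ub (w : coins) : has_ubound (range (fun n => dyadic n w : R)).
Proof. by exists 1 => _ [n _ <-]; exact: dyadic_le1. Qed.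

Lemma coinU_ge0 w : 0 <= coinU w.
Proof. by apply: (ub_le_sup (dyadic_has_ub w)); exists 0%N. Qed.

Lemma coinU_le1 w : coinU w <= 1.
Proof.
apply: ge_sup; first by exists 0, 0%N.
by move=> _ [n _ <-]; exact: dyadic_le1.
Qed.

Lemma measurable_dyadic n : measurable_fun setT (dyadic n : coins -> R).
Proof.
elim: n => [|n IH]; first exact: measurable_cst.
rewrite /=; apply: measurable_funM => //; apply: measurable_funD.
  rewrite (_ : (fun w : coins => _) = fun w => if w 0%N then 1 else 0); last first.
    by apply/funext => w; case: (w 0%N).
  apply: measurable_fun_ifT => //; apply: (measurable_fun_bool true) => //.
  by rewrite setTI; exact: measurable_coin.
exact: (measurableT_comp IH measurable_coin_shift).
Qed.

Lemma measurable_coinU : measurable_fun setT coinU.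
Proof.
apply: (measurable_fun_cvg (h := fun n => dyadic n : coins -> R)).
  by move=> n; exact: measurable_dyadic.
by move=> w _; apply: nondecreasing_cvgn; [exact: dyadic_nd|exact: dyadic_has_ub].
Qed.

Lemma coinU_digits x : 0 <= x < 1 -> coinU (digits x) = x.
Proof.
move=> x01.
have H n : dyadic n (digits x) <= x < dyadic n (digits x) + 2 ^- n.
  by apply/(digits_cyl _ _ x01).
apply/eqP; rewrite eq_le; apply/andP; split.
  apply: ge_sup; first by exists 0, 0%N.
  by move=> _ [n _ <-]; case/andP: (H n).
apply/ler_addgt0Pr => e e0.
have [n ne] : exists n, 2 ^- n < e.
  have /(@cvgrPdist_lt _ R^o)/(_ e e0)[n _ /(_ n (leqnn _))] :
      (2^-1 ^+ n : R^o) @[n --> \oo] --> (0 : R^o).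
    by apply: cvg_expr; rewrite ger0_norm ?invr_ge0// invf_lt1// ltr1n.
  rewrite sub0r normrN ger0_norm ?exprn_ge0 ?invr_ge0// exprVn => h.
  by exists n.
case/andP: (H n) => _ /ltW h; apply: (le_trans h).
by rewrite lerD// ?(ltW ne)//; apply: (ub_le_sup (dyadic_has_ub _)); exists n.
Qed.

Lemma coinP_U B : measurable B -> coinP (coinU @^-1` B) = mu (B `&` `[0, 1[).
Proof.
move=> mB; rewrite /coinP/= /distribution /pushforward unif01E; congr (mu _).
apply/seteqP; split=> x /=; rewrite in_itv/= => -[h x01]; split => //.
  by move: h; rewrite coinU_digits.
by rewrite coinU_digits.
Qed.

End coin_probability.

(** * Jump chains driven by coin tosses *)

Section ln_square.
Context {R : realType}.
Local Notation mu := (@lebesgue_measure R).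
Variables dd c : R.

Let L (u : R) : R := dd + c * ln u.
Let f (u : R) : R := L u ^+ 2.
Let F (u : R) : R := u * (L u ^+ 2 - 2 * c * L u + 2 * c ^+ 2).

Let dL (u : R) : 0 < u -> is_derive u 1 L (c * u^-1).
Proof.
move=> u0; rewrite -[c * _]add0r; apply: is_deriveD.
by have := is_deriveZ c (is_derive1_ln u0); rewrite /GRing.scale.
Qed.

Let dF (u : R) : 0 < u -> is_derive u 1 F (f u).
Proof.
move=> u0; have d := dL u0.
have d2 : is_derive u 1 (fun u => L u ^+ 2 - 2 * c * L u + 2 * c ^+ 2)
    (2 * L u * (c * u^-1) - 2 * c * (c * u^-1)).
  have e1 := is_deriveM d d.
  have e2 := is_deriveZ (2 * c) d.
  have e3 := is_deriveD (is_deriveB e1 e2) (is_derive_cst (2 * c ^+ 2) u 1).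
  apply: is_derive_eq e3 _; rewrite /GRing.scale/=; ring.
have e := is_deriveM (is_derive_id u 1) d2.
apply: is_derive_eq e _; rewrite /GRing.scale/= /f.
by field; rewrite gt_eqF.
Qed.

Let cf (u : R) : 0 < u -> {for u, continuous f}.
Proof.
move=> u0; apply: differentiable_continuous; apply/derivable1_diffP.
by have := is_deriveM (dL u0) (dL u0) => -[].
Qed.

Let cF (u : R) : 0 < u -> {for u, continuous F}.
Proof.
by move=> u0; apply: differentiable_continuous; apply/derivable1_diffP; have [] := dF u0.
Qed.

Let mf : measurable_fun setT f.
Proof.
apply: measurable_funX; apply: measurable_funD => //.
by apply: measurable_funM => //; exact: measurable_ln.
Qed.

Let bound (a : R) : 0 < a < 1 ->
  (\int[mu]_(u in `[a, 1%R]) (f u)%:E <= (dd ^+ 2 - 2 * c * dd + 2 * c ^+ 2)%:E)%E.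
Proof.
move=> /andP[a0 a1].
rewrite (@continuous_FTC2 _ f F a 1)//.
- rewrite -EFinB lee_fin.
  have -> : F 1 = dd ^+ 2 - 2 * c * dd + 2 * c ^+ 2 by rewrite /F /L ln1 mulr0 addr0 mul1r.
  rewrite lerBlDr lerDl /F; apply: mulr_ge0; first exact: ltW.
  have -> : L a ^+ 2 - 2 * c * L a + 2 * c ^+ 2 = (L a - c) ^+ 2 + c ^+ 2 by ring.
  by rewrite addr_ge0 ?sqr_ge0.
- apply: continuous_in_subspaceT => x; rewrite inE/= in_itv/= => /andP[ax _].
  by apply: cf; exact: lt_le_trans ax.
- split.
  + move=> x; rewrite in_itv/= => /andP[ax _].
    by have [] := dF (lt_trans a0 ax).
  + by apply: cvg_at_right_filter; exact: cF.
  + by apply: cvg_at_left_filter; exact: cF.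
- move=> x; rewrite in_itv/= => /andP[ax _].
  by rewrite derive1E; have [_ ->] := dF (lt_trans a0 ax).
Qed.

(** With [u] uniform, [- ln u] is a standard exponential variable, with mean 1 and second moment 2;
    the right-hand side is the corresponding second moment of [dd + c * ln u]. *)
Lemma integral_ln_sq_le :
  (\int[mu]_(u in `[0%R, 1%R[) ((dd + c * ln u) ^+ 2)%:E <=
   (dd ^+ 2 - 2 * c * dd + 2 * c ^+ 2)%:E)%E.
Proof.
rewrite integral_itv_bndo_bndc; last first.
  by apply/measurable_EFinP; exact: measurable_funTS.
rewrite -integral_itv_obnd_cbnd; last first.
  by apply/measurable_EFinP; exact: measurable_funTS.
(* The shift by two keeps the left end strictly below 1, as [bound] asks. *)
have -> : `]0, 1]%classic = \bigcup_n `[n.+2%:R^-1, 1]%classic :> set R.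
  apply/seteqP; split=> [x|x [n _]] /=; rewrite !in_itv/=.
    move=> /andP[x0 x1].
    exists (Num.truncn x^-1) => //=; rewrite in_itv/= x1 andbT.
    rewrite invf_ple ?posrE//.
    have := truncnS_gt (x^-1); move/ltW/le_trans; apply.
    by rewrite ler_nat.
  move=> /andP[nx ->]; rewrite andbT; apply: lt_le_trans nx.
  by rewrite invr_gt0.
pose I n : set (measurableTypeR R) := `[n.+2%:R^-1, 1]%classic.
have cv : (\int[mu]_(x in I n) (f x)%:E @[n --> \oo] -->
           \int[mu]_(x in \bigcup_n I n) (f x)%:E)%E.
  apply: (@ge0_nondecreasing_set_cvg_integral _ _ _ I (EFin \o f) mu).
  - apply/nondecreasing_seqP => n; rewrite subsetEset /I => x /=; rewrite !in_itv/=.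
    move=> /andP[h ->]; rewrite andbT; apply: le_trans h.
    by rewrite lef_pV2 ?posrE// ler_nat.
  - by move=> n; exact: measurable_itv.
  - by move=> n; apply/measurable_EFinP; exact: measurable_funTS.
  - by move=> n x _; rewrite lee_fin sqr_ge0.
rewrite -(cvg_lim _ cv)//; apply: lime_le; first by apply/cvg_ex; eexists; exact: cv.
apply: nearW => n; apply: bound.
by rewrite invr_gt0 ltr0n/= invf_lt1// ltr1n.
Qed.

End ln_square.

Lemma measurable_is_true d (T : measurableType d) (f : T -> bool) :
  measurable_fun setT f -> measurable [set t | f t].
Proof.
move=> mf; have := mf measurableT [set true] I; rewrite setTI.
by congr measurable; apply/seteqP; split=> t /=.
Qed.

(** * A chain with three transitions, built from a seed that splits into independent halves *)

Section jump_chain.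
Context {R : realType} {d : measure_display} {Om : measurableType d}.
Variable P : probability Om R.
Variables (sl sr : Om -> Om) (U : Om -> R).
Hypothesis msl : measurable_fun setT sl.
Hypothesis msr : measurable_fun setT sr.
Hypothesis mU : measurable_fun setT U.
Hypothesis U01 : forall w, 0 <= U w <= 1.
Hypothesis PU : forall B : set R, measurable B ->
  P (U @^-1` B) = lebesgue_measure (B `&` `[0, 1[).
Hypothesis Psplit : forall A B, measurable A -> measurable B ->
  P (sl @^-1` A `&` sr @^-1` B) = (P A * P B)%E.

Variables (r1 r2 r3 : state -> R) (t1 t2 t3 : state -> state).
Hypothesis r1_gt0 : forall z, 0 < r1 z.
Hypothesis r2_ge0 : forall z, 0 <= r2 z.
Hypothesis r3_ge0 : forall z, 0 <= r3 z.

Definition total_rate (z : state) : R := r1 z + r2 z + r3 z.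

Lemma total_rate_gt0 z : 0 < total_rate z.
Proof. by rewrite /total_rate -addrA ltr_pwDl// addr_ge0. Qed.

Definition target_of (z : state) (u : R) : state :=
  if u < r1 z / total_rate z then t1 z
  else if u < (r1 z + r2 z) / total_rate z then t2 z else t3 z.

Definition next_state (z : state) (h : Om) : state := target_of z (U (sl h)).

(** Inversion of the exponential distribution function. The null event [U = 0] gives holding time 0,
    by the convention that [ln 0] is 0. *)
Definition hold_time (z : state) (h : Om) : R := - ln (U (sr h)) / total_rate z.

Lemma hold_time_ge0 z h : 0 <= hold_time z h.
Proof.
apply: divr_ge0; last exact/ltW/total_rate_gt0.
rewrite oppr_ge0; by have /andP[u0 u1] := U01 (sr h); rewrite ln_le0.
Qed.

Lemma measurable_slI A : measurable A -> measurable (sl @^-1` A).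
Proof. by move=> mA; rewrite -[X in measurable X]setTI; exact: msl. Qed.
Lemma measurable_srI A : measurable A -> measurable (sr @^-1` A).
Proof. by move=> mA; rewrite -[X in measurable X]setTI; exact: msr. Qed.
Lemma measurable_UI A : measurable A -> measurable (U @^-1` A).
Proof. by move=> mA; rewrite -[X in measurable X]setTI; exact: mU. Qed.

Lemma measurable_hold_time z : measurable_fun setT (hold_time z).
Proof.
apply: measurable_funM => //; apply: measurableT_comp => //.
apply: measurableT_comp; first exact: measurable_ln.
exact: measurableT_comp.
Qed.

(** The next state takes one of three values, selected by comparisons of a measurable variable, so
    no measurable structure on [state] is involved. *)
Lemma measurable_next_state d1 d2 (T1 : measurableType d1) (T2 : measurableType d2)
    (f : T1 -> Om) (F : state -> T1 -> T2) z : measurable_fun setT f ->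
  (forall z, measurable_fun setT (F z)) ->
  measurable_fun setT (fun t => F (next_state z (f t)) t).
Proof.
move=> mf mF.
have -> : (fun t => F (next_state z (f t)) t) = fun t =>
  if U (sl (f t)) < r1 z / total_rate z then F (t1 z) t
  else if U (sl (f t)) < (r1 z + r2 z) / total_rate z then F (t2 z) t else F (t3 z) t.
  by apply/funext => t; rewrite /next_state /target_of; case: ifP => // _; case: ifP.
have mu : measurable_fun setT (U \o sl \o f).
  by do 2 apply: measurableT_comp => //.
apply: measurable_fun_ifT => //; first exact: measurable_fun_ltr.
by apply: measurable_fun_ifT => //; exact: measurable_fun_ltr.
Qed.

(** The recursion peels off the first jump: [sl w] drives it, and [sr w] is the seed of the chain
    restarted from the new state. The Markov property thus becomes independence of the two
    halves. *)
Fixpoint chain_state (n : nat) (z : state) (w : Om) : state :=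
  if n is n'.+1 then chain_state n' (next_state z (sl w)) (sr w) else z.
Fixpoint chain_hold (n : nat) (z : state) (w : Om) : R :=
  if n is n'.+1 then chain_hold n' (next_state z (sl w)) (sr w) else hold_time z (sl w).

Lemma chain_hold_ge0 n z w : 0 <= chain_hold n z w.
Proof. by elim: n z w => [|n IH] z w; [exact: hold_time_ge0|exact: IH]. Qed.

Lemma chain_stateS n z w : exists h, chain_state n.+1 z w = next_state (chain_state n z w) h.
Proof.
elim: n z w => [|n IH] z w; first by exists (sl w).
exact: (IH (next_state z (sl w)) (sr w)).
Qed.

Lemma measurable_chain_stateE n z z' : measurable_fun setT (fun w => chain_state n z w == z').
Proof.
elim: n z => [|n IH] z /=; first exact: measurable_cst.
apply: (@measurable_next_state _ _ _ _ sl (fun z w => chain_state n z (sr w) == z')) => // z0.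
exact: (measurableT_comp (IH z0) msr).
Qed.

Lemma measurable_chain_state n z z' : measurable [set w | chain_state n z w = z'].
Proof.
have := @measurable_chain_stateE n z z' measurableT [set true] I; rewrite setTI.
by congr measurable; apply/seteqP; split=> w /= /eqP.
Qed.

Lemma measurable_chain_hold n z : measurable_fun setT (chain_hold n z).
Proof.
elim: n z => [|n IH] z /=; first exact: (measurableT_comp (measurable_hold_time z)).
apply: (@measurable_next_state _ _ _ _ sl (fun z w => chain_hold n z (sr w))) => // z0.
exact: (measurableT_comp (IH z0) msr).
Qed.

Lemma P_U_itv (B : set R) (a b : R) : measurable B -> a <= b ->
  B `&` `[0, 1[ = `[a, b[%classic -> P (U @^-1` B) = (b - a)%:E.
Proof.
move=> mB ab BE; rewrite PU// BE lebesgue_measure_itv/= lte_fin; case: ltP => // ba.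
by have -> : a = b by [apply/le_anti; rewrite ab]; rewrite subrr.
Qed.

Lemma integral_target_of (F : state -> \bar R) z : (forall z', (0 <= F z')%E) ->
  (\int[P]_u F (target_of z (U u)) = (r1 z / total_rate z)%:E * F (t1 z) +
     (r2 z / total_rate z)%:E * F (t2 z) + (r3 z / total_rate z)%:E * F (t3 z))%E.
Proof.
move=> F0.
have q0 := total_rate_gt0 z; have h1 := ltW (r1_gt0 z); have h2 := r2_ge0 z; have h3 := r3_ge0 z.
pose p1 := r1 z / total_rate z; pose p2 := (r1 z + r2 z) / total_rate z.
have p1_0 : 0 <= p1 by rewrite divr_ge0// ltW.
have p12 : p1 <= p2 by rewrite ler_pM2r ?invr_gt0// lerDl.
have p2_1 : p2 <= 1 by rewrite ler_pdivrMr// mul1r /total_rate lerDl.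
pose A1 : set Om := U @^-1` `]-oo, p1[.
pose A2 : set Om := U @^-1` `[p1, p2[.
pose A3 : set Om := U @^-1` `[p2, +oo[.
have mA1 : measurable A1 by apply: measurable_UI; exact: measurable_itv.
have mA2 : measurable A2 by apply: measurable_UI; exact: measurable_itv.
have mA3 : measurable A3 by apply: measurable_UI; exact: measurable_itv.
have PA1 : P A1 = (r1 z / total_rate z)%:E.
  rewrite -/p1 -[p1]subr0; apply: P_U_itv => //.
  by apply/seteqP; split=> x /=; rewrite !in_itv/=; lra.
have PA2 : P A2 = (r2 z / total_rate z)%:E.
  have -> : r2 z / total_rate z = p2 - p1 by rewrite /p1 /p2 -mulrBl addrC addKr.
  apply: P_U_itv => //.
  by apply/seteqP; split=> x /=; rewrite !in_itv/=; lra.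
have PA3 : P A3 = (r3 z / total_rate z)%:E.
  have -> : r3 z / total_rate z = 1 - p2.
    by rewrite /p2 -[X in X - _](divff (lt0r_neq0 q0)) -mulrBl {2}/total_rate addrAC subrr add0r.
  apply: P_U_itv => //.
  by apply/seteqP; split=> x /=; rewrite !in_itv/= ?andbT; lra.
have m : measurable_fun setT (fun u => F (target_of z (U u))).
  have -> : (fun u => F (target_of z (U u))) = fun u =>
    if U u < p1 then F (t1 z) else if U u < p2 then F (t2 z) else F (t3 z).
    by apply/funext => t; rewrite /target_of -/p1 -/p2; case: ifP => // _; case: ifP.
  apply: measurable_fun_ifT => //; first exact: measurable_fun_ltr.
  by apply: measurable_fun_ifT => //; exact: measurable_fun_ltr.
have TE : setT = A1 `|` (A2 `|` A3).
  apply/seteqP; split=> // u _; rewrite /A1 /A2 /A3 /= !in_itv/= andbT.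
  by case: (ltP (U u) p1) => ?; [left|right; case: (ltP (U u) p2) => ?; [left|right]].
have mA23 : measurable (A2 `|` A3) by exact: measurableU.
rewrite TE ge0_integral_setU//; last 2 first.
- by rewrite -TE.
- rewrite disj_set2E; apply/eqP; rewrite -subset0 => u [].
  by rewrite /A1 /A2 /A3 /= !in_itv/= => h [|]; lra.
rewrite ge0_integral_setU//; last 2 first.
- exact: measurable_funTS.
- rewrite disj_set2E; apply/eqP; rewrite -subset0 => u [].
  by rewrite /A1 /A2 /A3 /= !in_itv/= => h; lra.
rewrite addeA; congr (_ + _ + _)%E.
- transitivity (\int[P]_(u in A1) (cst (F (t1 z))) u)%E; last first.
    by rewrite integral_cst// muleC; congr (_ * _)%E; exact: PA1.
  apply: eq_integral => u.
  by rewrite inE /A1/= in_itv/= /target_of => ->.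
- transitivity (\int[P]_(u in A2) (cst (F (t2 z))) u)%E; last first.
    by rewrite integral_cst// muleC; congr (_ * _)%E; exact: PA2.
  apply: eq_integral => u.
  rewrite inE /A2/= in_itv/= /target_of => /andP[h ->].
  by rewrite ltNge -/p1 h.
- transitivity (\int[P]_(u in A3) (cst (F (t3 z))) u)%E; last first.
    by rewrite integral_cst// muleC; congr (_ * _)%E; exact: PA3.
  apply: eq_integral => u.
  rewrite inE /A3/= in_itv/= andbT /target_of => h.
  by rewrite !ltNge -/p1 -/p2 h (le_trans p12 h).
Qed.

Definition jump_rate (z z' : state) : R :=
  r1 z * (z' == t1 z)%:R + r2 z * (z' == t2 z)%:R + r3 z * (z' == t3 z)%:R.

Lemma measurable_target_ofE z z' : measurable [set u | target_of z (U u) = z'].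
Proof.
pose p1 := r1 z / total_rate z; pose p2 := (r1 z + r2 z) / total_rate z.
have : measurable_fun setT (fun u => target_of z (U u) == z').
  have -> : (fun u => target_of z (U u) == z') = fun u =>
    if U u < p1 then t1 z == z' else if U u < p2 then t2 z == z' else t3 z == z'.
    by apply/funext => t; rewrite /target_of -/p1 -/p2; case: ifP => // _; case: ifP.
  apply: measurable_fun_ifT => //; first exact: measurable_fun_ltr.
  by apply: measurable_fun_ifT => //; exact: measurable_fun_ltr.
move=> /(_ measurableT [set true] I).
by rewrite setTI; congr measurable; apply/seteqP; split=> w /= /eqP.
Qed.

Lemma P_target_of z z' : P [set u | target_of z (U u) = z'] = (jump_rate z z' / total_rate z)%:E.
Proof.
rewrite -[X in P X]setIT -integral_indic//; last exact: measurable_target_ofE.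
pose F y : \bar R := (y == z')%:R%:E.
rewrite (eq_integral (fun u => F (target_of z (U u)))); last first.
  move=> u _; rewrite indicE /F; congr (_%:R%:E); congr nat_of_bool.
  by apply/idP/eqP; rewrite inE.
rewrite integral_target_of; last by move=> y; rewrite /F lee_fin.
rewrite /F -!EFinM -!EFinD; congr (_%:E).
rewrite /jump_rate !(eq_sym _ z'); ring.
Qed.

Lemma P_hold z s : 0 <= s ->
  P [set v | s < - ln (U v) / total_rate z] = (expR (- (total_rate z * s)))%:E.
Proof.
move=> s0; have q0 := total_rate_gt0 z.
have -> : [set v | s < - ln (U v) / total_rate z] = U @^-1` `]0, expR (- (total_rate z * s))[.
  apply/seteqP; split=> v /=; rewrite in_itv/= ltr_pdivlMr// mulrC ltrNr.
    move=> h; have [u0|u0] := leP (U v) 0.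
      by move: h; rewrite ln0// ltNge oppr_le0 mulr_ge0// ltW.
    by rewrite -[X in X < expR _]lnK ?posrE// ltr_expR.
  by move=> /andP[u0 h]; rewrite -ltr_expR lnK ?posrE.
have e1 : expR (- (total_rate z * s)) <= 1 by rewrite -expR0 ler_expR oppr_le0 mulr_ge0// ltW.
have e0 := expR_gt0 (- (total_rate z * s)).
rewrite PU; last exact: measurable_itv.
rewrite (_ : _ `&` _ = `]0, expR (- (total_rate z * s))[%classic); last first.
  by apply/seteqP; split=> x /=; rewrite !in_itv/=; lra.
by rewrite lebesgue_measure_itv/= lte_fin e0 oppr0 adde0.
Qed.

Lemma measurable_holdE z s : measurable [set v | s < - ln (U v) / total_rate z].
Proof.
have m : measurable_fun setT (fun v => - ln (U v) / total_rate z).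
  apply: measurable_funM => //; apply: measurableT_comp => //.
  by apply: measurableT_comp; first exact: measurable_ln.
by apply: measurable_is_true; exact: measurable_fun_ltr.
Qed.

Definition path_event n z (zs : nat -> state) (s : nat -> R) : set Om :=
  [set w | (forall k, (k <= n)%N -> chain_state k z w = zs k) /\
           (forall k, (k < n)%N -> s k < chain_hold k z w)].

Lemma measurable_path_event n z zs s : measurable (path_event n z zs s).
Proof.
have -> : path_event n z zs s = \bigcap_(k in `I_n.+1) [set w | chain_state k z w = zs k] `&`
    \bigcap_(k in `I_n) [set w | s k < chain_hold k z w].
  by apply/seteqP; split=> w [h1 h2]; split=> k kn; [exact: h1|exact: h2|exact: h1|exact: h2].
apply: measurableI; apply: bigcap_measurableType => // k _.
  exact: measurable_chain_state.
apply: measurable_is_true; apply: measurable_fun_ltr => //; exact: measurable_chain_hold.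
Qed.

(** The target of the first jump, its holding time and the rest of the path are read from three
    independent parts of the seed, whence the product by induction. *)
Lemma P_path_event n z zs s : (forall k, 0 <= s k) ->
  P (path_event n z zs s) = ((zs 0%N == z)%:R *
   \prod_(k < n) (expR (- (total_rate (zs k) * s k)) * (jump_rate (zs k) (zs k.+1) / total_rate (zs k))))%:E.
Proof.
elim: n z zs s => [|n IH] z zs s s0.
  rewrite big_ord0 mulr1; case: eqP => [e|ne].
    rewrite (_ : path_event _ _ _ _ = setT) ?probability_setT//.
    by apply/seteqP; split=> // w _; split => // -[].
  rewrite (_ : path_event _ _ _ _ = set0) ?measure0//.
  by rewrite -subset0 => w [/(_ 0%N (leqnn _))/= e _]; apply: ne.
case: eqP => [e|ne]; last first.
  rewrite (_ : path_event _ _ _ _ = set0) ?measure0 ?mul0r//.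
  by rewrite -subset0 => w [/(_ 0%N (leq0n _))/= e _]; apply: ne.
subst z.
have -> : path_event n.+1 (zs 0%N) zs s =
  sl @^-1` (sl @^-1` [set u | target_of (zs 0%N) (U u) = zs 1%N] `&`
            sr @^-1` [set v | s 0%N < - ln (U v) / total_rate (zs 0%N)]) `&`
  sr @^-1` (path_event n (zs 1%N) (fun k => zs k.+1) (fun k => s k.+1)).
  apply/seteqP; split=> w.
    move=> [hz hs]; have z1 : next_state (zs 0%N) (sl w) = zs 1%N by exact: (hz 1%N).
    split; first by split; [exact: z1|exact: (hs 0%N)].
    split=> k kn.
      by have := hz k.+1 kn; rewrite /= z1.
    by have := hs k.+1 kn; rewrite /= z1.
  move=> [[/= h1 h2] [hz hs]].
  split=> -[|k] kn //=; rewrite /next_state h1; [exact: hz|exact: hs].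
have mn := measurable_target_ofE (zs 0%N) (zs 1%N).
have mh := measurable_holdE (zs 0%N) (s 0%N).
rewrite Psplit; last 2 first.
- by apply: measurableI; [exact: measurable_slI|exact: measurable_srI].
- exact: measurable_path_event.
rewrite Psplit// IH; last by move=> k; exact: s0.
rewrite P_target_of P_hold// big_ord_recl eqxx !mul1r -!EFinM; congr (_%:E).
rewrite /=; congr (_ * _); exact: mulrC.
Qed.

(** The pair of halves has law [P \x P], by uniqueness on rectangles. This is the form in which the
    first jump is conditioned upon. *)
Lemma split_tonelli (f : Om * Om -> \bar R) : measurable_fun setT f ->
  (forall x, (0 <= f x)%E) ->
  (\int[P]_w f (sl w, sr w) = \int[P]_h \int[P]_w f (h, w))%E.
Proof.
move=> mf f0.
have mp : measurable_fun setT (fun w => (sl w, sr w)).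
  exact: measurable_fun_pair.
transitivity (\int[pushforward P (fun w => (sl w, sr w))]_x f x)%E.
  by rewrite ge0_integral_pushforward// preimage_setT.
transitivity (\int[P \x P]_x f x)%E; last by rewrite fubini_tonelli1.
apply: eq_measure_integral => A mA _.
by apply/esym; apply: product_measure_unique => // B C mB mC; rewrite -Psplit.
Qed.

Lemma integral_U (f : R -> R) : measurable_fun setT f -> (forall x, 0 <= f x) ->
  (\int[P]_w (f (U w))%:E = \int[lebesgue_measure]_(u in `[0%R, 1%R[) (f u)%:E)%E.
Proof.
move=> mf f0.
pose U' : Om -> measurableTypeR R := U.
have mU' : measurable_fun setT U' by exact: mU.
have mEf : measurable_fun setT (EFin \o f) by exact/measurable_EFinP.
transitivity (\int[pushforward P U']_x (f x)%:E)%E.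
  by rewrite ge0_integral_pushforward// ?preimage_setT// => x _; rewrite lee_fin.
have m01 : measurable (`[0, 1[%classic : set (measurableTypeR R)) by exact: measurable_itv.
have PN : pushforward P U' (~` `[0, 1[) = 0%E.
  by rewrite /pushforward PU ?setICl ?measure0//; exact: measurableC.
rewrite (@ge0_negligible_integral _ _ _ _ _ _ _ _ _ _ _ PN)//; last 2 first.
- exact: measurableC.
- by move=> x _; rewrite lee_fin.
rewrite setTD setCK; apply: eq_measure_integral => A mA A01.
by rewrite -[RHS](_ : pushforward P U' A = _)// /pushforward PU// setIidl.
Qed.

(** * A maximal inequality along the jumps *)

Section maximal_inequality.
Variables (D : state -> state -> R) (C : R).
Hypothesis D_le1 : forall z, D z (t1 z) ^+ 2 <= C.
Hypothesis D_le2 : forall z, D z (t2 z) ^+ 2 <= C.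
Hypothesis D_le3 : forall z, D z (t3 z) ^+ 2 <= C.

Definition drift z := r1 z * D z (t1 z) + r2 z * D z (t2 z) + r3 z * D z (t3 z).

(** Centred: the increment has mean [drift z / total_rate z], and the holding time has mean
    [1 / total_rate z]. *)
Definition compensated_inc z h : R := D z (next_state z h) - hold_time z h * drift z.

Fixpoint compensated_sum (n : nat) (z : state) (w : Om) : R :=
  if n is n'.+1 then compensated_inc z (sl w) + compensated_sum n' (next_state z (sl w)) (sr w) else 0.

Lemma compensated_sumE n z w : compensated_sum n z w = \sum_(k < n)
  (D (chain_state k z w) (chain_state k.+1 z w) - chain_hold k z w * drift (chain_state k z w)).
Proof.
elim: n z w => [|n IH] z w /=; first by rewrite big_ord0.
by rewrite big_ord_recl IH.
Qed.

Lemma measurable_compensated_inc z : measurable_fun setT (compensated_inc z).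
Proof.
apply: measurable_funB; last first.
  by apply: measurable_funM => //; exact: measurable_hold_time.
by apply: (@measurable_next_state _ _ _ _ id (fun z' _ => D z z')) => // z'; exact: measurable_cst.
Qed.

Lemma measurable_compensated_sum n z : measurable_fun setT (compensated_sum n z).
Proof.
elim: n z => [|n IH] z /=; first exact: measurable_cst.
apply: measurable_funD; first exact: (measurableT_comp (measurable_compensated_inc z)).
apply: (@measurable_next_state _ _ _ _ sl (fun z w => compensated_sum n z (sr w))) => // z0.
exact: (measurableT_comp (IH z0) msr).
Qed.

Definition exceeds n z (m a : R) : set Om :=
  [set w | exists2 k, (k <= n)%N & a <= `|m + compensated_sum k z w|].

Lemma measurable_exceeds n z m a : measurable (exceeds n z m a).
Proof.
have -> : exceeds n z m a = \bigcup_(k in `I_n.+1) [set w | a <= `|m + compensated_sum k z w|].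
  by apply/seteqP; split=> w [k kn h]; exists k.
apply: bigcup_measurable => k _; apply: measurable_is_true.
apply: measurable_fun_ler => //; apply: measurableT_comp => //.
by apply: measurable_funD => //; exact: measurable_compensated_sum.
Qed.

Lemma measurable_exceeds_joint n z m a :
  measurable [set x : Om * Om | exceeds n (next_state z x.1) (m + compensated_inc z x.1) a x.2].
Proof.
have -> : [set x : Om * Om | exceeds n (next_state z x.1) (m + compensated_inc z x.1) a x.2] =
  \bigcup_(k in `I_n.+1) [set x | a <= `|m + compensated_inc z x.1 + compensated_sum k (next_state z x.1) x.2|].
  by apply/seteqP; split=> w [k kn h]; exists k.
apply: bigcup_measurable => k _; apply: measurable_is_true.
apply: measurable_fun_ler => //; apply: measurableT_comp => //.
apply: measurable_funD.
  apply: measurable_funD => //.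
  exact: (measurableT_comp (measurable_compensated_inc z)).
apply: (@measurable_next_state _ _ _ _ fst (fun z x => compensated_sum k z x.2)) => // z0.
exact: (measurableT_comp (measurable_compensated_sum k z0)).
Qed.

(* A standard exponential has mean 1 and second moment 2, which makes the cross terms cancel. *)
Lemma compensated_inc_second_moment z m :
  (\int[P]_h ((m + compensated_inc z h) ^+ 2)%:E <= (m ^+ 2 + C)%:E)%E.
Proof.
have q0 := total_rate_gt0 z.
pose c := drift z / total_rate z.
pose f (x : Om * Om) : \bar R :=
  ((m + D z (target_of z (U x.1)) + c * ln (U x.2)) ^+ 2)%:E.
have mln : measurable_fun setT (fun x : Om * Om => c * ln (U x.2)).
  apply: measurable_funM => //; apply: measurableT_comp; first exact: measurable_ln.
  exact: (measurableT_comp mU).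
have mf : measurable_fun setT f.
  apply/measurable_EFinP; apply: measurable_funX; apply: measurable_funD => //.
  apply: measurable_funD => //.
  pose p1 := r1 z / total_rate z; pose p2 := (r1 z + r2 z) / total_rate z.
  have -> : (fun x : Om * Om => D z (target_of z (U x.1))) = fun x => if U x.1 < p1
    then D z (t1 z) else if U x.1 < p2 then D z (t2 z) else D z (t3 z).
    by apply/funext => t; rewrite /target_of -/p1 -/p2; case: ifP => // _; case: ifP.
  have mU1 : measurable_fun setT (fun x : Om * Om => U x.1).
    exact: (measurableT_comp mU).
  apply: measurable_fun_ifT => //; first exact: measurable_fun_ltr.
  by apply: measurable_fun_ifT => //; exact: measurable_fun_ltr.
have -> : (\int[P]_h ((m + compensated_inc z h) ^+ 2)%:E = \int[P]_h f (sl h, sr h))%E.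
  apply: eq_integral => h _; rewrite /f /compensated_inc /hold_time /next_state /c /=; congr (_%:E); ring.
rewrite split_tonelli//; last by move=> x; rewrite lee_fin sqr_ge0.
pose G z' : \bar R := (\int[P]_v ((m + D z z' + c * ln (U v)) ^+ 2)%:E)%E.
have G0 z' : (0 <= G z')%E by apply: integral_ge0 => v _; rewrite lee_fin sqr_ge0.
have GE z' : (G z' <= ((m + D z z') ^+ 2 - 2 * c * (m + D z z') + 2 * c ^+ 2)%:E)%E.
  rewrite /G (@integral_U (fun u => (m + D z z' + c * ln u) ^+ 2)).
  - exact: integral_ln_sq_le.
  - apply: measurable_funX; apply: measurable_funD => //.
    by apply: measurable_funM => //; exact: measurable_ln.
  - by move=> u; exact: sqr_ge0.
rewrite (integral_target_of z G0).
set g := fun z' => (m + D z z') ^+ 2 - 2 * c * (m + D z z') + 2 * c ^+ 2.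
apply: (@le_trans _ _ ((r1 z / total_rate z)%:E * (g (t1 z))%:E +
  (r2 z / total_rate z)%:E * (g (t2 z))%:E + (r3 z / total_rate z)%:E * (g (t3 z))%:E)%E).
  by apply: leeD; [apply: leeD|]; apply: lee_wpmul2l; rewrite ?GE// lee_fin divr_ge0// ltW.
rewrite -!EFinM -!EFinD lee_fin.
have -> : r1 z / total_rate z * g (t1 z) + r2 z / total_rate z * g (t2 z) + r3 z / total_rate z * g (t3 z) =
  m ^+ 2 + (r1 z * D z (t1 z) ^+ 2 + r2 z * D z (t2 z) ^+ 2 + r3 z * D z (t3 z) ^+ 2) / total_rate z.
  have e1 : r1 z = total_rate z - r2 z - r3 z by rewrite /total_rate; ring.
  have qn : total_rate z != 0 by rewrite gt_eqF.
  rewrite /g /c /drift.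
  move: (total_rate z) qn e1 => Q qn ->; by field.
rewrite lerD2l ler_pdivrMr// [leRHS]mulrC /total_rate !mulrDl.
by apply: lerD; [apply: lerD|]; apply: ler_wpM2l => //; exact: ltW.
Qed.

(* Doob's inequality by conditioning on the first jump: once [|m| >= a] the bound exceeds 1, and
   before that the second moment grows by at most [C] per jump. *)
Lemma P_exceeds n z m a : 0 < a -> (P (exceeds n z m a) <= ((m ^+ 2 + C * n%:R) / a ^+ 2)%:E)%E.
Proof.
have C0 : 0 <= C by exact: le_trans (sqr_ge0 _) (D_le1 (0, 0%N)).
move=> a0; elim: n z m => [|n IH] z m.
  have [am|ma] := leP a `|m|; last first.
    rewrite (_ : exceeds _ _ _ _ = set0) ?measure0 ?lee_fin ?divr_ge0 ?sqr_ge0//.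
      by rewrite addr_ge0 ?sqr_ge0// mulr_ge0.
    rewrite -subset0 => w [k]; rewrite leqn0 => /eqP -> /=.
    by rewrite addr0 leNgt ma.
  rewrite (le_trans (probability_le1 _ _))//; first exact: measurable_exceeds.
  rewrite lee_fin ler_pdivlMr ?exprn_gt0// mul1r mulr0 addr0 -(real_normK (num_real m)).
  by rewrite lerXn2r ?nnegrE// ltW.
have [am|ma] := leP a `|m|.
  rewrite (le_trans (probability_le1 _ _))//; first exact: measurable_exceeds.
  rewrite lee_fin ler_pdivlMr ?exprn_gt0// mul1r -(real_normK (num_real m)).
  apply: (@le_trans _ _ (`|m| ^+ 2)); first by rewrite lerXn2r ?nnegrE// ltW.
  by rewrite lerDl mulr_ge0.
(* The event as a set of pairs, first-jump seed and remaining seed. The first increment is absorbed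
   into the starting value, which is why the induction runs over all [m]. *)
pose X : set (Om * Om) := [set x | exceeds n (next_state z x.1) (m + compensated_inc z x.1) a x.2].
have mX : measurable X by exact: measurable_exceeds_joint.
have badE : exceeds n.+1 z m a = (fun w => (sl w, sr w)) @^-1` X.
  apply/seteqP; split=> w.
    move=> [[|k] kn]; first by rewrite /= addr0 leNgt ma.
    by rewrite /= addrA => h; exists k.
  by move=> [k kn h]; exists k.+1; rewrite //= addrA.
rewrite -[X in P X]setIT -integral_indic//; last exact: measurable_exceeds.
rewrite (eq_integral (fun w => (\1_X (sl w, sr w))%:E)); last first.
  by move=> w _; rewrite badE /indic.
rewrite (split_tonelli (f := fun x => (\1_X x)%:E)); last 2 first.
- exact/measurable_EFinP.
- by move=> x; rewrite lee_fin.
have mpsi2 : measurable_fun setT (fun h => (m + compensated_inc z h) ^+ 2).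
  apply: measurable_funX; apply: measurable_funD => //; exact: measurable_compensated_inc.
apply: (@le_trans _ _ (\int[P]_h (((m + compensated_inc z h) ^+ 2 + C * n%:R) / a ^+ 2)%:E)%E).
  apply: ge0_le_integral => //.
  - by move=> h _; apply: integral_ge0 => w _; rewrite lee_fin.
  - apply: (@measurable_fun_fubini_tonelli_F _ _ _ _ _ P (fun x => (\1_X x)%:E)).
      exact/measurable_EFinP.
    by move=> x; rewrite lee_fin.
  - by apply/measurable_EFinP; apply: measurable_funM => //; exact: measurable_funD.
  - move=> h _.
    rewrite (eq_integral (fun w => (\1_(exceeds n (next_state z h) (m + compensated_inc z h) a) w)%:E)); last first.
      by move=> w _; congr (_%:E); rewrite !indicE; congr (_%:R); congr nat_of_bool; apply/idP/idP; rewrite !inE.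
    rewrite integral_indic ?setIT//; first exact: IH.
    exact: measurable_exceeds.
under eq_integral do rewrite mulrC EFinM EFinD.
rewrite ge0_integralZl//; last 3 first.
- by apply: emeasurable_funD => //; exact/measurable_EFinP.
- by move=> h _; rewrite adde_ge0// lee_fin ?sqr_ge0// mulr_ge0.
- by rewrite lee_fin invr_ge0 sqr_ge0.
rewrite ge0_integralD//; last 3 first.
- by move=> h _; rewrite lee_fin sqr_ge0.
- exact/measurable_EFinP.
- by move=> h _; rewrite lee_fin mulr_ge0.
have Cn : (\int[P]_h (C * n%:R)%:E = (C * n%:R)%:E)%E.
  rewrite (integral_cst P measurableT (C * n%:R)%:E).
  by rewrite -[RHS]mule1; congr (_ * _)%E; exact: probability_setT.
rewrite Cn [leRHS]EFinM muleC.
apply: lee_wpmul2r; first by rewrite lee_fin invr_ge0 sqr_ge0.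
rewrite -natr1 mulrDr mulr1 (addrC (C * _)) addrA EFinD.
by apply: leeD => //; exact: compensated_inc_second_moment.
Qed.

End maximal_inequality.

End jump_chain.

(** * Resampling *)

Section resampling.
Context {R : realType} {d : measure_display} {Om : measurableType d}.
Variable P : probability Om R.
Variables (sl sr : Om -> Om) (U : Om -> R).
Hypothesis msl : measurable_fun setT sl.
Hypothesis msr : measurable_fun setT sr.
Hypothesis mU : measurable_fun setT U.
Hypothesis PU : forall B : set R, measurable B ->
  P (U @^-1` B) = lebesgue_measure (B `&` `[0, 1[).
Hypothesis Psplit : forall A B, measurable A -> measurable B ->
  P (sl @^-1` A `&` sr @^-1` B) = (P A * P B)%E.

Let preim_meas (f : Om -> Om) A : measurable_fun setT f -> measurable A ->
  measurable (f @^-1` A).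
Proof. by move=> mf mA; rewrite -[X in measurable X]setTI; exact: mf. Qed.

Let copy k w := sl (iter k sr w).

Let measurable_copy k : measurable_fun setT (copy k).
Proof.
apply: measurableT_comp => //; elim: k => [|k IH]; first exact: measurable_id.
exact: measurableT_comp.
Qed.

(* If no copy lies in [G] (a null event when [P G > 0]) the value is still a point of [G], so that
   no exceptional set has to be discarded for each scale. *)
Definition first_in (G : set Om) (w : Om) : Om :=
  if pselect (exists k, copy k w \in G) is left e then copy (ex_minn e) w
  else xget point G.

Lemma first_in_in G w : G !=set0 -> G (first_in G w).
Proof.
move=> G0; rewrite /first_in; case: pselect => [e|_]; last exact: xgetPex.
by case: ex_minnP => k; rewrite inE.
Qed.

(** The copies read from [sr w] are those of [w] after the first, so a failed trial restarts the
    search. When no copy succeeds both sides are the same default point. *)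
Lemma first_inE G w :
  first_in G w = if sl w \in G then sl w else first_in G (sr w).
Proof.
rewrite /first_in; case: ifPn => [h|h].
  case: pselect => [e|]; last by case; exists 0%N.
  by case: ex_minnP => -[|k] // _ /(_ 0%N h).
case: pselect => [e|ne]; case: pselect => [e'|ne'] //.
- case: ex_minnP => k hk mink; case: ex_minnP => j hj minj.
  have kS : k = k.-1.+1 by case: k hk {mink} => // hk; rewrite /copy/= hk in h.
  have e1 : copy j.+1 w \in G by rewrite /copy iterSr.
  have e2 : copy k.-1 (sr w) \in G by rewrite /copy -iterSr -kS.
  have := mink _ e1; have := minj _ e2 => l1 l2.
  have -> : k = j.+1 by lia.
  by rewrite /copy iterSr.
- case: ne'; case: e => -[|k] hk; first by rewrite /copy/= hk in h.
  by exists k; rewrite /copy -iterSr.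
- by case: ne; case: e' => k hk; exists k.+1; rewrite /copy iterSr.
Qed.

Lemma measurable_first_in G : measurable G -> measurable_fun setT (first_in G).
Proof.
move=> mG _ A mA; rewrite setTI.
pose E k := copy k @^-1` (G `&` A) `&` \bigcap_(i in `I_k) copy i @^-1` (~` G).
pose N := \bigcap_(i in setT) copy i @^-1` (~` G).
have mE k : measurable (E k).
  apply: measurableI; first by apply: preim_meas; [exact: measurable_copy|exact: measurableI].
  apply: bigcap_measurableType => // i _.
  by apply: preim_meas; [exact: measurable_copy|exact: measurableC].
have mN : measurable N.
  apply: bigcap_measurableType => // i _.
  by apply: preim_meas; [exact: measurable_copy|exact: measurableC].
have -> : first_in G @^-1` A = \bigcup_k E k `|`
    (if xget point G \in A then N else set0).
  apply/seteqP; split=> w.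
    rewrite /= /first_in; case: pselect => [e|ne].
      case: ex_minnP => k hk mink Ak; left; exists k => //; split.
        by split => //; rewrite inE in hk.
      move=> i /= ik Gi; have := mink i; rewrite inE => /(_ Gi).
      by rewrite leqNgt ik.
    move=> h; right; rewrite ifT; last by rewrite inE.
    by move=> i _ Gi; apply: ne; exists i; rewrite inE.
  move=> [[k _ [[Gk Ak] hk]]|].
    rewrite /= /first_in; case: pselect => [e|ne]; last first.
      by case: ne; exists k; rewrite inE.
    case: ex_minnP => j hj minj.
    have jk : (j <= k)%N by apply: minj; rewrite inE.
    have : ~~ (j < k)%N by apply/negP => /hk; apply; rewrite inE in hj.
    rewrite -leqNgt => kj; suff -> : j = k by [].
    by apply/eqP; rewrite eqn_leq jk kj.
  case: ifPn => // hA hN; rewrite /= /first_in; case: pselect => [[k hk]|_].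
    by exfalso; apply: (hN k) => //; rewrite inE in hk.
  by rewrite inE in hA.
apply: measurableU; first exact: bigcupT_measurable.
by case: ifP.
Qed.

(** By [first_inE] the unknown probability [x] equals the probability of the intersection plus
    [(1 - P G) * x], which replaces a geometric series over the trials. The product form covers
    [P G = 0] as well. *)
Lemma P_first_in G A : measurable G -> measurable A ->
  (P G * P (first_in G @^-1` A) = P (A `&` G))%E.
Proof.
move=> mG mA.
have mF : measurable (first_in G @^-1` A).
  by apply: preim_meas => //; exact: measurable_first_in.
have e : first_in G @^-1` A = sl @^-1` (A `&` G) `|`
    (sl @^-1` (~` G) `&` sr @^-1` (first_in G @^-1` A)).
  apply/seteqP; split=> w /=.
    rewrite first_inE; case: ifPn => h hA; [left|right].
      by split => //; rewrite inE in h.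
    by split => // Gw; move/negP: h; apply; rewrite inE.
  move=> [[hA hG]|[hG hA]]; rewrite first_inE.
    by rewrite ifT// inE.
  by rewrite ifF//; apply/negbTE/negP; rewrite inE.
have PAG : P (sl @^-1` (A `&` G)) = P (A `&` G).
  rewrite -[LHS](_ : P (sl @^-1` (A `&` G) `&` sr @^-1` setT) = _).
    rewrite Psplit// ?probability_setT ?mule1//; exact: measurableI.
  by rewrite preimage_setT setIT.
have : P (first_in G @^-1` A) = (P (A `&` G) + (1 - P G) * P (first_in G @^-1` A))%E.
  rewrite [X in P X = _]e measureU//.
  - congr (_ + _)%E; first exact: PAG.
    by apply: etrans (Psplit (measurableC mG) mF) _; rewrite probability_setC.
  - by apply: preim_meas => //; exact: measurableI.
  - by apply: measurableI; apply: preim_meas => //; exact: measurableC.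
  - by rewrite -subset0 => w [[_ hG] [hG' _]].
have pk (D : set Om) : measurable D -> P D = (fine (P D))%:E.
  by move=> mD; rewrite fineK// fin_num_measure.
rewrite (pk _ mF) (pk G)// (pk (A `&` G)); last exact: measurableI.
rewrite -EFinB -!EFinM -EFinD => -[h]; congr (_%:E); lra.
Qed.

(* Rejection sampling: the first good or the first bad copy is used according to whether the uniform
   variable is below [P G], which leaves the law unchanged. *)
Definition resample (G : set Om) (w : Om) : Om :=
  if U (sl w) < fine (P G) then first_in G (sr w) else first_in (~` G) (sr w).

(** [P G] exceeds a nonnegative number, so [G] is not empty and [first_in_in] applies: there is no
    exceptional seed. *)
Lemma resample_in G w : measurable G -> 0 <= U (sl w) -> U (sl w) < fine (P G) ->
  G (resample G w).
Proof.
move=> mG u0 up; rewrite /resample up; apply: first_in_in; apply/set0P/eqP => G0.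
by move: up; rewrite G0 measure0/= ltNge u0.
Qed.

Lemma measurable_resample G : measurable G -> measurable_fun setT (resample G).
Proof.
move=> mG; apply: measurable_fun_ifT.
- apply: measurable_fun_ltr => //; exact: measurableT_comp.
- by apply: measurableT_comp => //; exact: measurable_first_in.
- by apply: measurableT_comp => //; apply: measurable_first_in; exact: measurableC.
Qed.

(** The first branch is chosen with probability [P G], exactly the factor in [P_first_in]; the two
    branches contribute the parts of [A] inside and outside [G]. *)
Lemma P_resample G A : measurable G -> measurable A -> P (resample G @^-1` A) = P A.
Proof.
move=> mG mA.
have mGC := measurableC mG.
pose p := fine (P G).
have PG : P G = p%:E by rewrite /p fineK// fin_num_measure.
have p0 : 0 <= p by rewrite fine_ge0.
have p1 : p <= 1 by rewrite -lee_fin -PG; exact: probability_le1.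
pose L : set Om := U @^-1` `]-oo, p[.
have mL : measurable L by rewrite -[X in measurable X]setTI; apply: mU => //; exact: measurable_itv.
have PL : P L = P G.
  rewrite PU; last exact: measurable_itv.
  rewrite (_ : _ `&` _ = `[0, p[%classic); last first.
    by apply/seteqP; split=> x /=; rewrite !in_itv/=; lra.
  rewrite lebesgue_measure_itv/= lte_fin PG; case: ltP => [_|h].
    by rewrite oppr0 adde0.
  by congr (_%:E); apply/le_anti; rewrite h p0.
have e : resample G @^-1` A = (sl @^-1` L `&` sr @^-1` (first_in G @^-1` A)) `|`
   (sl @^-1` (~` L) `&` sr @^-1` (first_in (~` G) @^-1` A)).
  apply/seteqP; split=> w.
    rewrite /resample/= -/p; case: ltP => [h hA|h hA]; [left|right]; split => //;
      rewrite /L/= in_itv/= ?h//; by rewrite ltNge h.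
  rewrite /resample /L/= in_itv/= -/p => -[[-> //]|[/negP/negbTE -> //]].
have m1 : measurable (first_in G @^-1` A).
  by apply: preim_meas => //; exact: measurable_first_in.
have m2 : measurable (first_in (~` G) @^-1` A).
  by apply: preim_meas => //; exact: measurable_first_in.
rewrite e measureU//.
- transitivity (P (A `&` G) + P (A `&` ~` G))%E.
    congr (_ + _)%E.
      by apply: etrans (Psplit mL m1) _; rewrite PL P_first_in.
    apply: etrans (Psplit (measurableC mL) m2) _.
    by rewrite probability_setC// PL -probability_setC// P_first_in.
  rewrite -[in RHS](setIT A) -(setUv G) setIUr; apply/esym/measureU.
  + exact: measurableI.
  + exact: measurableI.
  + by rewrite -subset0 => w [[_ h] [_ h']].
- by apply: measurableI; exact: preim_meas.
- by apply: measurableI; apply: preim_meas => //; exact: measurableC.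
- by rewrite -subset0 => w [[h _] [h' _]].
Qed.

End resampling.

(** * Approximate fluid solutions *)

Lemma derivable_expansion {R : realType} (f : R -> R) (t : R) : derivable f t 1 ->
  forall e, 0 < e -> exists2 rho, 0 < rho & forall h, `|h| < rho ->
    `|f (t + h) - f t - derive1 f t * h| <= e * `|h|.
Proof.
move=> df e e0.
have : (fun h => h^-1 *: ((f \o shift t) (h *: 1) - f t)) @ 0^' --> derive1 f t.
  by rewrite derive1E; exact: df.
move=> /cvgrPdist_le /(_ e e0) [rho /= rho0 H]; exists rho => // h hr.
have [->|hn0] := eqVneq h 0; first by rewrite addr0 subrr mulr0 subr0 normr0 mulr0.
have := H h; rewrite /ball_/= sub0r normrN => /(_ hr hn0).
rewrite /GRing.scale/= mulr1 => {}H.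
have -> : f (t + h) - f t - derive1 f t * h = - ((derive1 f t - h^-1 * (f (h + t) - f t)) * h).
  by rewrite (addrC h t); field.
by rewrite normrN normrM ler_wpM2r.
Qed.

Section approximate_solutions.
Context {R : realType}.
Local Notation mu := (@lebesgue_measure R).
Variables (lam beta eps : R) (gam : nat).
Hypotheses (lam0 : 0 < lam) (beta0 : 0 < beta) (eps0 : 0 < eps).

(* [z] is the path itself and [w] a Lipschitz curve within [eta] of it, driven by the drift at [z]
   and by a push [p] that vanishes unless [z] is within [eta] of the boundary. *)
Definition approx_sol (T eta B : R) (zy zx wy wx : R -> R) : Prop :=
  [/\ exists L, lip_on 0 T L wy, exists L, lip_on 0 T L wx,
    forall t, 0 <= t <= T -> [/\ `|zy t - wy t| <= eta, `|zx t - wx t| <= eta,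
       - (lam / beta) <= zx t, `|zy t| <= B & `|zx t| <= B] &
    {ae mu, forall t, 0 < t < T -> exists p, [/\ 0 <= p <= B,
       0 < p -> zx t <= - (lam / beta) + eta,
       is_derive t 1 wy (beta * zx t) &
       is_derive t 1 wx (- (gam%:R * beta * zx t) - eps * zy t + p)]}].

Lemma approx_solW T eta B eta' B' zy zx wy wx : eta <= eta' -> B <= B' ->
  approx_sol T eta B zy zx wy wx -> approx_sol T eta' B' zy zx wy wx.
Proof.
move=> ee BB [Ly Lx H1 H2]; split => //.
  move=> t /H1[a1 a2 a3 a4 a5]; split => //.
  - exact: le_trans ee.
  - exact: le_trans ee.
  - exact: le_trans BB.
  - exact: le_trans BB.
move: H2; apply: filterS; first exact: (ae_filter_ringOfSetsType mu).
move=> t H2 /H2[p [/andP[p0 pB] pe dy dx]]; exists p; split => //.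
  by rewrite p0 (le_trans pB).
by move=> /pe; lra.
Qed.

Lemma approx_sol_shorten T T' eta B zy zx wy wx : T' <= T ->
  approx_sol T eta B zy zx wy wx -> approx_sol T' eta B zy zx wy wx.
Proof.
move=> TT [[Ly ly] [Lx lx] H1 H2].
have sub t : 0 <= t <= T' -> 0 <= t <= T by move=> /andP[-> /le_trans->].
split.
- by exists Ly => s t /sub sT /sub tT; exact: ly.
- by exists Lx => s t /sub sT /sub tT; exact: lx.
- by move=> t /sub/H1.
move: H2; apply: filterS; first exact: (ae_filter_ringOfSetsType mu).
by move=> t H2 /andP[t0 tT]; apply: H2; rewrite t0 (lt_le_trans tT).
Qed.

Let normr_le (x y : R) : `|x| <= y -> (- y <= x) && (x <= y).
Proof. by rewrite ler_norml. Qed.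

(* The reflection terms only help: when [p > 0] the first path is at the boundary, up to
   [eta], hence below the second one. *)
Lemma energy_rate (B h a b dx dy p p' : R) : 0 <= B -> 0 <= h <= 2 ->
  `|a| <= 2 * B + 2 -> `|b| <= 2 * B + 2 ->
  `|dx - b| <= h -> `|dy - a| <= h -> 0 <= p <= B -> 0 <= p' <= B ->
  (0 < p -> b <= 2 * h) -> (0 < p' -> - b <= 2 * h) ->
  2 * a * (beta * dx) + 2 * b * (- (gam%:R * beta * dx) - eps * dy + (p - p')) <=
  (beta + eps) * (a ^+ 2 + b ^+ 2) +
  (2 * (2 * B + 2) * (beta + gam%:R * beta + eps) + 8 * B) * h.
Proof.
move=> B0 /andP[h0 h2] aB bB xb ya /andP[p0 pB] /andP[p0' pB'] pb pb'.
have prod_le (x y c k : R) : `|x| <= c -> `|y| <= k -> x * y <= c * k.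
  move=> xc yk; apply: (le_trans (ler_norm _)); rewrite normrM.
  by apply: ler_pM.
have e1 : a * (dx - b) <= (2 * B + 2) * h by exact: prod_le.
have e2 : (- b) * (dx - b) <= (2 * B + 2) * h by apply: prod_le; rewrite ?normrN.
have e3 : (- b) * (dy - a) <= (2 * B + 2) * h by apply: prod_le; rewrite ?normrN.
have e4 : b * p <= 2 * h * B.
  move: p0; rewrite le_eqVlt => /orP[/eqP <-|p0].
    by rewrite mulr0 mulr_ge0// mulr_ge0.
  have := pb p0 => {}pb.
  apply: (@le_trans _ _ (2 * h * p)); first by rewrite ler_wpM2r// ltW.
  by rewrite ler_wpM2l// mulr_ge0.
have e5 : - b * p' <= 2 * h * B.
  move: p0'; rewrite le_eqVlt => /orP[/eqP <-|p0'].
    by rewrite mulr0 mulr_ge0// mulr_ge0.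
  have := pb' p0' => {}pb'.
  apply: (@le_trans _ _ (2 * h * p')); first by rewrite ler_wpM2r// ltW.
  by rewrite ler_wpM2l// mulr_ge0.
have g0 : 0 <= gam%:R * beta by rewrite mulr_ge0// ltW.
have f1 := ler_wpM2l (ltW beta0) e1.
have f2 := ler_wpM2l g0 e2.
have f3 := ler_wpM2l (ltW eps0) e3.
(* Completing these squares bounds the cross terms [2 * beta * a * b] and [- 2 * eps * a * b],
   whence the rate [beta + eps]. *)
have s1 : 0 <= beta * (a - b) ^+ 2 by rewrite mulr_ge0 ?sqr_ge0// ltW.
have s2 : 0 <= eps * (a + b) ^+ 2 by rewrite mulr_ge0 ?sqr_ge0// ltW.
have s3 : 0 <= gam%:R * beta * b ^+ 2 by rewrite mulr_ge0 ?sqr_ge0.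
move: (gam%:R * beta) g0 f2 s3 => gb g0 f2 s3.
have -> : 2 * a * (beta * dx) + 2 * b * (- (gb * dx) - eps * dy + (p - p')) =
  (beta + eps) * (a ^+ 2 + b ^+ 2) - beta * (a - b) ^+ 2 - eps * (a + b) ^+ 2
  - 2 * (gb * b ^+ 2) + 2 * (beta * (a * (dx - b))) + 2 * (gb * (- b * (dx - b)))
  + 2 * (eps * (- b * (dy - a))) + 2 * (b * p) + 2 * (- b * p') by ring.
have -> : (2 * (2 * B + 2) * (beta + gb + eps) + 8 * B) * h =
  2 * (beta * ((2 * B + 2) * h)) + 2 * (gb * ((2 * B + 2) * h)) + 2 * (eps * ((2 * B + 2) * h))
  + 2 * (2 * h * B) + 2 * (2 * h * B) by ring.
lra.
Qed.

Let rate_ge0 (B : R) : 0 <= B ->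
  0 <= 2 * (2 * B + 2) * (beta + gam%:R * beta + eps) + 8 * B.
Proof.
move=> B0; have g0 : 0 <= gam%:R * beta by rewrite mulr_ge0// ltW.
move: (gam%:R * beta) g0 => gb g0.
have : 0 <= (2 * B + 2) * (beta + gb + eps) by rewrite mulr_ge0// ?addr_ge0// ?mulr_ge0//; exact: ltW.
lra.
Qed.

Lemma lip_on_sqrB (T L M : R) (f g : R -> R) : 0 <= T ->
  lip_on 0 T L f -> lip_on 0 T M g ->
  exists K, lip_on 0 T K (fun t => (f t - g t) ^+ 2).
Proof.
move=> T0 fL gM.
have H : lip_on 0 T (L + M) (fun t => f t - g t).
  move=> s t sT tT.
  have -> : f s - g s - (f t - g t) = (f s - f t) - (g s - g t) by ring.
  by rewrite (le_trans (ler_normB _ _))// [leRHS]mulrDl lerD ?fL ?gM.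
have [K hK] := lip_onM T0 H H; exists K => s t sT tT.
by have := hK s t sT tT; rewrite !expr2.
Qed.

(** Gronwall's inequality for the squared distance of the two curves. The error fed to [energy_rate]
    is [2 * eta], each path being within [eta] of its curve, and [2 * B + 2] bounds the differences
    because [eta <= 1]. *)
Lemma approx_sol_energy T eta B zy zx wy wx zy' zx' wy' wx' :
  0 <= T -> 0 <= B -> 0 <= eta <= 1 ->
  approx_sol T eta B zy zx wy wx -> approx_sol T eta B zy' zx' wy' wx' ->
  (wy T - wy' T) ^+ 2 + (wx T - wx' T) ^+ 2 <=
  ((wy 0 - wy' 0) ^+ 2 + (wx 0 - wx' 0) ^+ 2 +
   (2 * (2 * B + 2) * (beta + gam%:R * beta + eps) + 8 * B) * (2 * eta) * T) *
  expR ((beta + eps) * T).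
Proof.
move=> T0 B0 /andP[eta0 eta1] [[Ly ly] [Lx lx] H1 H2] [[Ly' ly'] [Lx' lx'] H1' H2'].
have [K1 k1] := lip_on_sqrB T0 ly ly'; have [K2 k2] := lip_on_sqrB T0 lx lx'.
pose D t := (wy t - wy' t) ^+ 2 + (wx t - wx' t) ^+ 2.
have DL : lip_on 0 T (K1 + K2) D by exact: lip_onD.
apply: (gronwall_ae _ _ T0 DL).
- by rewrite addr_ge0// ltW.
- by apply: mulr_ge0; [exact: rate_ge0|exact: mulr_ge0].
move: H2 H2'; apply: filterS2; first exact: (ae_filter_ringOfSetsType mu).
move=> t H2 H2' tT _.
have [p [pB pe dy dx]] := H2 tT; have [p' [pB' pe' dy' dx']] := H2' tT.
have tT' : 0 <= t <= T by case/andP: tT => /ltW -> /ltW ->.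
have [a1 a2 a3 a4 a5] := H1 _ tT'; have [b1 b2 b3 b4 b5] := H1' _ tT'.
have dD : is_derive t 1 D (2 * (wy t - wy' t) * (beta * zx t - beta * zx' t) +
  2 * (wx t - wx' t) * ((- (gam%:R * beta * zx t) - eps * zy t + p) -
                        (- (gam%:R * beta * zx' t) - eps * zy' t + p'))).
  have e1 := is_deriveB dy dy'; have e2 := is_deriveB dx dx'.
  have := is_deriveD (is_deriveM e1 e1) (is_deriveM e2 e2) => e3.
  apply: is_derive_eq e3 _; rewrite /GRing.scale/= !fctE; ring.
rewrite derive1E (@derive_val _ _ _ _ _ _ _ dD).
have := @energy_rate B (2 * eta) (wy t - wy' t) (wx t - wx' t) (zx t - zx' t) (zy t - zy' t) p p'.
move: a1 a2 a4 a5 b1 b2 b4 b5 => /normr_le a1 /normr_le a2 /normr_le a4 /normr_le a5.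
move=> /normr_le b1 /normr_le b2 /normr_le b4 /normr_le b5.
have E : 2 * (wy t - wy' t) * (beta * zx t - beta * zx' t) +
  2 * (wx t - wx' t) * ((- (gam%:R * beta * zx t) - eps * zy t + p) -
                        (- (gam%:R * beta * zx' t) - eps * zy' t + p')) =
  2 * (wy t - wy' t) * (beta * (zx t - zx' t)) + 2 * (wx t - wx' t) *
    (- (gam%:R * beta * (zx t - zx' t)) - eps * (zy t - zy' t) + (p - p')) by ring.
rewrite E; apply => //; rewrite ?ler_norml.
- by rewrite mulr_ge0//=; lra.
- lra.
- lra.
- lra.
- lra.
- by move=> /pe; lra.
- by move=> /pe'; lra.
Qed.

Lemma approx_sol_close T B e : 0 <= T -> 0 <= B -> 0 < e ->
  exists2 eta0, 0 < eta0 <= 1 & forall eta, 0 <= eta <= eta0 ->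
  forall zy zx wy wx zy' zx' wy' wx',
  approx_sol T eta B zy zx wy wx -> approx_sol T eta B zy' zx' wy' wx' ->
  `|wy 0 - wy' 0| <= 2 * eta -> `|wx 0 - wx' 0| <= 2 * eta ->
  forall t, 0 <= t <= T -> `|wy t - wy' t| <= e /\ `|wx t - wx' t| <= e.
Proof.
move=> T0 B0 e0.
pose K := 2 * (2 * B + 2) * (beta + gam%:R * beta + eps) + 8 * B.
have K0 : 0 <= K by exact: rate_ge0.
(* Each of the two initial squares is at most [(2 * eta) ^+ 2 <= 4 * eta], whence the 8. The energy
   is then at most [eta * M], to be kept below [e ^+ 2]. *)
pose M := (8 + K * 2 * T) * expR ((beta + eps) * T).
have M0 : 0 < M by rewrite mulr_gt0 ?expR_gt0// ltr_pwDl// !mulr_ge0.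
exists (Num.min 1 (e ^+ 2 / M)).
  by rewrite lt_min ltr01 divr_gt0 ?exprn_gt0//= ge_min lexx.
move=> eta; rewrite le_min => /andP[eta0 /andP[eta1 etaM]].
move=> zy zx wy wx zy' zx' wy' wx' A A' iy ix t /andP[t0 tT].
have etaE : 0 <= eta <= 1 by rewrite eta0.
have := approx_sol_energy t0 B0 etaE (approx_sol_shorten tT A) (approx_sol_shorten tT A').
rewrite -/K => H.
have sq (x : R) : `|x| <= 2 * eta -> x ^+ 2 <= 4 * eta.
  move=> xe; apply: (@le_trans _ _ ((2 * eta) ^+ 2)).
    by rewrite -(real_normK (num_real x)) lerXn2r ?nnegrE// mulr_ge0.
  have -> : (2 * eta) ^+ 2 = 4 * eta * eta by ring.
  by rewrite ler_piMr// mulr_ge0.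
have {}H : (wy t - wy' t) ^+ 2 + (wx t - wx' t) ^+ 2 <= e ^+ 2.
  apply: (le_trans H); apply: (@le_trans _ _ (eta * M)); last first.
    by rewrite -ler_pdivlMr.
  rewrite /M [leRHS]mulrA ler_pM ?expR_ge0//.
  - by rewrite addr_ge0 ?addr_ge0 ?sqr_ge0// !mulr_ge0.
  - have := sq _ iy; have := sq _ ix => s1 s2.
    have : K * (2 * eta) * t <= K * (2 * eta) * T by rewrite ler_wpM2l// !mulr_ge0.
    have -> : eta * (8 + K * 2 * T) = 4 * eta + 4 * eta + K * (2 * eta) * T by ring.
    by move=> h; apply: lerD => //; exact: lerD.
  - by rewrite ler_expR ler_wpM2l// addr_ge0// ltW.
have absle (x y : R) : x ^+ 2 + y ^+ 2 <= e ^+ 2 -> `|x| <= e.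
  move=> h; rewrite -(@ler_pXn2r _ 2) ?nnegrE ?(ltW e0)//.
  by rewrite (real_normK (num_real x)) (le_trans _ h)// lerDl sqr_ge0.
by split; [exact: absle H|apply: absle; rewrite addrC; exact: H].
Qed.

(** With error 0 the path is its own curve: on the boundary the push is the gap between the
    reflected drift and the linear one, elsewhere it vanishes. Almost every point is regular because
    the maximum and the minimum of Lipschitz functions are Lipschitz. *)
Lemma fluid_approx_sol y0 x0 y x T : 0 <= T -> fluid_solution lam beta eps gam y0 x0 y x ->
  exists2 B, 0 <= B & approx_sol T 0 B y x y x.
Proof.
move=> T0 [_ [_ [ly [lx [xge reg]]]]].
have [Ly yL] := ly T; have [Lx xL] := lx T.
have [By By0 yB] := lip_on_bounded T0 yL; have [Bx Bx0 xB] := lip_on_bounded T0 xL.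
have eBy : 0 <= eps * By by rewrite mulr_ge0// ltW.
(* The last summand bounds the push, which on the boundary is the positive part of
   [eps * y t - gam%:R * lam]. *)
exists (By + Bx + eps * By); first by rewrite !addr_ge0.
split; [by exists Ly|by exists Lx| |].
  move=> t tT; have := yB t tT; have := xB t tT => h1 h2.
  by rewrite !subrr normr0; split => //; [apply: xge; case/andP: tT|lra|lra].
have maxL : lip_on 0 T (`|Ly| + `|Lx|) (fun s => Num.max (y s) (x s)).
  move=> s t sT tT; have := yL s t sT tT; have := xL s t sT tT => h1 h2.
  have k1 : Ly * `|s - t| <= `|Ly| * `|s - t| by rewrite ler_wpM2r// ler_norm.
  have k2 : Lx * `|s - t| <= `|Lx| * `|s - t| by rewrite ler_wpM2r// ler_norm.
  have k3 : 0 <= `|Ly| * `|s - t| by rewrite mulr_ge0.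
  have k4 : 0 <= `|Lx| * `|s - t| by rewrite mulr_ge0.
  rewrite mulrDl; move: h1 h2 => /normr_le h1 /normr_le h2.
  rewrite ler_norml /Num.max; case: ltP => ?; case: ltP => ?; lra.
have minL : lip_on 0 T (`|Ly| + `|Lx|) (fun s => Num.min (y s) (x s)).
  move=> s t sT tT; have := yL s t sT tT; have := xL s t sT tT => h1 h2.
  have k1 : Ly * `|s - t| <= `|Ly| * `|s - t| by rewrite ler_wpM2r// ler_norm.
  have k2 : Lx * `|s - t| <= `|Lx| * `|s - t| by rewrite ler_wpM2r// ler_norm.
  have k3 : 0 <= `|Ly| * `|s - t| by rewrite mulr_ge0.
  have k4 : 0 <= `|Lx| * `|s - t| by rewrite mulr_ge0.
  rewrite mulrDl; move: h1 h2 => /normr_le h1 /normr_le h2.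
  rewrite ler_norml /Num.min; case: ltP => ?; case: ltP => ?; lra.
have a1 := lip_on_ae_derivable yL; have a2 := lip_on_ae_derivable xL.
have a3 := lip_on_ae_derivable maxL; have a4 := lip_on_ae_derivable minL.
have : {ae mu, forall t, 0 < t < T -> regular_pt y x t}.
  have a12 : {ae mu, forall t, 0 < t < T -> derivable y t 1 /\ derivable x t 1}.
    move: a1 a2; apply: filterS2; first exact: (ae_filter_ringOfSetsType mu).
    by move=> t h1 h2 tT; split; [exact: h1|exact: h2].
  move: a12 a3 a4; apply: filterS3; first exact: (ae_filter_ringOfSetsType mu).
  move=> t h12 h3 h4 tT; have [h1 h2] := h12 tT.
  exact: (conj h1 (conj h2 (conj (h3 tT) (h4 tT)))).
apply: filterS; first exact: (ae_filter_ringOfSetsType mu).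
move=> t ht tT; have rt := ht tT; have [t0 tT'] := andP tT.
have ht' : 0 <= t <= T by rewrite !ltW.
have [dy [dx _]] := rt; have [r1 r2] := reg t t0 rt.
have Dy : is_derive t 1 y (derive1 y t) by rewrite derive1E; exact: DeriveDef.
have Dx : is_derive t 1 x (derive1 x t) by rewrite derive1E; exact: DeriveDef.
have := xge t (ltW t0); rewrite le_eqVlt => /orP[/eqP xe|xgt].
  have [e1 e2] := r2 (esym xe).
  have ye : - (eps * By) <= eps * y t <= eps * By.
    have /normr_le/andP[h1 h2] := yB t ht'.
    by rewrite -mulrN !ler_wpM2l// ltW.
  have bl : beta * (lam / beta) = lam by field; rewrite gt_eqF.
  have gl : gam%:R * beta * (lam / beta) = gam%:R * lam by rewrite -mulrA bl.
  have gl0 : 0 <= gam%:R * lam by rewrite mulr_ge0// ltW.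
  exists (Num.max (gam%:R * lam - eps * y t) 0 - (gam%:R * lam - eps * y t)); split.
  - rewrite /Num.max; case: ltP => ?; lra.
  - by rewrite -xe addr0.
  - by rewrite -xe mulrN bl -e1.
  - rewrite -xe mulrN gl opprK.
    by apply: is_derive_eq Dx _; rewrite e2; ring.
have [e1 e2] := r1 xgt; exists 0; split => //.
- by rewrite lexx !addr_ge0.
- by rewrite ltxx.
- by rewrite -e1.
- by rewrite addr0 -e2.
Qed.

End approximate_solutions.

(** Derivability being given, increments to the right alone decide the bound. *)
Lemma derive1_le {R : realType} (f : R -> R) (t c : R) : derivable f t 1 ->
  (forall e, 0 < e -> exists2 rho, 0 < rho &
     forall h, 0 < h < rho -> f (t + h) - f t <= (c + e) * h) ->
  derive1 f t <= c.
Proof.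
move=> df H; apply/ler_addgt0Pr => e e0; have e20 : 0 < e / 2 by rewrite divr_gt0.
have [r1 r10 H1] := derivable_expansion df e20; have [r2 r20 H2] := H _ e20.
pose h := Num.min r1 r2 / 2.
have m0 : 0 < Num.min r1 r2 by rewrite lt_min r10.
have h0 : 0 < h by rewrite divr_gt0.
have hm : h < Num.min r1 r2 by rewrite /h ltr_pdivrMr// ltr_pMr// ltr1n.
have [hr1 hr2] : h < r1 /\ h < r2 by move: hm; rewrite lt_min => /andP.
have hr2' : 0 < h < r2 by rewrite h0.
have := H1 h; rewrite gtr0_norm// => /(_ hr1); rewrite ler_norml => /andP[k1 _].
have k2 := H2 h hr2'.
have : derive1 f t * h <= (c + e) * h by lra.
by rewrite ler_pM2r.
Qed.

Lemma derive1_ge {R : realType} (f : R -> R) (t c : R) : derivable f t 1 ->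
  (forall e, 0 < e -> exists2 rho, 0 < rho &
     forall h, 0 < h < rho -> (c - e) * h <= f (t + h) - f t) ->
  c <= derive1 f t.
Proof.
move=> df H; apply/ler_addgt0Pr => e e0; have e20 : 0 < e / 2 by rewrite divr_gt0.
have [r1 r10 H1] := derivable_expansion df e20; have [r2 r20 H2] := H _ e20.
pose h := Num.min r1 r2 / 2.
have m0 : 0 < Num.min r1 r2 by rewrite lt_min r10.
have h0 : 0 < h by rewrite divr_gt0.
have hm : h < Num.min r1 r2 by rewrite /h ltr_pdivrMr// ltr_pMr// ltr1n.
have [hr1 hr2] : h < r1 /\ h < r2 by move: hm; rewrite lt_min => /andP.
have hr2' : 0 < h < r2 by rewrite h0.
have := H1 h; rewrite gtr0_norm// => /(_ hr1); rewrite ler_norml => /andP[_ k1].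
have k2 := H2 h hr2'.
have : c * h <= (derive1 f t + e) * h by lra.
by rewrite ler_pM2r.
Qed.

Lemma derive1_min {R : realType} (f : R -> R) (t : R) : 0 < t -> derivable f t 1 ->
  (forall s, 0 <= s -> f t <= f s) -> derive1 f t = 0.
Proof.
move=> t0 df fmin; apply/le_anti/andP; split; last first.
  apply: derive1_ge => // e e0; exists 1 => // h /andP[h0 _].
  have : f t <= f (t + h) by apply: fmin; rewrite addr_ge0// ltW.
  have : 0 < e * h by rewrite mulr_gt0.
  lra.
apply/ler_addgt0Pr => e e0.
have [r1 r10 H1] := derivable_expansion df e0.
pose h := Num.min r1 t / 2.
have m0 : 0 < Num.min r1 t by rewrite lt_min r10.
have h0 : 0 < h by rewrite divr_gt0.
have hm : h < Num.min r1 t by rewrite /h ltr_pdivrMr// ltr_pMr// ltr1n.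
have [hr1 hr2] : h < r1 /\ h < t by move: hm; rewrite lt_min => /andP.
have := H1 (- h); rewrite normrN gtr0_norm// => /(_ hr1); rewrite ler_norml => /andP[_ k1].
have k2 : f t <= f (t - h) by apply: fmin; rewrite subr_ge0 ltW.
have : derive1 f t * h <= (0 + e) * h by lra.
by rewrite ler_pM2r.
Qed.

Lemma lip_on_incr_le {R : realType} (T L c s t : R) (f : R -> R) :
  lip_on 0 T L f -> 0 <= s -> s <= t -> t <= T ->
  {ae @lebesgue_measure R, forall u, s < u < t -> exists2 d, is_derive u 1 f d & d <= c} ->
  f t - f s <= c * (t - s).
Proof.
move=> fL s0 st tT H; apply: (@lip_on_ae_le _ s t L) => //.
  by move=> u v /andP[su ut] /andP[sv vt]; apply: fL; lra.
move: H; apply: filterS; first exact: (ae_filter_ringOfSetsType lebesgue_measure).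
move=> u Hu /Hu [d du dc] _.
by rewrite derive1E (@derive_val _ _ _ _ _ _ _ du).
Qed.

Lemma lip_on_incr_ge {R : realType} (T L c s t : R) (f : R -> R) :
  lip_on 0 T L f -> 0 <= s -> s <= t -> t <= T ->
  {ae @lebesgue_measure R, forall u, s < u < t -> exists2 d, is_derive u 1 f d & c <= d} ->
  c * (t - s) <= f t - f s.
Proof.
move=> fL s0 st tT H.
have := @lip_on_incr_le _ T L (- c) s t (- f) _ s0 st tT.
rewrite !fctE => H'; suff : - f t - - f s <= - c * (t - s) by lra.
apply: H'.
  by move=> u v uT vT; rewrite opprK addrC distrC; exact: fL.
move: H; apply: filterS; first exact: (ae_filter_ringOfSetsType lebesgue_measure).
move=> u Hu /Hu [d du dc]; exists (- d); last by rewrite lerN2.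
exact: is_deriveN.
Qed.

Lemma cauchy_limit {R : realType} (u : nat -> R) :
  (forall e, 0 < e -> exists m0, forall m n, (m0 <= m)%N -> (m0 <= n)%N ->
     `|u m - u n| <= e) ->
  exists l, forall e, 0 < e -> exists m0, forall m, (m0 <= m)%N -> `|u m - l| <= e.
Proof.
move=> H.
have : cauchy (u @ \oo).
  apply: cauchy_exP => e e0; have e20 : 0 < e / 2 by rewrite divr_gt0.
  have [m0 Hm] := H _ e20; exists (u m0); exists m0 => // m /= m0m.
  rewrite /ball/=; apply: le_lt_trans (Hm _ _ (leqnn _) m0m) _.
  by rewrite ltr_pdivrMr// ltr_pMr// ltr1n.
move=> /cauchy_cvgP/cvg_ex[l /cvgrPdist_le cl]; exists l => e e0.
have [m0 _ h] := cl e e0; exists m0 => m m0m; rewrite distrC; exact: h.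
Qed.

(** * Limits of approximate solutions *)

Section fluid_limit.
Context {R : realType}.
Local Notation mu := (@lebesgue_measure R).
Variables (lam beta eps : R) (gam : nat).
Hypotheses (lam0 : 0 < lam) (beta0 : 0 < beta) (eps0 : 0 < eps).
Variables (y0 x0 : R) (zy zx wy wx : nat -> R -> R).
Local Notation approx T eta B m :=
  (approx_sol lam beta eps gam T eta B (zy m) (zx m) (wy m) (wx m)).
Hypothesis H : forall T, 0 <= T -> exists2 B, 0 <= B &
  forall eta, 0 < eta -> exists m0, forall m, (m0 <= m)%N ->
  [/\ approx T eta B m, `|wy m 0 - y0| <= eta & `|wx m 0 - x0| <= eta].

(** In [H] the bound [B] precedes [eta], so the threshold that [approx_sol_close] gives for this [B]
    may serve as the error. *)
Let unif_cauchy T e : 0 <= T -> 0 < e -> exists m0, forall m n, (m0 <= m)%N -> (m0 <= n)%N ->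
  forall t, 0 <= t <= T -> `|wy m t - wy n t| <= e /\ `|wx m t - wx n t| <= e.
Proof.
move=> T0 e0; have [B B0 HB] := H T0.
have [eta0 /andP[eta00 _] Hc] := approx_sol_close lam gam beta0 eps0 T0 B0 e0.
have [m0 Hm] := HB _ eta00; exists m0 => m n m0m m0n.
have [A1 i1 j1] := Hm m m0m; have [A2 i2 j2] := Hm n m0n.
apply: (Hc eta0 _ _ _ _ _ _ _ _ _ A1 A2); first by rewrite lexx ltW.
- move: i1 i2; rewrite !ler_norml; lra.
- move: j1 j2; rewrite !ler_norml; lra.
Qed.

Let limits : exists y x : R -> R, forall T e, 0 <= T -> 0 < e -> exists m0, forall m,
  (m0 <= m)%N -> forall t, 0 <= t <= T -> `|wy m t - y t| <= e /\ `|wx m t - x t| <= e.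
Proof.
have Ly t : exists l, 0 <= t -> forall e, 0 < e -> exists m0, forall m, (m0 <= m)%N -> `|wy m t - l| <= e.
  have [t0|t0] := leP 0 t; last by exists 0.
  have [e e0|l hl] := @cauchy_limit _ (fun m => wy m t); last by exists l.
  have [m0 hm] := unif_cauchy t0 e0; exists m0 => m n mm mn.
  by have [] := hm m n mm mn t; rewrite ?t0 ?lexx.
have Lx t : exists l, 0 <= t -> forall e, 0 < e -> exists m0, forall m, (m0 <= m)%N -> `|wx m t - l| <= e.
  have [t0|t0] := leP 0 t; last by exists 0.
  have [e e0|l hl] := @cauchy_limit _ (fun m => wx m t); last by exists l.
  have [m0 hm] := unif_cauchy t0 e0; exists m0 => m n mm mn.
  by have [] := hm m n mm mn t; rewrite ?t0 ?lexx.
have [y hy] := choice Ly; have [x hx] := choice Lx.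
exists y, x => T e T0 e0; have e20 : 0 < e / 2 by rewrite divr_gt0.
have [m0 hm] := unif_cauchy T0 e20; exists m0 => m m0m t /[dup] tT /andP[t0 _].
have [m1 hm1] := hy t t0 _ e20; have [m2 hm2] := hx t t0 _ e20.
pose n := maxn m0 (maxn m1 m2).
have n0 : (m0 <= n)%N by rewrite leq_maxl.
have n1 : (m1 <= n)%N by rewrite /n; lia.
have n2 : (m2 <= n)%N by rewrite /n; lia.
have [h1 h2] := hm m n m0m n0 t tT.
have := hm1 n n1; have := hm2 n n2; move: h1 h2; rewrite !ler_norml; lra.
Qed.

(** Increment bounds on short intervals survive the limit. As the push is nonnegative, the linear
    drift [lin t] bounds the derivative of [x] from below everywhere, and off the boundary the push
    vanishes near [t], which gives equality. On the boundary [x] has a minimum, so its derivative is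
    0; the lower bound then forces [lin t <= 0], in agreement with the maximum in the limiting
    equation. *)
Lemma fluid_limit : exists y x, fluid_solution lam beta eps gam y0 x0 y x.
Proof.
have [y [x yx]] := limits; exists y, x.
have g0 : 0 <= gam%:R * beta by rewrite mulr_ge0// ltW.
have le_lim (a b : R) : (forall e, 0 < e -> a <= b + e) -> a <= b.
  by move=> h; apply/ler_addgt0Pr.
have yinit : y 0 = y0.
  apply/eqP; rewrite -subr_eq0 -normr_le0; apply: le_lim => e e0.
  have e20 : 0 < e / 2 by rewrite divr_gt0.
  have [B B0 /(_ _ e20)[m0 hm]] := H (lexx 0).
  have [m1 hm1] := yx 0 _ (lexx 0) e20.
  have [_ i1 _] := hm (maxn m0 m1) (leq_maxl _ _).
  have [|i2 _] := hm1 (maxn m0 m1) (leq_maxr _ _) 0; first by rewrite lexx.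
  move: i1 i2; rewrite !ler_norml; lra.
have xinit : x 0 = x0.
  apply/eqP; rewrite -subr_eq0 -normr_le0; apply: le_lim => e e0.
  have e20 : 0 < e / 2 by rewrite divr_gt0.
  have [B B0 /(_ _ e20)[m0 hm]] := H (lexx 0).
  have [m1 hm1] := yx 0 _ (lexx 0) e20.
  have [_ _ i1] := hm (maxn m0 m1) (leq_maxl _ _).
  have [|_ i2] := hm1 (maxn m0 m1) (leq_maxr _ _) 0; first by rewrite lexx.
  move: i1 i2; rewrite !ler_norml; lra.
have close T : 0 <= T -> exists2 B, 0 <= B & forall e, 0 < e -> exists m,
    approx T e B m /\ forall t, 0 <= t <= T -> `|wy m t - y t| <= e /\ `|wx m t - x t| <= e.
  move=> T0; have [B B0 HB] := H T0; exists B => // e e0.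
  have [m0 hm] := HB e e0; have [m1 hm1] := yx T e T0 e0.
  exists (maxn m0 m1); have [A _ _] := hm _ (leq_maxl m0 m1); split => //.
  exact: hm1 _ (leq_maxr _ _).
have lip T : 0 <= T -> exists2 K, 0 <= K & lip_on 0 T K y /\ lip_on 0 T K x.
  move=> T0; have [B B0 cl] := close T T0.
  (* A bound for both slopes of every approximating curve; the final 1 accounts for the push. *)
  pose K := (beta + gam%:R * beta + eps + 1) * B.
  have K0 : 0 <= K by rewrite mulr_ge0// !addr_ge0// ltW.
  have bB : 0 <= beta * B by rewrite mulr_ge0// ltW.
  have eB : 0 <= eps * B by rewrite mulr_ge0// ltW.
  have gB : 0 <= gam%:R * beta * B by rewrite mulr_ge0.
  have KE : K = beta * B + gam%:R * beta * B + eps * B + B by rewrite /K; ring.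
  exists K => //.
  suff L s t : 0 <= s -> s <= t -> t <= T -> `|y s - y t| <= K * (t - s) /\ `|x s - x t| <= K * (t - s).
    split=> s t /andP[s0 sT] /andP[t0 tT].
      have [st|/ltW ts] := leP s t.
        by rewrite (distrC s) [X in _ <= _ * X]ger0_norm ?subr_ge0//; have [] := L s t s0 st tT.
      by rewrite distrC [X in _ <= _ * X]ger0_norm ?subr_ge0//; have [] := L t s t0 ts sT.
    have [st|/ltW ts] := leP s t.
      by rewrite (distrC s) [X in _ <= _ * X]ger0_norm ?subr_ge0//; have [] := L s t s0 st tT.
    by rewrite distrC [X in _ <= _ * X]ger0_norm ?subr_ge0//; have [] := L t s t0 ts sT.
  move=> s0 st tT.
  have sT : 0 <= s <= T by rewrite s0 (le_trans st).
  have tT' : 0 <= t <= T by rewrite tT (le_trans s0).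
  have key e : 0 < e -> exists m, [/\ `|wy m s - y s| <= e, `|wx m s - x s| <= e,
      `|wy m t - y t| <= e, `|wx m t - x t| <= e &
      `|wy m t - wy m s| <= K * (t - s) /\ `|wx m t - wx m s| <= K * (t - s)].
    move=> e0; have [m [[[Ly ly] [Lx lx] H1 H2] hc]] := cl e e0; exists m.
    have [c1 c2] := hc s sT; have [c3 c4] := hc t tT'.
    have sub u : s < u < t -> 0 < u < T.
      by move=> /andP[su ut]; rewrite (le_lt_trans s0 su) (lt_le_trans ut tT).
    have bnd u : 0 < u < T -> forall p, 0 <= p <= B ->
       [/\ - K <= beta * zx m u, beta * zx m u <= K,
         - K <= - (gam%:R * beta * zx m u) - eps * zy m u + p &
         - (gam%:R * beta * zx m u) - eps * zy m u + p <= K].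
      move=> /andP[u0 uT] p /andP[p0 pB].
      have [|_ _ _ ] := H1 u; first by rewrite !ltW.
      rewrite !ler_norml => /andP[a1 a2] /andP[b1 b2].
      have := ler_wpM2l (ltW beta0) b1; have := ler_wpM2l (ltW beta0) b2.
      have := ler_wpM2l g0 b1; have := ler_wpM2l g0 b2.
      have := ler_wpM2l (ltW eps0) a1; have := ler_wpM2l (ltW eps0) a2.
      rewrite KE !mulrN => q1 q2 q3 q4 q5 q6.
      move: (beta * zx m u) (beta * B) (eps * zy m u) (eps * B) bB eB q1 q2 q5 q6.
      move: (gam%:R * beta * zx m u) (gam%:R * beta * B) gB q3 q4 => *; split; lra.
    have c5 : `|wy m t - wy m s| <= K * (t - s).
      rewrite ler_norml; apply/andP; split.
        rewrite -mulNr; apply: (lip_on_incr_ge ly) => //.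
        move: H2; apply: filterS; first exact: (ae_filter_ringOfSetsType mu).
        move=> u Hu /sub/[dup] uT /Hu[p [pB _ dy _]]; exists (beta * zx m u) => //.
        by have [] := bnd u uT p pB.
      apply: (lip_on_incr_le ly) => //.
      move: H2; apply: filterS; first exact: (ae_filter_ringOfSetsType mu).
      move=> u Hu /sub/[dup] uT /Hu[p [pB _ dy _]]; exists (beta * zx m u) => //.
      by have [] := bnd u uT p pB.
    have c6 : `|wx m t - wx m s| <= K * (t - s).
      rewrite ler_norml; apply/andP; split.
        rewrite -mulNr; apply: (lip_on_incr_ge lx) => //.
        move: H2; apply: filterS; first exact: (ae_filter_ringOfSetsType mu).
        move=> u Hu /sub/[dup] uT /Hu[p [pB _ _ dx]].
        by exists (- (gam%:R * beta * zx m u) - eps * zy m u + p) => //; have [] := bnd u uT p pB.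
      apply: (lip_on_incr_le lx) => //.
      move: H2; apply: filterS; first exact: (ae_filter_ringOfSetsType mu).
      move=> u Hu /sub/[dup] uT /Hu[p [pB _ _ dx]].
      by exists (- (gam%:R * beta * zx m u) - eps * zy m u + p) => //; have [] := bnd u uT p pB.
    by [].
  split; apply: le_lim => e e0; have e20 : 0 < e / 2 by rewrite divr_gt0.
    have [m [k1 _ k3 _ [k5 _]]] := key _ e20.
    move: (K * (t - s)) k5 => KK; move: k1 k3; rewrite !ler_norml; lra.
  have [m [_ k2 _ k4 [_ k6]]] := key _ e20.
  move: (K * (t - s)) k6 => KK; move: k2 k4; rewrite !ler_norml; lra.
have xge t : 0 <= t -> - (lam / beta) <= x t.
  move=> t0; apply: le_lim => e e0; have e20 : 0 < e / 2 by rewrite divr_gt0.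
  have [B _ /(_ _ e20)[m [[_ _ H1 _] hc]]] := close t t0.
  have tt : 0 <= t <= t by rewrite t0 lexx.
  have [_ k1 k2 _ _] := H1 t tt; have [_ k3] := hc t tt.
  move: (lam / beta) k1 k2 k3 => lb; rewrite !ler_norml; lra.
pose lin t := - (gam%:R * beta * x t) - eps * y t.
(* The paths stay within [dl] of [y t] and [x t] just after [t]. The upper bound for [x] asks for a
   margin [2 * dl] from the boundary: the path then stays more than [dl] away from it, while the
   push acts only within [dl / 3]. *)
have incr t dl : 0 < t -> 0 < dl -> exists2 rho, 0 < rho & forall h, 0 < h < rho ->
    [/\ y (t + h) - y t <= (beta * x t + beta * dl) * h,
        (beta * x t - beta * dl) * h <= y (t + h) - y t,
        (lin t - (gam%:R * beta + eps) * dl) * h <= x (t + h) - x t &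
        - (lam / beta) + 2 * dl < x t ->
        x (t + h) - x t <= (lin t + (gam%:R * beta + eps) * dl) * h].
  move=> t0 dl0; have T0 : 0 <= t + 1 by rewrite addr_ge0// ltW.
  have [K K0 [yL xL]] := lip _ T0.
  (* One third each for the distance from path to curve, from curve to limit, and for the
     oscillation of the limit on [[t, t + h]]. *)
  have d30 : 0 < dl / 3 by rewrite divr_gt0.
  have K10 : 0 < K + 1 by rewrite ltr_wpDl.
  pose rho := Num.min 1 (dl / 3 / (K + 1)).
  have rho0 : 0 < rho by rewrite lt_min ltr01 divr_gt0.
  have rho1 : rho <= 1 by rewrite ge_min lexx.
  have rhoK : K * rho <= dl / 3.
    have : rho <= dl / 3 / (K + 1) by rewrite ge_min lexx orbT.
    rewrite ler_pdivlMr// => h; apply: le_trans h; by rewrite mulrC ler_pM2l// lerDl.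
  exists rho => // h /andP[h0 hr].
  have th : t <= t + h by rewrite lerDl ltW.
  have hT : t + h <= t + 1 by rewrite lerD2l (le_trans (ltW hr)).
  have tT : 0 <= t <= t + 1 by rewrite ltW//= lerDl.
  have thT : 0 <= t + h <= t + 1 by rewrite hT addr_ge0// ltW.
  have [B B0 cl] := close _ T0.
  have incr_m e : 0 < e -> exists m, [/\ `|wy m t - y t| <= e, `|wx m t - x t| <= e,
      `|wy m (t + h) - y (t + h)| <= e, `|wx m (t + h) - x (t + h)| <= e &
    [/\ wy m (t + h) - wy m t <= (beta * x t + beta * dl) * h,
        (beta * x t - beta * dl) * h <= wy m (t + h) - wy m t,
        (lin t - (gam%:R * beta + eps) * dl) * h <= wx m (t + h) - wx m t &
        - (lam / beta) + 2 * dl < x t ->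
        wx m (t + h) - wx m t <= (lin t + (gam%:R * beta + eps) * dl) * h]].
    move=> e0; have m0 : 0 < Num.min e (dl / 3) by rewrite lt_min e0.
    have [m [[[Ly ly] [Lx lx] H1 H2] hc]] := cl _ m0; exists m.
    set mm := Num.min e (dl / 3) in m0 H1 H2 hc.
    have me : mm <= e by rewrite ge_min lexx.
    have md : mm <= dl / 3 by rewrite ge_min lexx orbT.
    have [c1 c2] := hc t tT; have [c3 c4] := hc _ thT.
    have zclose u : t < u < t + h -> [/\ 0 < u < t + 1, `|zy m u - y t| <= dl & `|zx m u - x t| <= dl].
      move=> /andP[tu uh].
      have uT : 0 < u < t + 1 by rewrite (lt_trans t0 tu) (lt_le_trans uh).
      have uT' : 0 <= u <= t + 1 by case/andP: uT => /ltW -> /ltW ->.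
      have [p1 p2 _ _ _] := H1 u uT'; have [p3 p4] := hc u uT'.
      have ku : K * `|u - t| <= dl / 3.
        apply: le_trans rhoK; rewrite ler_wpM2l// gtr0_norm ?subr_gt0//; lra.
      have p5 := le_trans (yL u t uT' tT) ku; have p6 := le_trans (xL u t uT' tT) ku.
      split => //.
        by move: p1 p3 p5; rewrite !ler_norml; lra.
      by move: p2 p4 p6; rewrite !ler_norml; lra.
    have lins u : t < u < t + h ->
      [/\ beta * zx m u <= beta * x t + beta * dl, beta * x t - beta * dl <= beta * zx m u,
          lin t - (gam%:R * beta + eps) * dl <= - (gam%:R * beta * zx m u) - eps * zy m u &
          - (gam%:R * beta * zx m u) - eps * zy m u <= lin t + (gam%:R * beta + eps) * dl].
      move=> /zclose[_]; rewrite !ler_norml => /andP[a1 a2] /andP[b1 b2].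
      have := ler_wpM2l (ltW beta0) b1; have := ler_wpM2l (ltW beta0) b2.
      have := ler_wpM2l g0 b1; have := ler_wpM2l g0 b2.
      have := ler_wpM2l (ltW eps0) a1; have := ler_wpM2l (ltW eps0) a2.
      rewrite /lin !mulrN !mulrBr mulrDl => q1 q2 q3 q4 q5 q6.
      move: (beta * zx m u) (beta * x t) (beta * dl) q5 q6 => ? ? ? q5 q6.
      move: (eps * zy m u) (eps * y t) (eps * dl) q1 q2 => ? ? ? q1 q2.
      move: (gam%:R * beta * zx m u) (gam%:R * beta * x t) (gam%:R * beta * dl) q3 q4 => ? ? ? q3 q4.
      by split; lra.
    have hE : t + h - t = h by ring.
    split; [exact: le_trans me|exact: le_trans me|exact: le_trans me|exact: le_trans me|].
    split.
    - rewrite -[X in _ <= _ * X]hE; apply: (lip_on_incr_le ly) => //; first exact: ltW.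
      move: H2; apply: filterS; first exact: (ae_filter_ringOfSetsType mu).
      move=> u Hu uh; have [uT _ _] := zclose u uh; have [p [_ _ dy _]] := Hu uT.
      by exists (beta * zx m u) => //; have [] := lins u uh.
    - rewrite -[X in _ * X <= _]hE; apply: (lip_on_incr_ge ly) => //; first exact: ltW.
      move: H2; apply: filterS; first exact: (ae_filter_ringOfSetsType mu).
      move=> u Hu uh; have [uT _ _] := zclose u uh; have [p [_ _ dy _]] := Hu uT.
      by exists (beta * zx m u) => //; have [] := lins u uh.
    - rewrite -[X in _ * X <= _]hE; apply: (lip_on_incr_ge lx) => //; first exact: ltW.
      move: H2; apply: filterS; first exact: (ae_filter_ringOfSetsType mu).
      move=> u Hu uh; have [uT _ _] := zclose u uh; have [p [/andP[p0 _] _ _ dx]] := Hu uT.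
      exists (- (gam%:R * beta * zx m u) - eps * zy m u + p) => //.
      have [_ _ l3 _] := lins u uh; exact: ler_wpDr.
    - move=> xb.
      rewrite -[X in _ <= _ * X]hE; apply: (lip_on_incr_le lx) => //; first exact: ltW.
      move: H2; apply: filterS; first exact: (ae_filter_ringOfSetsType mu).
      move=> u Hu uh; have [uT _ zc] := zclose u uh; have [p [/andP[p0 _] pe _ dx]] := Hu uT.
      exists (- (gam%:R * beta * zx m u) - eps * zy m u + p) => //.
      have [_ _ _ l4] := lins u uh.
      have pE : p = 0.
        apply/eqP; apply: contraT => pn; exfalso.
        have pp : 0 < p by rewrite lt_def pn p0.
        have := pe pp; move: zc xb; rewrite ler_norml.
        move: (lam / beta) => lb; lra.
      by rewrite pE addr0.
  split.
  - apply: le_lim => e e0; have e20 : 0 < e / 2 by rewrite divr_gt0.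
    have [m [c1 _ c3 _ [k _ _ _]]] := incr_m _ e20.
    move: ((beta * x t + beta * dl) * h) k c1 c3 => V; rewrite !ler_norml; lra.
  - apply: le_lim => e e0; have e20 : 0 < e / 2 by rewrite divr_gt0.
    have [m [c1 _ c3 _ [_ k _ _]]] := incr_m _ e20.
    move: ((beta * x t - beta * dl) * h) k c1 c3 => V; rewrite !ler_norml; lra.
  - apply: le_lim => e e0; have e20 : 0 < e / 2 by rewrite divr_gt0.
    have [m [_ c1 _ c3 [_ _ k _]]] := incr_m _ e20.
    move: ((lin t - (gam%:R * beta + eps) * dl) * h) k c1 c3 => V; rewrite !ler_norml; lra.
  - move=> xb; apply: le_lim => e e0; have e20 : 0 < e / 2 by rewrite divr_gt0.
    have [m [_ c1 _ c3 [_ _ _ /(_ xb) k]]] := incr_m _ e20.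
    move: ((lin t + (gam%:R * beta + eps) * dl) * h) k c1 c3 => V; rewrite !ler_norml; lra.
split => //; split => //; split; last split; last split => //.
- move=> T; have [T0|T0] := leP 0 T.
    by have [K _ [yL _]] := lip T T0; exists K.
  by exists 0 => s u /andP[s0 sT]; move: (le_trans s0 sT); rewrite leNgt T0.
- move=> T; have [T0|T0] := leP 0 T.
    by have [K _ [_ xL]] := lip T T0; exists K.
  by exists 0 => s u /andP[s0 sT]; move: (le_trans s0 sT); rewrite leNgt T0.
move=> t t0 [dy [dx _]].
have y' : derive1 y t = beta * x t.
  apply/le_anti/andP; split.
    apply: derive1_le => // e e0; have d0 : 0 < e / beta by rewrite divr_gt0.
    have [rho rho0 Hr] := incr t _ t0 d0; exists rho => // h /Hr[k _ _ _].
    by rewrite (_ : beta * (e / beta) = e) in k; last by field; rewrite gt_eqF.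
  apply: derive1_ge => // e e0; have d0 : 0 < e / beta by rewrite divr_gt0.
  have [rho rho0 Hr] := incr t _ t0 d0; exists rho => // h /Hr[_ k _ _].
  by rewrite (_ : beta * (e / beta) = e) in k; last by field; rewrite gt_eqF.
have ge0 : 0 < gam%:R * beta + eps by rewrite ltr_wpDl.
have x'ge : lin t <= derive1 x t.
  apply: derive1_ge => // e e0; have d0 : 0 < e / (gam%:R * beta + eps) by rewrite divr_gt0.
  have [rho rho0 Hr] := incr t _ t0 d0; exists rho => // h /Hr[_ _ k _].
  by move: k; rewrite mulrC mulrCA mulfV ?mulr1 ?gt_eqF// mulrC.
split=> [xgt|xe].
  split => //; apply/le_anti/andP; split; last exact: x'ge.
  apply: derive1_le => // e e0.
  (* The first bound makes the error in the slope at most [e]; the second leaves [2 * dl] strictly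
     below the distance of [x t] from the boundary. *)
  pose dl := Num.min (e / (gam%:R * beta + eps)) ((x t + lam / beta) / 3).
  have xp : 0 < x t + lam / beta by lra.
  have d0 : 0 < dl by rewrite lt_min !divr_gt0.
  have dE : (gam%:R * beta + eps) * dl <= e.
    by rewrite mulrC -ler_pdivlMr// ge_min lexx.
  have dx3 : dl <= (x t + lam / beta) / 3 by rewrite ge_min lexx orbT.
  have [rho rho0 Hr] := incr t _ t0 d0; exists rho => // h /[dup] /andP[h0 _] /Hr[_ _ _ k].
  apply: (le_trans (k _)); first by move: (lam / beta) xp dx3 => lb; lra.
  by rewrite ler_pM2r// lerD2l.
have x'0 : derive1 x t = 0.
  by apply: derive1_min => // s s0; rewrite xe; exact: xge.
have bl : beta * (lam / beta) = lam by field; rewrite gt_eqF.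
split; first by rewrite y' xe mulrN bl.
rewrite x'0; apply/esym/max_idPr.
have := x'ge; rewrite x'0 /lin xe mulrN opprK -mulrA bl.
by [].
Qed.

End fluid_limit.

(** * Piecewise linear interpolation *)

Section piecewise_linear.
Context {R : realType}.
Local Notation mu := (@lebesgue_measure R).
Variables (S : nat -> R) (N : nat).
Hypothesis S0 : forall k, 0 <= S k.

Definition tau (n : nat) : R := \sum_(k < n) S k.

Lemma tauS n : tau n.+1 = tau n + S n.
Proof. by rewrite /tau big_ord_recr. Qed.

Lemma tau0 : tau 0 = 0.
Proof. by rewrite /tau big_ord0. Qed.

Lemma tau_le m n : (m <= n)%N -> tau m <= tau n.
Proof.
move=> /subnK <-; elim: (n - m)%N => // k IH.
by rewrite addSn tauS (le_trans IH)// lerDl.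
Qed.

Lemma tau_locate t : 0 <= t < tau N -> exists2 n, (n < N)%N & tau n <= t < tau n.+1.
Proof.
move=> /andP[t0]; elim: N => [|n IH] tN; first by move: tN; rewrite tau0 ltNge t0.
have [tn|nt] := ltP t (tau n); last by exists n; rewrite ?ltnSn ?nt.
by have [m mn h] := IH tn; exists m => //; exact: ltnW.
Qed.

Lemma tau_inj m n t : tau m <= t < tau m.+1 -> tau n <= t < tau n.+1 -> m = n.
Proof.
move=> /andP[m1 m2] /andP[n1 n2]; apply/eqP; rewrite eqn_leq; apply/andP; split.
  rewrite leqNgt; apply/negP => nm.
  by have := lt_le_trans n2 (le_trans (tau_le nm) m1); rewrite ltxx.
rewrite leqNgt; apply/negP => nm.
by have := lt_le_trans m2 (le_trans (tau_le nm) n1); rewrite ltxx.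
Qed.

Lemma ae_neq_tau : {ae mu, forall t, forall n, t != tau n}.
Proof.
apply: ae_foralln => n; exists [set tau n]; split => //.
  exact: lebesgue_measure_set1.
by move=> t /= /negP; rewrite negbK => /eqP.
Qed.

Let clip (u s : R) : R := Num.max 0 (Num.min u s).

Let clip_lip u v s : 0 <= s -> `|clip u s - clip v s| <= `|u - v|.
Proof.
move=> s0; wlog uv : u v / u <= v.
  by move=> H; have [/H//|/ltW/H] := leP u v; rewrite distrC [X in _ <= X]distrC.
rewrite distrC (distrC u) (ger0_norm (x := v - u)) ?subr_ge0// ler_norml.
rewrite /clip /Num.max /Num.min; case: (ltP v s) => ?; case: (ltP u s) => ?;
  case: ltP => ?; case: ltP => ?; lra.
Qed.

(** [clip (t - tau k) (S k)] is the time spent before [t] in the [k]-th interval. As a sum of such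
    terms the curve is visibly Lipschitz, with no need to locate [t]. *)
Definition pwlin (c : nat -> R) (f0 t : R) : R :=
  f0 + \sum_(k < N) c k * clip (t - tau k) (S k).

Lemma pwlin0 (c : nat -> R) (f0 : R) : pwlin c f0 0 = f0.
Proof.
rewrite /pwlin big1 ?addr0// => k _; rewrite /clip.
have := @tau_le 0 k (leq0n _); rewrite tau0 => h.
rewrite (_ : Num.max _ _ = 0) ?mulr0//; apply/max_idPl.
by rewrite ge_min sub0r oppr_le0 h.
Qed.

Lemma pwlin_lip (c : nat -> R) (f0 T : R) : lip_on 0 T (\sum_(k < N) `|c k|) (pwlin c f0).
Proof.
move=> s t _ _; rewrite /pwlin.
rewrite opprD addrACA subrr add0r -sumrB mulr_suml.
apply: (le_trans (ler_norm_sum _ _ _)); apply: ler_sum => k _.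
rewrite -mulrBr normrM ler_wpM2l// (le_trans (clip_lip _ _ _))//.
by rewrite opprB addrA subrK.
Qed.

Lemma pwlinE (c : nat -> R) (f0 : R) n t : (n < N)%N -> tau n <= t <= tau n.+1 ->
  pwlin c f0 t = f0 + \sum_(k < n) c k * S k + c n * (t - tau n).
Proof.
move=> nN /andP[nt tn]; rewrite /pwlin -addrA; congr (_ + _).
rewrite -(big_mkord xpredT (fun k => c k * clip (t - tau k) (S k))).
rewrite (big_cat_nat (n := n.+1))//= big_nat_recr//=.
rewrite [X in _ + X]big_nat_cond [X in _ + X]big1 ?addr0; last first.
  move=> k; rewrite andbT => /andP[nk kN].
  have := tau_le nk => h; rewrite /clip (_ : Num.max _ _ = 0) ?mulr0//; apply/max_idPl.
  by rewrite ge_min; apply/orP; left; rewrite subr_le0 (le_trans tn).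
rewrite -(big_mkord xpredT (fun k => c k * S k)); congr (_ + _).
  rewrite big_nat_cond [RHS]big_nat_cond; apply: eq_bigr => k; rewrite andbT => /andP[_ kn].
  congr (_ * _); rewrite /clip.
  have : tau k.+1 <= t by rewrite (le_trans (tau_le kn)).
  rewrite tauS => h; have := S0 k => sk.
  rewrite (_ : Num.min _ _ = S k); first exact/max_idPr.
  by apply/min_idPr; rewrite lerBrDl.
congr (_ * _); rewrite /clip (_ : Num.min _ _ = t - tau n).
  by apply/max_idPr; rewrite subr_ge0.
by apply/min_idPl; rewrite lerBlDl -tauS.
Qed.

Lemma pwlin_derive (c : nat -> R) (f0 : R) n (t : R) : (n < N)%N -> tau n < t < tau n.+1 ->
  is_derive t 1 (pwlin c f0) (c n).
Proof.
move=> nN /andP[nt tn].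
pose g (u : R) := c n * u + (f0 + \sum_(k < n) c k * S k - c n * tau n).
have dg : is_derive t 1 g (c n).
  have e := is_deriveD (is_deriveZ (c n) (is_derive_id t 1))
    (is_derive_cst (f0 + \sum_(k < n) c k * S k - c n * tau n) t 1).
  by apply: is_derive_eq e _; rewrite /GRing.scale/= mulr1 addr0.
have ne : \forall u \near t, g u = pwlin c f0 u.
  near=> u; rewrite (@pwlinE _ _ n)//; first by rewrite /g; ring.
  apply/andP; split; apply/ltW; near: u; [exact: lt_nbhsr|exact: lt_nbhsl].
apply: DeriveDef; first by apply: near_eq_derivable ne _; exact: ex_derive.
by rewrite -(near_eq_derive _ ne); exact: derive_val.
Unshelve. all: by end_near. Qed.

(** At jump times the discrepancy is at most [A]. Inside an interval the curve moves by at most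
    [|c n * S n|], and two consecutive discrepancies together with one jump bound this by
    [2 * A + J], however long the interval. *)
Lemma pwlin_close (c v : nat -> R) (A J : R) :
  (forall n, (n <= N)%N -> `|v n - v 0%N - \sum_(k < n) c k * S k| <= A) ->
  (forall n, `|v n.+1 - v n| <= J) ->
  forall n t, (n < N)%N -> tau n <= t <= tau n.+1 ->
  `|v n - pwlin c (v 0%N) t| <= 3 * A + J.
Proof.
move=> HA HJ n t nN /[dup] tn /andP[t1 t2]; rewrite (pwlinE _ _ nN tn).
have h1 := HA n (ltnW nN); have h2 := HA n.+1 nN; have h3 := HJ n.
rewrite big_ord_recr/= in h2.
have h4 : `|c n * (t - tau n)| <= `|c n * S n|.
  rewrite !normrM ler_wpM2l// !ger0_norm ?subr_ge0//.
  by rewrite lerBlDl -tauS.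
have h5 : `|c n * S n| <= 2 * A + J.
  set s := \sum_(k < n) _ in h1 h2.
  move: (c n * S n) h2 => X h2.
  by move: h1 h2 h3; rewrite !ler_norml; lra.
have {h4 h5} := le_trans h4 h5.
set s := \sum_(k < n) _ in h1 h2 *.
move: (c n * (t - tau n)) => X.
by move: h1; rewrite !ler_norml; lra.
Qed.

End piecewise_linear.

(** * Paths of the model *)

Section model_paths.
Context {R : realType}.
Local Notation mu := (@lebesgue_measure R).
Variables (lam beta eps : R) (gam : nat).
Hypotheses (lam0 : 0 < lam) (beta0 : 0 < beta) (eps0 : 0 < eps).

Definition rate1 (r : R) (z : state) : R := lam * r.
Definition rate2 (z : state) : R := beta * (z.2)%:R.
Definition rate3 (z : state) : R := eps * `|(z.1)%:~R : R| * (tgt3 z != z)%:R.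

Definition incY (z z' : state) : R := (z'.1)%:~R - (z.1)%:~R.
Definition incX (z z' : state) : R := (z'.2)%:R - (z.2)%:R.

Definition mean_inc (r : R) (D : state -> state -> R) (z : state) : R :=
  rate1 r z * D z (tgt1 gam z) + rate2 z * D z (tgt2 gam z) + rate3 z * D z (tgt3 z).

(* The part of the linear drift of [X] suppressed by the truncations at [X < gam]: in the limit it
   becomes the reflection at the boundary. *)
Definition push (z : state) : R :=
  (gam%:R - (minn gam z.2)%:R) * (beta * (z.2)%:R) +
  (if z.2 == 0%N then eps * Num.max (z.1)%:~R 0 else 0).

Lemma mean_incY r z : mean_inc r incY z = beta * (z.2)%:R - lam * r.
Proof.
case: z => Y X; rewrite /mean_inc /rate1 /rate2 /incY /tgt1 /tgt2 /=.
have -> : ((tgt3 (Y, X)).1)%:~R - Y%:~R = 0 :> R.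
  by rewrite /tgt3; case: ifP => _; case: ifP => _ /=; try case: ifP => _ /=; rewrite subrr.
by rewrite !intrD intrN mulr1z; ring.
Qed.

Lemma mean_incX r z : mean_inc r incX z =
  gam%:R * (lam * r) - gam%:R * (beta * (z.2)%:R) - eps * (z.1)%:~R + push z.
Proof.
case: z => Y X; rewrite /mean_inc /rate1 /rate2 /rate3 /incX /tgt1 /tgt2 /push /=.
rewrite natrD natrB ?geq_minr//.
(* The third transition contributes [- eps * Y] except when [X = 0 < Y]: nothing can be removed
   there, and the second half of [push] cancels the term. *)
have -> : eps * `|Y%:~R : R| * (tgt3 (Y, X) != (Y, X))%:R * (((tgt3 (Y, X)).2)%:R - X%:R) =
    - (eps * Y%:~R) + (if X == 0%N then eps * Num.max Y%:~R 0 else 0).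
  rewrite /tgt3; case: X => [|X] /=.
    case: (ltP Y 0) => Y0 /=.
      have -> : (Y, 1%N) != (Y, 0%N) by apply/eqP => -[].
      rewrite ltr0_norm ?ltrz0// (_ : Num.max _ _ = 0) /=; first by ring.
      by apply/max_idPr; rewrite lerz0 ltW.
    rewrite eqxx (_ : Num.max _ _ = Y%:~R) /=; first by ring.
    by apply/max_idPl; rewrite ler0z.
  case: (ltgtP 0 Y) => Y0 /=.
  - have -> : (Y, X) != (Y, X.+1) by apply/eqP => -[]; lia.
    by rewrite gtr0_norm ?ltr0z// -(natr1 X) /=; ring.
  - have -> : (Y, X.+2) != (Y, X.+1) by apply/eqP => -[]; lia.
    by rewrite ltr0_norm ?ltrz0// -(natr1 X.+1) /=; ring.
  - by rewrite -Y0 eqxx normr0 /=; ring.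
move: (if _ then _ else _) => P; set m := (minn gam X)%:R; set g := gam%:R.
ring.
Qed.

Lemma push_ge0 z : 0 <= push z.
Proof.
rewrite /push addr_ge0//.
  by rewrite mulr_ge0 ?mulr_ge0 ?(ltW beta0)// subr_ge0 ler_nat geq_minl.
by case: ifP => // _; rewrite mulr_ge0 ?(ltW eps0)// le_max lexx orbT.
Qed.

Lemma push_gt0 z : 0 < push z -> (z.2 <= gam)%N.
Proof.
rewrite /push; case: (leqP z.2 gam) => // h.
rewrite subrr mul0r add0r; case: eqP => [e|_]; last by rewrite ltxx.
by rewrite e in h.
Qed.

Lemma push_le z : push z <= gam%:R ^+ 2 * beta + eps * `|(z.1)%:~R : R|.
Proof.
rewrite /push lerD//.
  have [h|h] := leqP z.2 gam; last first.
    by rewrite subrr mul0r mulr_ge0 ?sqr_ge0// ltW.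
  rewrite expr2 -mulrA ler_pM ?subr_ge0 ?ler_nat//.
  - by rewrite mulr_ge0// ltW.
  - by rewrite lerBlDr lerDl.
  - by rewrite [leRHS]mulrC ler_wpM2l ?ler_nat// ltW.
case: ifP => _; last by rewrite mulr_ge0// ltW.
by rewrite ler_wpM2l ?(ltW eps0)// ge_max ler_norm normr_ge0.
Qed.

Definition ysc (r : R) (z : state) : R := (z.1)%:~R / r.
Definition xsc (r : R) (z : state) : R := ((z.2)%:R - lam * r / beta) / r.

Lemma xscE r z : 0 < r -> xsc r z = (z.2)%:R / r - lam / beta.
Proof. by move=> r0; rewrite /xsc; field; rewrite !gt_eqF. Qed.

Lemma xsc_ge r z : 0 < r -> - (lam / beta) <= xsc r z.
Proof. by move=> r0; rewrite xscE// lerDr divr_ge0// ltW. Qed.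

Lemma mean_incY_sc r z : 0 < r -> mean_inc r incY z / r = beta * xsc r z.
Proof. by move=> r0; rewrite mean_incY xscE//; field; rewrite !gt_eqF. Qed.

Lemma mean_incX_sc r z : 0 < r -> mean_inc r incX z / r =
  - (gam%:R * beta * xsc r z) - eps * ysc r z + push z / r.
Proof. by move=> r0; rewrite mean_incX xscE// /ysc; field; rewrite !gt_eqF. Qed.

Definition kap : R := beta + gam%:R * beta + 2 * eps + gam%:R ^+ 2 * beta.

Lemma kap_ge0 : 0 <= kap.
Proof.
rewrite /kap; have := ltW beta0; have := ltW eps0 => e0 b0.
by rewrite !addr_ge0// mulr_ge0// sqr_ge0.
Qed.

(** All coefficients are bounded by [kap], in which [eps] counts twice, for the drift and for the
    push. The rest is the inequality between products and squares, with 3 coming from the linear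
    terms. It prevents the path from escaping although the rates are unbounded. *)
Lemma growth_rate (wy wx zy zx p : R) : `|zy - wy| <= 1 -> `|zx - wx| <= 1 ->
  0 <= p <= gam%:R ^+ 2 * beta + eps * `|zy| ->
  2 * wy * (beta * zx) + 2 * wx * (- (gam%:R * beta * zx) - eps * zy + p) <=
  7 * kap * (wy ^+ 2 + wx ^+ 2) + 3 * kap.
Proof.
move=> hy hx /andP[p0 pB].
have b0 := ltW beta0; have e0 := ltW eps0.
have g0 : 0 <= gam%:R * beta by rewrite mulr_ge0.
have g20 : 0 <= gam%:R ^+ 2 * beta by rewrite mulr_ge0// sqr_ge0.
have azx : `|zx| <= `|wx| + 1.
  rewrite -[zx](subrK wx) addrC (le_trans (ler_normD _ _))// lerD2l//.
have azy : `|zy| <= `|wy| + 1.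
  rewrite -[zy](subrK wy) addrC (le_trans (ler_normD _ _))// lerD2l//.
have k1 : beta <= kap by rewrite /kap; lra.
have t1 : 2 * wy * (beta * zx) <= 2 * (`|wy| * (kap * (`|wx| + 1))).
  rewrite -mulrA ler_pM2l// (le_trans (ler_norm _))// normrM ler_wpM2l// normrM ger0_norm//.
  by rewrite ler_pM.
have t2 : 2 * wx * (- (gam%:R * beta * zx) - eps * zy + p) <=
    2 * (`|wx| * (kap * (`|wx| + `|wy| + 2))).
  rewrite -mulrA ler_pM2l// (le_trans (ler_norm _))// normrM ler_wpM2l//.
  have u1 : `|gam%:R * beta * zx| <= gam%:R * beta * (`|wx| + 1).
    by rewrite normrM ger0_norm// ler_wpM2l.
  have u2 : `|eps * zy| <= eps * (`|wy| + 1) by rewrite normrM ger0_norm// ler_wpM2l.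
  have u3 : p <= gam%:R ^+ 2 * beta + eps * (`|wy| + 1).
    by rewrite (le_trans pB)// lerD2l ler_wpM2l.
  rewrite (le_trans (ler_normD _ _))// (ger0_norm p0).
  apply: (@le_trans _ _ (gam%:R * beta * (`|wx| + 1) + eps * (`|wy| + 1) + p)).
    by rewrite lerD2r (le_trans (ler_normB _ _))// normrN lerD.
  have := normr_ge0 wx; have := normr_ge0 wy => w1 w2.
  have v1 : gam%:R * beta * (`|wx| + 1) <= gam%:R * beta * (`|wx| + `|wy| + 2).
    by rewrite ler_wpM2l//; lra.
  have v2 : eps * (`|wy| + 1) <= eps * (`|wx| + `|wy| + 2).
    by rewrite ler_wpM2l//; lra.
  have v3 : gam%:R ^+ 2 * beta <= gam%:R ^+ 2 * beta * (`|wx| + `|wy| + 2).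
    by rewrite ler_peMr//; lra.
  have v4 : 0 <= beta * (`|wx| + `|wy| + 2) by rewrite mulr_ge0//; lra.
  rewrite /kap !(mulrDl _ _ (`|wx| + `|wy| + 2)).
  move: (beta * (`|wx| + `|wy| + 2)) (gam%:R * beta * (`|wx| + `|wy| + 2)) v1 v4 => A1 A2 v1 v4.
  rewrite -(mulrA 2 eps).
  move: (eps * (`|wx| + `|wy| + 2)) v2 => A3 v2.
  move: (gam%:R ^+ 2 * beta * (`|wx| + `|wy| + 2)) v3 => A4 v3.
  move: (gam%:R * beta * (`|wx| + 1)) v1 => A5 v1.
  move: (eps * (`|wy| + 1)) v2 u3 => A6 v2 u3.
  move: (gam%:R ^+ 2 * beta) u3 v3 => A7 u3 v3.
  lra.
have t3 : 2 * (`|wy| * (kap * (`|wx| + 1))) + 2 * (`|wx| * (kap * (`|wx| + `|wy| + 2))) =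
   kap * (2 * (`|wy| * (`|wx| + 1) + `|wx| * (`|wx| + `|wy| + 2))) by ring.
apply: (@le_trans _ _ (kap * (2 * (`|wy| * (`|wx| + 1) + `|wx| * (`|wx| + `|wy| + 2))))).
  by rewrite -t3 lerD.
have -> : 7 * kap * (wy ^+ 2 + wx ^+ 2) + 3 * kap = kap * (7 * (wy ^+ 2 + wx ^+ 2) + 3) by ring.
rewrite ler_wpM2l ?kap_ge0//.
rewrite -(real_normK (num_real wy)) -(real_normK (num_real wx)).
move: `|wy| `|wx| => A C.
have := sqr_ge0 (A - C); have := sqr_ge0 (A - 1); have := sqr_ge0 (C - 1).
have -> : (A - C) ^+ 2 = A ^+ 2 + C ^+ 2 - 2 * (A * C) by ring.
have -> : (A - 1) ^+ 2 = A ^+ 2 + 1 - 2 * A by ring.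
have -> : (C - 1) ^+ 2 = C ^+ 2 + 1 - 2 * C by ring.
have -> : 2 * (A * (C + 1) + C * (C + A + 2)) = 4 * (A * C) + 2 * A + 2 * C ^+ 2 + 4 * C by ring.
have := sqr_ge0 A; have := sqr_ge0 C.
move: (A ^+ 2) (C ^+ 2) (A * C) => AA CC AC; lra.
Qed.

(** Gronwall's bound on the squared norm of the curve, plus 3 to pass from squares to absolute
    values and from the curve to the path. [path_bound'] also covers the push, and [jump_bound] the
    total transition rate divided by [r]. *)
Definition path_bound (T D0 : R) : R := 3 + (D0 + 3 * kap * T) * expR (7 * kap * T).
Definition path_bound' (T D0 : R) : R :=
  path_bound T D0 + gam%:R ^+ 2 * beta + eps * path_bound T D0.
Definition jump_bound (T D0 : R) : R :=
  lam + beta * (path_bound T D0 + lam / beta) + eps * path_bound T D0.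

Definition liny (r : R) (Z : nat -> state) (S : nat -> R) (N : nat) : R -> R :=
  pwlin S N (fun k => mean_inc r incY (Z k) / r) (ysc r (Z 0%N)).
Definition linx (r : R) (Z : nat -> state) (S : nat -> R) (N : nat) : R -> R :=
  pwlin S N (fun k => mean_inc r incX (Z k) / r) (xsc r (Z 0%N)).

(** * Deterministic estimates for one good path *)

Section one_path.
Variables (r a T D0 : R) (N : nat) (Z : nat -> state) (S : nat -> R) (V : R -> state).
Hypotheses (r1 : 1 <= r) (T0 : 0 <= T) (a0 : 0 <= a).
Hypothesis S0 : forall k, 0 <= S k.
Hypothesis stepY : forall n, `|incY (Z n) (Z n.+1)| <= gam%:R + 1.
Hypothesis stepX : forall n, `|incX (Z n) (Z n.+1)| <= gam%:R + 1.
Hypothesis MY : forall n, (n <= N)%N ->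
  `|\sum_(k < n) (incY (Z k) (Z k.+1) - S k * mean_inc r incY (Z k))| <= a.
Hypothesis MX : forall n, (n <= N)%N ->
  `|\sum_(k < n) (incX (Z k) (Z k.+1) - S k * mean_inc r incX (Z k))| <= a.
Hypothesis M1 : forall n, (n <= N)%N ->
  `|\sum_(k < n) (1 - S k * mean_inc r (fun _ _ => 1) (Z k))| <= a.
Hypothesis VE : forall n t, tau S n <= t < tau S n.+1 -> V t = Z n.

(** The bound [3 * A + J] of [pwlin_close] for the scaled path, with [A = a / r] and
    [J = (gam%:R + 1) / r]. *)
Definition noise : R := (3 * a + (gam%:R + 1)) / r.
Hypothesis noise1 : noise <= 1.
Hypothesis init_le : ysc r (Z 0%N) ^+ 2 + xsc r (Z 0%N) ^+ 2 <= D0.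
Hypothesis N_large : a + jump_bound T D0 * r * T < N%:R.

Let r0 : 0 < r. Proof. exact: lt_le_trans r1. Qed.

Let wy := pwlin S N (fun k => mean_inc r incY (Z k) / r) (ysc r (Z 0%N)).
Let wx := pwlin S N (fun k => mean_inc r incX (Z k) / r) (xsc r (Z 0%N)).

Let telescope (f : nat -> R) n : \sum_(k < n) (f k.+1 - f k) = f n - f 0%N.
Proof. by rewrite -(big_mkord xpredT (fun k => f k.+1 - f k)) telescope_sumr. Qed.

Let close_y n t : (n < N)%N -> tau S n <= t <= tau S n.+1 -> `|ysc r (Z n) - wy t| <= noise.
Proof.
have -> : noise = 3 * (a / r) + (gam%:R + 1) / r by rewrite /noise; field; rewrite gt_eqF.
apply: (pwlin_close S0 (v := fun n => ysc r (Z n))) => m.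
  move=> mN; have := MY mN; rewrite sumrB (telescope (fun k => ((Z k).1)%:~R)) => h.
  rewrite ler_pdivlMr// -[X in _ * X](gtr0_norm r0) -normrM; apply: le_trans h.
  rewrite mulrBl /ysc mulr_suml; rewrite le_eqVlt; apply/orP; left; apply/eqP; congr (`|_|).
  congr (_ - _); first by field; rewrite gt_eqF.
  by apply: eq_bigr => k _; field; rewrite gt_eqF.
have := stepY m; rewrite /ysc -mulrBl normrM [X in _ * X]gtr0_norm ?invr_gt0// => h.
by rewrite ler_pM2r ?invr_gt0.
Qed.

Let close_x n t : (n < N)%N -> tau S n <= t <= tau S n.+1 -> `|xsc r (Z n) - wx t| <= noise.
Proof.
have -> : noise = 3 * (a / r) + (gam%:R + 1) / r by rewrite /noise; field; rewrite gt_eqF.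
apply: (pwlin_close S0 (v := fun n => xsc r (Z n))) => m.
  move=> mN; have := MX mN; rewrite sumrB (telescope (fun k => ((Z k).2)%:R)) => h.
  rewrite ler_pdivlMr// -[X in _ * X](gtr0_norm r0) -normrM; apply: le_trans h.
  rewrite mulrBl !xscE// mulr_suml; rewrite le_eqVlt; apply/orP; left; apply/eqP; congr (`|_|).
  congr (_ - _); first by field; rewrite !gt_eqF.
  by apply: eq_bigr => k _; field; rewrite gt_eqF.
have := stepX m; rewrite !xscE// => h.
have -> : ((Z m.+1).2)%:R / r - lam / beta - (((Z m).2)%:R / r - lam / beta) =
  incX (Z m) (Z m.+1) / r by rewrite /incX; field; rewrite !gt_eqF.
by rewrite normrM [X in _ * X]gtr0_norm ?invr_gt0// ler_pM2r ?invr_gt0.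
Qed.

Let push_sc n : 0 <= push (Z n) / r <= gam%:R ^+ 2 * beta + eps * `|ysc r (Z n)|.
Proof.
rewrite divr_ge0 ?push_ge0 ?(ltW r0)//= ler_pdivrMr//.
apply: (le_trans (push_le _)); rewrite mulrDl lerD//.
  by rewrite ler_peMr// mulr_ge0 ?sqr_ge0 ?(ltW beta0).
by rewrite /ysc normrM (@gtr0_norm _ r^-1) ?invr_gt0// -mulrA divfK ?gt_eqF.
Qed.

Let derivs n (t : R) : (n < N)%N -> tau S n < t < tau S n.+1 ->
  is_derive t 1 wy (beta * xsc r (Z n)) /\
  is_derive t 1 wx (- (gam%:R * beta * xsc r (Z n)) - eps * ysc r (Z n) + push (Z n) / r).
Proof.
move=> nN tn; split.
  exact: is_derive_eq (pwlin_derive S0 _ _ nN tn) (mean_incY_sc _ r0).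
exact: is_derive_eq (pwlin_derive S0 _ _ nN tn) (mean_incX_sc _ r0).
Qed.

Let ae_locate b : b <= tau S N -> {ae mu, forall t, 0 < t < b ->
  exists2 n, (n < N)%N & tau S n < t < tau S n.+1}.
Proof.
move=> bN; have := ae_neq_tau S.
apply: filterS; first exact: (ae_filter_ringOfSetsType mu).
move=> t Ht /andP[t0 tb].
have [|n nN /andP[h1 h2]] := @tau_locate _ S N t; first by rewrite ltW//= (lt_le_trans tb).
by exists n => //; rewrite h2 lt_neqAle eq_sym Ht h1.
Qed.

(** Stated up to the earlier of [T] and the [N]-th jump, since nothing yet shows that [N] jumps
    reach [T]. *)
Let apriori b : 0 <= b <= T -> b <= tau S N -> wy b ^+ 2 + wx b ^+ 2 <= path_bound T D0 - 3.
Proof.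
move=> /andP[b0 bT] bN.
have lsq c f0 : exists K, lip_on 0 b K (fun t => pwlin S N c f0 t ^+ 2).
  have h := @pwlin_lip _ S N S0 c f0 b.
  have [K hK] := lip_onM b0 h h; exists K => s t sb tb.
  by have := hK s t sb tb; rewrite !expr2.
have [K1 k1] := lsq (fun k => mean_inc r incY (Z k) / r) (ysc r (Z 0%N)).
have [K2 k2] := lsq (fun k => mean_inc r incX (Z k) / r) (xsc r (Z 0%N)).
have DL := lip_onD k1 k2; rewrite -/wy -/wx in DL.
have kp := kap_ge0.
have k70 : 0 <= 7 * kap by rewrite mulr_ge0.
have k30 : 0 <= 3 * kap by rewrite mulr_ge0.
apply: (@le_trans _ _ ((wy 0 ^+ 2 + wx 0 ^+ 2 + 3 * kap * b) * expR (7 * kap * b))).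
  apply: (gronwall_ae k70 k30 b0 DL).
  have := ae_locate bN; apply: filterS; first exact: (ae_filter_ringOfSetsType mu).
  move=> t Ht /Ht[n nN tn] _; have [dy dx] := derivs nN tn.
  have tn' : tau S n <= t <= tau S n.+1 by case/andP: tn => /ltW -> /ltW ->.
  have dD : is_derive t 1 (fun t => wy t ^+ 2 + wx t ^+ 2) (2 * wy t * (beta * xsc r (Z n)) +
     2 * wx t * (- (gam%:R * beta * xsc r (Z n)) - eps * ysc r (Z n) + push (Z n) / r)).
    have e := is_deriveD (is_deriveM dy dy) (is_deriveM dx dx).
    by apply: is_derive_eq e _; rewrite /GRing.scale/=; ring.
  rewrite derive1E (@derive_val _ _ _ _ _ _ _ dD).
  apply: growth_rate.
  - exact: le_trans (close_y nN tn') noise1.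
  - exact: le_trans (close_x nN tn') noise1.
  - exact: push_sc.
rewrite (_ : path_bound T D0 - 3 = (D0 + 3 * kap * T) * expR (7 * kap * T)); last by rewrite /path_bound addrC addKr.
rewrite /wy /wx !pwlin0//.
have d0 : 0 <= D0 by apply: le_trans init_le; rewrite addr_ge0 ?sqr_ge0.
rewrite ler_pM ?expR_ge0//.
- by rewrite addr_ge0 ?addr_ge0 ?sqr_ge0// mulr_ge0.
- by rewrite lerD// ler_wpM2l.
- by rewrite ler_expR ler_wpM2l.
Qed.

Let pb3 : 3 <= path_bound T D0.
Proof.
have d0 : 0 <= D0 by apply: le_trans init_le; rewrite addr_ge0 ?sqr_ge0.
by rewrite lerDl mulr_ge0 ?expR_ge0// addr_ge0// !mulr_ge0// kap_ge0.
Qed.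

Let z_bound n t : (n < N)%N -> tau S n <= t <= tau S n.+1 -> 0 <= t <= T -> t <= tau S N ->
  `|ysc r (Z n)| <= path_bound T D0 /\ `|xsc r (Z n)| <= path_bound T D0.
Proof.
move=> nN tn tT tN; have := apriori tT tN.
have cy := le_trans (close_y nN tn) noise1; have cx := le_trans (close_x nN tn) noise1.
move: (wy t) (wx t) cy cx => A C cy cx h.
have sq (x : R) : `|x| <= 1 + x ^+ 2.
  have := sqr_ge0 (`|x| - 1).
  have -> : (`|x| - 1) ^+ 2 = `|x| ^+ 2 + 1 - 2 * `|x| by ring.
  rewrite (real_normK (num_real x)); have := normr_ge0 x; lra.
have := sq A; have := sq C; have := sqr_ge0 A; have := sqr_ge0 C => h1 h2 h3 h4.
have ny := ler_normD (ysc r (Z n) - A) A; have nx := ler_normD (xsc r (Z n) - C) C.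
rewrite !subrK in ny nx.
have hA : `|A| + 1 <= path_bound T D0 by lra.
have hC : `|C| + 1 <= path_bound T D0 by lra.
by split; [apply: (le_trans ny); apply: le_trans hA|apply: (le_trans nx); apply: le_trans hC];
  rewrite addrC lerD2l.
Qed.

(** If the [N] jumps ended by time [T], the a priori bound would hold throughout and the integrated
    total rate would be at most [jump_bound T D0 * r * T]. By [M1] it is at least [N - a], which
    contradicts [N_large]. *)
Let T_tau : T < tau S N.
Proof.
rewrite ltNge; apply/negP => tT.
have := M1 (leqnn N); rewrite sumrB big_const_ord iter_addr_0.
rewrite ler_norml => /andP[_ h].
suff : \sum_(k < N) S k * mean_inc r (fun _ _ => 1) (Z k) <= jump_bound T D0 * r * T.
  move=> hs; move: N_large; rewrite ltNge => /negP; apply.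
  by rewrite -lerBlDl; apply: le_trans hs; rewrite lerBlDr -lerBlDl.
have jb : 0 <= jump_bound T D0 * r.
  have := pb3; have := ltW lam0; have := ltW beta0; have := ltW eps0 => e0 b0 l0 p3.
  have p0 : 0 <= path_bound T D0 by lra.
  by rewrite mulr_ge0 ?(ltW r0)// /jump_bound !addr_ge0// mulr_ge0// addr_ge0// divr_ge0.
apply: (@le_trans _ _ (\sum_(k < N) S k * (jump_bound T D0 * r))); last first.
  by rewrite -mulr_suml mulrC ler_wpM2l.
apply: ler_sum => k _; rewrite ler_wpM2l//.
have kN := ltn_ord k.
have tk : tau S k <= tau S k <= tau S k.+1 by rewrite lexx tau_le.
have tkN : tau S k <= tau S N by rewrite tau_le// ltnW.
have tk0 : 0 <= tau S k <= T.
  by rewrite (le_trans tkN)// andbT -(tau0 S) tau_le.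
have [by_ bx_] := z_bound kN tk tk0 tkN.
rewrite /mean_inc !mulr1 /rate1 /rate2 /rate3 /jump_bound !mulrDl.
apply: lerD; [apply: lerD => //|].
  rewrite -mulrA ler_wpM2l ?(ltW beta0)//.
  by have := le_trans (ler_norm _) bx_; rewrite xscE// lerBlDr ler_pdivrMr.
apply: (@le_trans _ _ (eps * `|((Z k).1)%:~R : R|)).
  by rewrite ler_piMr ?mulr_ge0 ?(ltW eps0)//; case: (_ != _).
rewrite -mulrA ler_wpM2l ?(ltW eps0)//.
move: by_; rewrite /ysc normrM [X in _ * X]gtr0_norm ?invr_gt0// ler_pdivrMr//.
Qed.

Lemma good_path_approx : approx_sol lam beta eps gam T noise (path_bound' T D0)
  (fun t => ysc r (V t)) (fun t => xsc r (V t)) (liny r Z S N) (linx r Z S N).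
Proof.
rewrite -[liny _ _ _ _]/wy -[linx _ _ _ _]/wx.
have p0 : 0 <= path_bound T D0 by apply: le_trans pb3.
have g20 : 0 <= gam%:R ^+ 2 * beta by rewrite mulr_ge0 ?sqr_ge0 ?(ltW beta0).
have ep0 : 0 <= eps * path_bound T D0 by rewrite mulr_ge0 ?(ltW eps0).
have pb_le : path_bound T D0 <= path_bound' T D0.
  by rewrite /path_bound' -addrA lerDl addr_ge0.
have loc t : 0 <= t <= T -> exists2 n, (n < N)%N & tau S n <= t < tau S n.+1.
  by move=> /andP[t0 tT]; apply: tau_locate; rewrite t0 (le_lt_trans tT).
split; [by eexists; exact: pwlin_lip|by eexists; exact: pwlin_lip| |].
  move=> t tT; have [n nN tn] := loc t tT; rewrite (VE tn).
  have tn' : tau S n <= t <= tau S n.+1 by case/andP: tn => -> /ltW ->.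
  have tN : t <= tau S N by apply: (le_trans _ (ltW T_tau)); case/andP: tT.
  have [b1 b2] := z_bound nN tn' tT tN.
  split; [exact: close_y|exact: close_x|exact: xsc_ge|exact: le_trans pb_le|exact: le_trans pb_le].
have := ae_locate (ltW T_tau); apply: filterS; first exact: (ae_filter_ringOfSetsType mu).
move=> t Ht /[dup] tT /Ht[n nN tn]; have [dy dx] := derivs nN tn.
have tn' : tau S n <= t < tau S n.+1 by case/andP: tn => /ltW -> ->.
have tn2 : tau S n <= t <= tau S n.+1 by case/andP: tn => /ltW -> /ltW ->.
have tT' : 0 <= t <= T by case/andP: tT => /ltW -> /ltW ->.
have tN : t <= tau S N by apply: (le_trans _ (ltW T_tau)); case/andP: tT'.
have [b1 _] := z_bound nN tn2 tT' tN.
rewrite (VE tn'); have /andP[ps0 ps1] := push_sc n.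
exists (push (Z n) / r); split => //.
- rewrite ps0 (le_trans ps1)// /path_bound' -addrA.
  apply: (@le_trans _ _ (gam%:R ^+ 2 * beta + eps * path_bound T D0)).
    by rewrite lerD2l ler_wpM2l ?(ltW eps0).
  by rewrite lerDr.
(* A positive push means [X <= gam], hence a scaled distance of at most [gam%:R / r <= noise] from
   the boundary. *)
- rewrite pmulr_lgt0 ?invr_gt0// => /push_gt0 Xg.
  rewrite xscE// addrC lerD2l /noise ler_pM2r ?invr_gt0//.
  have Xg' : (((Z n).2)%:R : R) <= gam%:R by rewrite ler_nat.
  by rewrite (le_trans Xg')// addrCA lerDl addr_ge0// mulr_ge0.
Qed.

End one_path.
End model_paths.

(** * The coupling *)

Section fourth_roots.
Context {R : realType}.

Definition fourth_root (r : R) : R := Num.sqrt (Num.sqrt r).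

Lemma fourth_rootX4 r : 0 <= r -> fourth_root r ^+ 4 = r.
Proof. by move=> r0; rewrite (exprM _ 2 2) !sqr_sqrtr// sqrtr_ge0. Qed.

Lemma fourth_root_ge K r : 0 <= K -> K ^+ 4 <= r -> K <= fourth_root r.
Proof.
move=> K0 Kr; have -> : K = Num.sqrt (Num.sqrt (K ^+ 4)).
  by rewrite (exprM _ 2 2) sqrtr_sqr ger0_norm ?sqr_ge0// sqrtr_sqr ger0_norm.
by rewrite !ler_wsqrtr.
Qed.

End fourth_roots.

Section increments.
Context {R : realType}.
Variable gam : nat.
Local Notation incY := (@incY R).
Local Notation incX := (@incX R).

Lemma tgt3_incY z : incY z (tgt3 z) = 0.
Proof.
case: z => Y X; rewrite /incY /tgt3.
by case: ifP => _; case: ifP => _ /=; try case: ifP => _ /=; rewrite subrr.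
Qed.

Let g0 : (0 : R) <= gam%:R. Proof. by []. Qed.

Lemma incY_le z : [/\ `|incY z (tgt1 gam z)| <= gam%:R + 1,
  `|incY z (tgt2 gam z)| <= gam%:R + 1 & `|incY z (tgt3 z)| <= gam%:R + 1].
Proof.
split; last by rewrite tgt3_incY normr0 addr_ge0.
- rewrite /incY /tgt1/= intrD intrN mulr1z addrAC subrr add0r normrN normr1.
  by rewrite lerDr.
- by rewrite /incY /tgt2/= intrD mulr1z addrAC subrr add0r normr1 lerDr.
Qed.

Lemma incX_le z : [/\ `|incX z (tgt1 gam z)| <= gam%:R + 1,
  `|incX z (tgt2 gam z)| <= gam%:R + 1 & `|incX z (tgt3 z)| <= gam%:R + 1].
Proof.
case: z => Y X; split.
- by rewrite /incX /tgt1/= natrD addrAC subrr add0r ger0_norm// lerDl.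
- rewrite /incX /tgt2/= natrB ?geq_minr// addrAC subrr add0r normrN ger0_norm//.
  by rewrite natr1 ler_nat (leq_trans (geq_minl _ _)).
- have small (k : R) : `|k| <= 1 -> `|k| <= gam%:R + 1.
    by move=> h; rewrite (le_trans h)// lerDr.
  apply: small; rewrite /incX /tgt3; case: X => [|X] /=.
    by case: ifP => _ /=; rewrite subr0 ?normr1 ?normr0.
  case: ifP => _ /=.
    by rewrite -(natr1 X) opprD addrA subrr sub0r normrN normr1.
  case: ifP => _ /=; last by rewrite subrr normr0.
  by rewrite -(natr1 X.+1) addrAC subrr add0r normr1.
Qed.

Lemma sqr_le_norm (x c : R) : `|x| <= c -> x ^+ 2 <= c ^+ 2.
Proof.
move=> xc; have c0 := le_trans (normr_ge0 _) xc.
by rewrite -(real_normK (num_real x)) lerXn2r ?nnegrE.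
Qed.

End increments.

Section step_path.
Context {R : realType}.

(** Past the total duration of all intervals, if it is finite, the path takes a default state, on
    which [path_of] imposes nothing. *)
Definition step_path (Z : nat -> state) (S : nat -> R) (t : R) : state :=
  if pselect (exists n, tau S n <= t < tau S n.+1) is left e then Z (projT1 (cid e))
  else (0, 0%N).

Lemma step_pathE Z S n t : (forall k, 0 <= S k) -> tau S n <= t < tau S n.+1 ->
  step_path Z S t = Z n.
Proof.
move=> S0 tn; rewrite /step_path; case: pselect => [e|]; last by case; exists n.
by case: (cid e) => m tm /=; rewrite (tau_inj S0 tm tn).
Qed.

End step_path.

Section coupling.
Context {R : realType}.
Variables (lam beta eps : R) (gam : nat) (init : R -> state).
Hypotheses (lam0 : 0 < lam) (beta0 : 0 < beta) (eps0 : 0 < eps).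
Local Notation P := (@coinP R).
Local Notation U := (@coinU R).

Definition model_state (r : R) (n : nat) (w : coins) : state :=
  chain_state evens odds U (rate1 lam r) (rate2 beta) (rate3 eps) (tgt1 gam) (tgt2 gam) tgt3
    n (init r) w.
Definition model_hold (r : R) (n : nat) (w : coins) : R :=
  chain_hold evens odds U (rate1 lam r) (rate2 beta) (rate3 eps) (tgt1 gam) (tgt2 gam) tgt3
    n (init r) w.
Definition model_exceeds (r : R) (D : state -> state -> R) (N : nat) (a : R) : set coins :=
  exceeds evens odds U (rate1 lam r) (rate2 beta) (rate3 eps) (tgt1 gam) (tgt2 gam) tgt3
    D N (init r) 0 a.

(** With this increment the compensated sum is the number of jumps minus the integrated total rate;
    it links jumps to elapsed time. *)
Definition one_inc (_ _ : state) : R := 1.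
(** With [s] the fourth root of [r], the scaled noise is of order [s ^+ 3 / s ^+ 4], the horizon of
    order [s ^+ 5] exceeds the [O(s ^+ 4)] jumps of a bounded time interval, and the failure
    probability is of order [s ^+ 5 / s ^+ 6]. *)
Definition noise_level (r : R) : R := fourth_root r ^+ 3.
Definition jump_horizon (r : R) : nat := (Num.truncn (fourth_root r ^+ 5)).+1.

Definition good_event (r : R) : set coins :=
  ~` (model_exceeds r (@incY R) (jump_horizon r) (noise_level r) `|`
      (model_exceeds r (@incX R) (jump_horizon r) (noise_level r) `|` model_exceeds r one_inc (jump_horizon r) (noise_level r))).

Let rate1_gt0 r : 0 < r -> forall z, 0 < rate1 lam r z.
Proof. by move=> r0 z; rewrite /rate1 mulr_gt0. Qed.
Let rate2_ge0 z : 0 <= rate2 beta z.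
Proof. by rewrite /rate2 mulr_ge0// ltW. Qed.
Let rate3_ge0 z : 0 <= rate3 eps z.
Proof. by rewrite /rate3 !mulr_ge0// ltW. Qed.

Let me := measurable_evens.
Let mo := measurable_odds.
Let mu := @measurable_coinU R.
Let U01 (w : coins) : 0 <= U w <= 1.
Proof. by rewrite coinU_ge0 coinU_le1. Qed.

Lemma measurable_model_exceeds r D N a : measurable (model_exceeds r D N a).
Proof. exact: (measurable_exceeds me mo mu). Qed.

Lemma measurable_good_event r : measurable (good_event r).
Proof.
apply: measurableC; apply: measurableU; first exact: measurable_model_exceeds.
by apply: measurableU; exact: measurable_model_exceeds.
Qed.

Lemma P_model_exceeds r D N a : 0 < r -> 0 < a ->
  (forall z, [/\ `|D z (tgt1 gam z)| <= gam%:R + 1, `|D z (tgt2 gam z)| <= gam%:R + 1 &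
                 `|D z (tgt3 z)| <= gam%:R + 1]) ->
  (P (model_exceeds r D N a) <= ((gam%:R + 1) ^+ 2 * N%:R / a ^+ 2)%:E)%E.
Proof.
move=> r0 a0 HD.
have h1 z : D z (tgt1 gam z) ^+ 2 <= (gam%:R + 1) ^+ 2 by apply: sqr_le_norm; have [] := HD z.
have h2 z : D z (tgt2 gam z) ^+ 2 <= (gam%:R + 1) ^+ 2 by apply: sqr_le_norm; have [] := HD z.
have h3 z : D z (tgt3 z) ^+ 2 <= (gam%:R + 1) ^+ 2 by apply: sqr_le_norm; have [] := HD z.
have := P_exceeds me mo mu (@coinP_U R) (@coinP_split R) (rate1_gt0 r0) rate2_ge0 rate3_ge0
  h1 h2 h3 N (init r) 0 a0.
by rewrite expr2 mulr0 add0r.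
Qed.

Lemma P_good_event r : 0 < r -> 1 <= fourth_root r ->
  1 - 6 * (gam%:R + 1) ^+ 2 / fourth_root r <= fine (P (good_event r)).
Proof.
move=> r0 s1; set s := fourth_root r in s1 *; have s0 : 0 < s by exact: lt_le_trans s1.
have a0 : 0 < noise_level r by rewrite exprn_gt0.
(* The factor 2 absorbs the rounding in [jump_horizon]; over three events it becomes the constant
   6. *)
have N_le : (jump_horizon r)%:R <= 2 * s ^+ 5.
  rewrite /jump_horizon -natr1 -/s mulrDl mul1r lerD//; last by rewrite exprn_ege1.
  by rewrite truncn_le// exprn_ge0 ?(ltW s0).
set C := (gam%:R + 1) ^+ 2.
have C0 : 0 <= C by rewrite sqr_ge0.
have bnd : C * (jump_horizon r)%:R / noise_level r ^+ 2 <= 2 * C / s.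
  rewrite ler_pdivrMr ?exprn_gt0// /noise_level -/s.
  have -> : 2 * C / s * (s ^+ 3) ^+ 2 = C * (2 * s ^+ 5) by field; rewrite gt_eqF.
  by rewrite ler_wpM2l.
have one_le z : [/\ `|one_inc z (tgt1 gam z)| <= gam%:R + 1,
   `|one_inc z (tgt2 gam z)| <= gam%:R + 1 & `|one_inc z (tgt3 z)| <= gam%:R + 1].
  by rewrite /one_inc normr1 lerDr; split.
have pb D : (forall z, [/\ `|D z (tgt1 gam z)| <= gam%:R + 1,
    `|D z (tgt2 gam z)| <= gam%:R + 1 & `|D z (tgt3 z)| <= gam%:R + 1]) ->
    (P (model_exceeds r D (jump_horizon r) (noise_level r)) <= (2 * C / s)%:E)%E.
  by move=> HD; apply: (le_trans (P_model_exceeds (jump_horizon r) r0 a0 HD)); rewrite lee_fin.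
set B1 := model_exceeds r (@incY R) (jump_horizon r) (noise_level r).
set B2 := model_exceeds r (@incX R) (jump_horizon r) (noise_level r).
set B3 := model_exceeds r one_inc (jump_horizon r) (noise_level r).
have m1 : measurable B1 by exact: measurable_model_exceeds.
have m2 : measurable B2 by exact: measurable_model_exceeds.
have m3 : measurable B3 by exact: measurable_model_exceeds.
have m23 : measurable (B2 `|` B3) by exact: measurableU.
have m123 : measurable (B1 `|` (B2 `|` B3)) by exact: measurableU.
have PB : (P (B1 `|` (B2 `|` B3)) <= (6 * C / s)%:E)%E.
  apply: (le_trans (measureU2 _ m1 m23)).
  have -> : 6 * C / s = 2 * C / s + (2 * C / s + 2 * C / s) by lra.
  rewrite 2!EFinD; apply: leeD; first exact: pb (incY_le _).
  apply: (le_trans (measureU2 _ m2 m3)); apply: leeD; first exact: pb (incX_le _).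
  exact: pb one_le.
have pe : P (good_event r) = (1 - P (B1 `|` (B2 `|` B3)))%E by exact: probability_setC.
have pk : P (B1 `|` (B2 `|` B3)) = (fine (P (B1 `|` (B2 `|` B3))))%:E.
  by rewrite fineK// fin_num_measure.
rewrite pe; rewrite pk lee_fin in PB; rewrite pk -EFinB/=.
by rewrite lerB.
Qed.

Definition model_path (r : R) (w : coins) (t : R) : state :=
  step_path (fun n => model_state r n w) (fun n => model_hold r n w) t.

Lemma model_hold_ge0 r n w : 0 < r -> 0 <= model_hold r n w.
Proof.
move=> r0; apply: chain_hold_ge0; [exact: U01|exact: rate1_gt0|exact: rate2_ge0|exact: rate3_ge0].
Qed.

Lemma model_state_step r n w : exists2 i : 'I_3, true &
  model_state r n.+1 w = nth (tgt3 (model_state r n w)) [:: tgt1 gam (model_state r n w); tgt2 gam (model_state r n w)] i.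
Proof.
rewrite /model_state; have [h ->] := chain_stateS evens odds U (rate1 lam r) (rate2 beta) (rate3 eps)
  (tgt1 gam) (tgt2 gam) tgt3 n (init r) w.
rewrite /next_state /target_of; case: ifP => _; first by exists (inord 0) => //; rewrite inordK.
case: ifP => _; first by exists (inord 1) => //; rewrite inordK.
by exists (inord 2) => //; rewrite inordK.
Qed.

Lemma model_state_incY r n w : `|incY (model_state r n w) (model_state r n.+1 w) : R| <= gam%:R + 1.
Proof.
have [[i i3] _ ->] := model_state_step r n w; have [h1 h2 h3] := @incY_le R gam (model_state r n w).
by case: i i3 => [|[|[|]]].
Qed.

Lemma model_state_incX r n w : `|incX (model_state r n w) (model_state r n.+1 w) : R| <= gam%:R + 1.
Proof.
have [[i i3] _ ->] := model_state_step r n w; have [h1 h2 h3] := @incX_le R gam (model_state r n w).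
by case: i i3 => [|[|[|]]].
Qed.

Lemma compensated_sum_le r D N a w : ~ model_exceeds r D N a w -> forall n, (n <= N)%N ->
  `|\sum_(k < n) (D (model_state r k w) (model_state r k.+1 w) -
      model_hold r k w * mean_inc lam beta eps gam r D (model_state r k w))| <= a.
Proof.
move=> nb n nN; rewrite leNgt; apply/negP => h; apply: nb; exists n => //.
by rewrite add0r compensated_sumE ltW.
Qed.

Definition model_liny r w := liny lam beta eps gam r (fun n => model_state r n w) (fun n => model_hold r n w) (jump_horizon r).
Definition model_linx r w := linx lam beta eps gam r (fun n => model_state r n w) (fun n => model_hold r n w) (jump_horizon r).

(** The estimates see the seed only through its membership in the good event, so the threshold [R0]
    is the same for all good seeds. *)
Lemma good_approx (y0 x0 T : R) : 0 <= T ->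
  (fun r => ysc r (init r)) @ +oo --> y0 -> (fun r => xsc lam beta r (init r)) @ +oo --> x0 ->
  exists2 B, 0 <= B & forall eta, 0 < eta -> exists R0, forall r, R0 <= r -> 0 < r ->
  forall w, good_event r w ->
  [/\ approx_sol lam beta eps gam T eta B
        (fun t => ysc r (model_path r w t)) (fun t => xsc lam beta r (model_path r w t)) (model_liny r w) (model_linx r w),
      `|model_liny r w 0 - y0| <= eta & `|model_linx r w 0 - x0| <= eta].
Proof.
move=> T0 cy cx.
pose D0 := (`|y0| + 1) ^+ 2 + (`|x0| + 1) ^+ 2.
have D00 : 0 <= D0 by rewrite addr_ge0 ?sqr_ge0.
have kp := kap_ge0 gam beta0 eps0.
have pb0 : 0 <= path_bound beta eps gam T D0.
  by rewrite /path_bound addr_ge0// mulr_ge0 ?expR_ge0// addr_ge0// !mulr_ge0.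
have pb0' : 0 <= path_bound' beta eps gam T D0.
  rewrite /path_bound'; apply: addr_ge0; last exact: mulr_ge0 (ltW eps0) pb0.
  by apply: addr_ge0 => //; apply: mulr_ge0; [exact: sqr_ge0|exact: ltW].
have jb0 : 0 <= jump_bound lam beta eps gam T D0.
  have := ltW lam0; have := ltW beta0; have := ltW eps0 => e0 b0 l0.
  by rewrite /jump_bound !addr_ge0// mulr_ge0// addr_ge0// divr_ge0.
exists (path_bound' beta eps gam T D0) => // eta eta0.
pose e1 := Num.min 1 eta.
have e10 : 0 < e1 by rewrite lt_min ltr01.
have e11 : e1 <= 1 by rewrite ge_min lexx.
have e1e : e1 <= eta by rewrite ge_min lexx orbT.
have /cvgrPdist_le/(_ _ e10)[Ry [_ hy]] := cy.
have /cvgrPdist_le/(_ _ e10)[Rx [_ hx]] := cx.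
(* One summand for each requirement on the fourth root of [r]: to be at least 1, to bring the noise
   below [e1], and to make the horizon outlast [T]. *)
pose K := 1 + (gam%:R + 4) / e1 + (1 + jump_bound lam beta eps gam T D0 * T).
have q1 : 0 <= (gam%:R + 4) / e1 by rewrite divr_ge0 ?(ltW e10)// addr_ge0.
have q2 : 0 <= jump_bound lam beta eps gam T D0 * T by rewrite mulr_ge0.
have K0 : 0 <= K by rewrite /K; lra.
exists (Num.max (Num.max Ry Rx + 1) (K ^+ 4)) => r.
rewrite ge_max => /andP[rRxy rK] r0 w gw.
have [rRy rRx] : Ry < r /\ Rx < r.
  have : Num.max Ry Rx < r by rewrite (lt_le_trans _ rRxy)// ltrDl.
  by rewrite gt_max => /andP.
have sK : K <= fourth_root r by exact: fourth_root_ge.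
have s4 := fourth_rootX4 (ltW r0).
set s := fourth_root r in sK s4.
have s1 : 1 <= s by move: sK; rewrite /K; lra.
have sg : (gam%:R + 4) / e1 <= s by move: sK; rewrite /K; lra.
have sj : 1 + jump_bound lam beta eps gam T D0 * T < s by move: sK; rewrite /K; lra.
have s0 : 0 < s by exact: lt_le_trans s1.
have r1 : 1 <= r by rewrite -s4 exprn_ege1.
have noise_le : noise gam r (noise_level r) <= e1.
  rewrite /noise /noise_level -/s ler_pdivrMr//.
  have s3 : 1 <= s ^+ 3 by rewrite exprn_ege1.
  have h1 : 3 * s ^+ 3 + (gam%:R + 1) <= (gam%:R + 4) * s ^+ 3.
    have -> : (gam%:R + 4) * s ^+ 3 = 3 * s ^+ 3 + (gam%:R + 1) * s ^+ 3 by ring.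
    by rewrite lerD2l ler_peMr// addr_ge0.
  apply: (le_trans h1).
  have -> : e1 * r = e1 * s * s ^+ 3 by rewrite -s4; ring.
  rewrite ler_pM2r ?exprn_gt0//.
  by rewrite mulrC -ler_pdivrMr.
have nlarge : noise_level r + jump_bound lam beta eps gam T D0 * r * T < (jump_horizon r)%:R.
  apply: (@le_lt_trans _ _ (s ^+ 5)); last first.
    rewrite /jump_horizon -/s; exact: truncnS_gt.
  rewrite /noise_level -/s -s4.
  have -> : s ^+ 5 = s * s ^+ 4 by ring.
  apply: (@le_trans _ _ ((1 + jump_bound lam beta eps gam T D0 * T) * s ^+ 4)).
    have -> : (1 + jump_bound lam beta eps gam T D0 * T) * s ^+ 4 =
      s ^+ 4 + jump_bound lam beta eps gam T D0 * s ^+ 4 * T by ring.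
    by rewrite lerD2r ler_weXn2l.
  by rewrite ler_wpM2r ?exprn_ge0 ?(ltW s0)// ltW.
have iy := hy r rRy; have ix := hx r rRx.
have initE : model_state r 0 w = init r by [].
have init_le : ysc r (model_state r 0 w) ^+ 2 + xsc lam beta r (model_state r 0 w) ^+ 2 <= D0.
  rewrite initE /D0 lerD//; apply: sqr_le_norm.
    rewrite -[X in `|X|](subrK y0) addrC (le_trans (ler_normD _ _))// lerD2l distrC.
    exact: le_trans iy e11.
  rewrite -[X in `|X|](subrK x0) addrC (le_trans (ler_normD _ _))// lerD2l distrC.
  exact: le_trans ix e11.
have [nb1 nb2 nb3] : [/\ ~ model_exceeds r (@incY R) (jump_horizon r) (noise_level r) w,
   ~ model_exceeds r (@incX R) (jump_horizon r) (noise_level r) w & ~ model_exceeds r one_inc (jump_horizon r) (noise_level r) w].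
  by split=> h; apply: gw; [left|right; left|right; right].
split.
- apply: (approx_solW (le_trans noise_le e1e) (lexx _)).
  apply: good_path_approx => //.
  + by rewrite /noise_level exprn_ge0// ltW.
  + by move=> k; exact: model_hold_ge0.
  + by move=> n; exact: model_state_incY.
  + by move=> n; exact: model_state_incX.
  + exact: compensated_sum_le nb1.
  + exact: compensated_sum_le nb2.
  + exact: compensated_sum_le nb3.
  + by move=> n t tn; apply: step_pathE => // k; exact: model_hold_ge0.
  + exact: le_trans noise_le e11.
- rewrite /model_liny /liny pwlin0; last by move=> k; exact: model_hold_ge0.
  by rewrite distrC (le_trans iy).
- rewrite /model_linx /linx pwlin0; last by move=> k; exact: model_hold_ge0.
  by rewrite distrC (le_trans ix).
Qed.

Definition coupled_seed (r : R) (w : coins) : coins := resample P evens odds U (good_event r) w.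

Lemma rate_jump_rate r z z' :
  jump_rate (rate1 lam r) (rate2 beta) (rate3 eps) (tgt1 gam) (tgt2 gam) tgt3 z z' =
  rate lam beta eps gam r z z'.
Proof.
rewrite /jump_rate /rate /rate1 /rate2 /rate3; congr (_ + _ + _).
rewrite -[LHS]mulrA; congr (_ * _).
by rewrite -natrM mulnb andbC; congr (_%:R); congr nat_of_bool; case: eqP => // ->.
Qed.

Lemma coupled_ctmc r : 0 < r ->
  ctmc_jump_data P (rate lam beta eps gam r) (qtot lam beta eps r) (init r)
    (fun n w => model_state r n (coupled_seed r w)) (fun n w => model_hold r n (coupled_seed r w)).
Proof.
move=> r0.
have mg := measurable_good_event r.
have mrho : measurable_fun setT (coupled_seed r) by exact: (measurable_resample P me mo mu mg).
have mp A : measurable A -> measurable (coupled_seed r @^-1` A).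
  by move=> mA; rewrite -[X in measurable X]setTI; exact: mrho.
split; [|split].
- move=> n z; apply: (mp [set w | model_state r n w = z]).
  exact: (measurable_chain_state me mo mu).
- move=> n; apply: (measurableT_comp _ mrho).
  exact: (measurable_chain_hold me mo mu).
move=> n zs s s0.
have mE := measurable_path_event me mo mu (rate1 lam r) (rate2 beta) (rate3 eps)
  (tgt1 gam) (tgt2 gam) tgt3 n (init r) zs s.
apply: etrans (P_resample me mo mu (@coinP_U R) (@coinP_split R) mg mE) _.
apply: etrans (P_path_event me mo mu (@coinP_U R) (@coinP_split R) _ _ _
  (rate1_gt0 r0) rate2_ge0 rate3_ge0 n (init r) zs s0) _.
congr (_%:E); congr (_ * _); apply: eq_bigr => k _.
by rewrite rate_jump_rate.
Qed.

End coupling.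

(** Both are approximate solutions with error 0 and the same initial point, hence within [e] of each
    other for every positive [e]. *)
Lemma fluid_solution_unique {R : realType} (lam beta eps : R) (gam : nat) (y0 x0 : R)
    (y x y' x' : R -> R) : 0 < lam -> 0 < beta -> 0 < eps ->
  fluid_solution lam beta eps gam y0 x0 y x -> fluid_solution lam beta eps gam y0 x0 y' x' ->
  forall t, 0 <= t -> y' t = y t /\ x' t = x t.
Proof.
move=> lam0 beta0 eps0 fs fs' t t0.
have [B B0 A] := fluid_approx_sol lam0 beta0 eps0 t0 fs.
have [B' B0' A'] := fluid_approx_sol lam0 beta0 eps0 t0 fs'.
have H e : 0 < e -> `|y' t - y t| <= e /\ `|x' t - x t| <= e.
  move=> e0; have BB : 0 <= Num.max B B' by rewrite le_max B0.
  have [eta0 /andP[eta00 _] Hc] := approx_sol_close lam gam beta0 eps0 t0 BB e0.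
  have BM : B <= Num.max B B' by rewrite le_max lexx.
  have BM' : B' <= Num.max B B' by rewrite le_max lexx orbT.
  apply: (Hc 0 _ _ _ _ _ _ _ _ _ (approx_solW (lexx 0) BM' A') (approx_solW (lexx 0) BM A)).
  - by rewrite lexx ltW.
  - have [-> _] := fs; have [-> _] := fs'.
    by rewrite subrr normr0 mulr0.
  - have [_ [-> _]] := fs; have [_ [-> _]] := fs'.
    by rewrite subrr normr0 mulr0.
  - by rewrite t0 lexx.
split; apply/eqP; rewrite -subr_eq0 -normr_le0; apply/ler_addgt0Pr => e e0;
  by rewrite add0r; have [] := H e e0.
Qed.

Theorem theorem1 (R : realType) (lam beta eps : R) (gam : nat) (y0 x0 : R)
    (init : R -> state) :
  0 < lam -> 0 < beta -> 0 < eps -> (0 < gam)%N ->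
  eps < gam%:R ^+ 2 * beta / 4 ->
  - (lam / beta) <= x0 ->
  (fun r => ((init r).1)%:~R / r) @ +oo --> y0 ->
  (fun r => (((init r).2)%:R - lam * r / beta) / r) @ +oo --> x0 ->
  exists y x : R -> R,
    fluid_solution lam beta eps gam y0 x0 y x /\
    (forall y' x' : R -> R, fluid_solution lam beta eps gam y0 x0 y' x' ->
       forall t, 0 <= t -> y' t = y t /\ x' t = x t) /\
    exists (d : measure_display) (T : measurableType d) (P : probability T R)
           (Z : R -> nat -> T -> state) (S : R -> nat -> T -> R)
           (V : R -> T -> R -> state),
      (forall r, 0 < r ->
         ctmc_jump_data P (rate lam beta eps gam r) (qtot lam beta eps r)
           (init r) (Z r) (S r) /\ path_of P (Z r) (S r) (V r)) /\
      {ae P, forall w, forall Tm e : R, 0 < e -> exists R0 : R,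
         forall r t : R, R0 <= r -> 0 < r -> 0 <= t <= Tm ->
           `|((V r w t).1)%:~R / r - y t| < e /\
           `|(((V r w t).2)%:R - lam * r / beta) / r - x t| < e}.
Proof.
move=> lam0 beta0 eps0 _ _ _ cy cx.
pose good' := good_event lam beta eps gam init.
pose C : R := 6 * (gam%:R + 1) ^+ 2.
have C0 : 0 <= C by rewrite mulr_ge0 ?sqr_ge0.
(* For each value [u < 1] of the common uniform variable, all scales beyond a threshold are good;
   [K] brings the failure bound, [C] over the fourth root of [r], below [1 - u]. *)
have likely u : 0 <= u < 1 -> exists R0, forall r, R0 <= r -> 0 < r ->
    u < fine (@coinP R (good' r)).
  move=> /andP[u0 u1]; have u10 : 0 < 1 - u by rewrite subr_gt0.
  pose K := C / (1 - u) + 1.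
  have q0 : 0 <= C / (1 - u) by rewrite divr_ge0// ltW.
  have K0 : 0 <= K by rewrite addr_ge0.
  exists (K ^+ 4) => r rK r0; have sK := fourth_root_ge K0 rK.
  have s1 : 1 <= fourth_root r by apply: le_trans sK; rewrite lerDr.
  have s0 : 0 < fourth_root r by exact: lt_le_trans s1.
  apply: lt_le_trans (P_good_event gam init lam0 beta0 eps0 r0 s1).
  rewrite -/C ltrBrDr -ltrBrDl ltr_pdivrMr// mulrC -ltr_pdivrMr//.
  by apply: lt_le_trans sK; rewrite ltrDl.
have ga T (T0 : 0 <= T) := good_approx gam lam0 beta0 eps0 T0 cy cx.
(* One seed in the good event of each integer scale; for large scales this event has positive
   probability, so the choice does not fall back on the default point. *)
pose wm m : coins := xget point (good' m%:R).
have [y [x fs]] : exists y x, fluid_solution lam beta eps gam y0 x0 y x.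
  apply: (@fluid_limit R lam beta eps gam lam0 beta0 eps0 y0 x0
    (fun m t => ysc m%:R (model_path lam beta eps gam init m%:R (wm m) t))
    (fun m t => xsc lam beta m%:R (model_path lam beta eps gam init m%:R (wm m) t))
    (fun m => model_liny lam beta eps gam init m%:R (wm m))
    (fun m => model_linx lam beta eps gam init m%:R (wm m))) => T T0.
  have [B B0 HB] := ga T T0; exists B => // eta eta0.
  have [R0 hR0] := HB eta eta0.
  have [|R1 hR1] := likely 0; first by rewrite lexx ltr01.
  exists (Num.truncn (Num.max (Num.max R0 R1) 0)).+1 => m m0m.
  have : Num.max (Num.max R0 R1) 0 < m%:R.
    by apply: lt_le_trans (truncnS_gt _) _; rewrite ler_nat.
  rewrite !gt_max => /andP[/andP[mR0 mR1] m0].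
  apply: hR0 => //; first exact: ltW.
  apply: xgetPex; apply/set0P/eqP => g0.
  have := hR1 _ (ltW mR1) m0.
  by rewrite g0 measure0 ltxx.
exists y, x; split => //; split.
  by move=> y' x' fs'; exact: fluid_solution_unique lam0 beta0 eps0 fs fs'.
exists _, coins, (@coinP R),
  (fun r n w => model_state lam beta eps gam init r n (coupled_seed lam beta eps gam init r w)),
  (fun r n w => model_hold lam beta eps gam init r n (coupled_seed lam beta eps gam init r w)),
  (fun r w t => model_path lam beta eps gam init r (coupled_seed lam beta eps gam init r w) t).
split.
  move=> r r0; split; first exact: coupled_ctmc.
  apply: aeW => w n t tn; apply: step_pathE => // k.
  exact: model_hold_ge0.
(* The one exceptional event for all scales: the uniform variable read from the even coins, which
   decides every resampling, reaches 1. *)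
exists (evens @^-1` ((@coinU R) @^-1` `[1, +oo[)); split.
- by apply: measurable_evensl; rewrite -[X in measurable X]setTI; exact: measurable_coinU.
- have mB : measurable ((@coinU R) @^-1` `[1, +oo[).
    by rewrite -[X in measurable X]setTI; exact: measurable_coinU.
  have := coinP_split mB measurableT; rewrite preimage_setT setIT => ->.
  rewrite coinP_U// (_ : _ `&` _ = set0) ?measure0 ?mul0e//.
  by rewrite -subset0 => u [] /=; rewrite !in_itv/= andbT => h /andP[_]; rewrite ltNge h.
move=> w nw; apply: contrapT => wN; apply: nw => Tm e e0.
have u1 : coinU (evens w) < 1 :> R.
  by rewrite ltNge; apply/negP => h; apply: wN; rewrite /= in_itv/= h.
pose T := Num.max Tm 0.
have T0 : 0 <= T by rewrite le_max lexx orbT.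
have TmT : Tm <= T by rewrite le_max lexx.
have [B B0 HB] := ga T T0.
have [B1 B10 A1] := fluid_approx_sol lam0 beta0 eps0 T0 fs.
have BB : 0 <= Num.max B B1 by rewrite le_max B0.
have BM : B <= Num.max B B1 by rewrite le_max lexx.
have BM1 : B1 <= Num.max B B1 by rewrite le_max lexx orbT.
have e20 : 0 < e / 2 by rewrite divr_gt0.
have [eta0 /andP[eta00 _] Hc] := approx_sol_close lam gam beta0 eps0 T0 BB e20.
(* The path is within [eta <= e / 4] of its curve and the curve within [e / 2] of the fluid
   solution, so the total stays strictly below [e]. *)
pose eta := Num.min eta0 (e / 4).
have eta_gt0 : 0 < eta by rewrite lt_min eta00 divr_gt0.
have eta_le : eta <= eta0 by rewrite ge_min lexx.
have eta_e : eta <= e / 4 by rewrite ge_min lexx orbT.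
have [R0 hR0] := HB eta eta_gt0.
have [|R1 hR1] := likely (coinU (evens w)); first by rewrite coinU_ge0.
exists (Num.max R0 R1) => r t; rewrite ge_max => /andP[rR0 rR1] r0 /andP[t0 tTm].
have gw : good' r (coupled_seed lam beta eps gam init r w).
  apply: resample_in; [exact: measurable_good_event|exact: coinU_ge0|exact: hR1].
have tT : 0 <= t <= T by rewrite t0 (le_trans tTm).
have [A iy ix] := hR0 r rR0 r0 _ gw.
have [fy0 [fx0 _]] := fs.
have eta2 : eta <= 2 * eta by rewrite ler_peMl ?ler1n// ltW.
have etaE : 0 <= eta <= eta0 by rewrite eta_le ltW.
rewrite -fy0 in iy; rewrite -fx0 in ix.
have [cly clx] := Hc eta etaE _ _ _ _ _ _ _ _ (approx_solW (lexx _) BM A)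
  (approx_solW (ltW eta_gt0) BM1 A1) (le_trans iy eta2) (le_trans ix eta2) t tT.
have [_ _ /(_ t tT)[zy zx _ _ _] _] := A.
rewrite /ysc /xsc in zy zx.
split.
  apply: (@le_lt_trans _ _ (eta + e / 2)); last lra.
  by apply: le_trans (lerD zy cly); apply: ler_distD.
apply: (@le_lt_trans _ _ (eta + e / 2)); last lra.
by apply: le_trans (lerD zx clx); apply: ler_distD.
Qed.
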